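(* Let $\mu$ be an independent random cascade (as defined in the context). Let $\widetilde\varepsilon=(\varepsilon_n)_{n\ge1}$ be a sequence of positive numbers converging to $0$ such that for every $\alpha>0$ the series $\sum_{n\ge1}n\,b^{-n\alpha\varepsilon_n^2}$ converges. Assume that there is $\eta>0$ such that $\varepsilon_n\ge n^{-1/2}\log(n)^{1/2+\eta}$ for every $n$, that $J=\mathbb R$ (in particular $\widetilde\tau_\mu'(1)>0$), and that there exists $A>1$ such that with probability one $A^{-1}\le W_i\le A$ for all $0\le i\le b-1$. Let $\mathcal S_j=\Big[\exp\Big(\big(j\log(j)^{\eta}\big)^{\frac1{1+2\eta}}\Big)\Big]$; or, if there exists $\eta>0$ such that $\varepsilon_n\ge\log(n)^{-\eta}$ for every $n\ge2$, let $\mathcal S_j=[j\log(j)^{\eta'}]$ for some $\eta'>2\eta$. Let $K$ be a compact subinterval of $\mathbb R$ and $\beta=1+\max_{q\in K}|q|$. Then, with probability one, for $j$ large enough, for all $q\in K$, all $w\in\mathcal A^j$, and all $n\ge\mathcal S_j$, one has $$Y_q^w\,b^{n(\widetilde\tau_\mu'(q)q-\widetilde\tau_\mu(q)-\beta\varepsilon_n)}\le\mathcal N_n\big(\mu^w,\widetilde\tau_\mu'(q),\varepsilon_n\big)\le Y_q^w\,b^{n(\widetilde\tau_\mu'(q)q-\widetilde\tau_\mu(q)+\beta\varepsilon_n)}.$$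
   Context: $[x]$ denotes the integer part of $x$. Words and intervals. Fix an integer $b\ge2$, $\mathcal A=\{0,\dots,b-1\}$, $\mathcal A^*=\bigcup_{j\ge0}\mathcal A^j$ with $\mathcal A^0=\{\emptyset\}$. $|w|$ is the length of $w$; $v\cdot w$ (or $vw$) is concatenation; $v|k$ is the prefix of length $k$ of $v$ ($v|0=\emptyset$). For $w\in\mathcal A^j$, $i(w)=\sum_{k=1}^{j}w_kb^{j-k}$ and $I_w=[i(w)b^{-j},(i(w)+1)b^{-j}]$. $t_1t_2\dots$ denotes the $b$-adic expansion of $t\in[0,1)$ and $t|k=(t_1,\dots,t_k)$. Independent random cascade. Let $W=(W_0,\dots,W_{b-1})$ be a random vector with almost surely positive components and $\sum_{k=0}^{b-1}\mathbb E(W_k)=1$, and let $(W(w))_{w\in\mathcal A^*}$ be i.i.d. copies of $W$, $W(w)=(W_0(w),\dots,W_{b-1}(w))$. For $q\in\mathbb R$ let $\widetilde\tau_\mu(q)=-\log_b\mathbb E\big(\sum_{k=0}^{b-1}W_k^q\big)\in\mathbb R\cup\{-\infty\}$. Let $J$ be the interior of the interval $\{q\in\mathbb R:\widetilde\tau_\mu'(q)q-\widetilde\tau_\mu(q)>0\}$. (The paper also considers a critical case $\widetilde\tau_\mu'(1^-)=0$, in which $J\subset(-\infty,1)$; it is excluded here by $J=\mathbb R$.) In the case $\widetilde\tau_\mu'(1^-)>0$, the independent random cascade is $\mu=\mu^\emptyset$ where, for $v\in\mathcal A^*$, $\mu^v$ is the almost sure weak limit as $j\to\infty$ of the measures $\mu^v_j$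 on $[0,1]$ with density $b^j\prod_{k=0}^{j-1}W_{t_{k+1}}(v\cdot t|k)$ with respect to Lebesgue measure. Analyzing measures. For $q\in J$ put $W_{q,i}(w)=b^{\widetilde\tau_\mu(q)}W_i(w)^q$, and let $\mu^v_{q,j}$ be the measure on $[0,1]$ with Lebesgue density $b^j\prod_{k=0}^{j-1}W_{q,t_{k+1}}(v\cdot t|k)$. Almost surely, for all $v\in\mathcal A^*$ and all $q\in J$ simultaneously, $\mu^v_{q,j}$ converges weakly as $j\to\infty$ to a positive measure $\mu^v_q$. $Y_q^v=\Vert\mu_q^v\Vert$ is its total mass. Counting. $\mathcal N_n(\mu^w,\alpha,\varepsilon_n)=\#\{v\in\mathcal A^n: b^{-n(\alpha+\varepsilon_n)}\le\mu^w(I_v)\le b^{-n(\alpha-\varepsilon_n)}\}$. *)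

(* Defs.v *)
From HB Require Import structures.
From mathcomp Require Import all_boot all_order all_algebra.
From mathcomp Require Import all_classical all_reals all_analysis.

Set Implicit Arguments.
Unset Strict Implicit.
Unset Printing Implicit Defensive.
Import Order.TTheory GRing.Theory Num.Theory.
Import numFieldNormedType.Exports.

Local Open Scope classical_set_scope.
Local Open Scope ring_scope.

(** The left end point of I_w is i(w) b^{-|w|}, where i(w) reads [w] in base b
    with its most significant letter first. *)

Definition badic_index (b : nat) (w : seq 'I_b) : nat :=
  (\sum_(k < size w) nth 0 (map val w) k * b ^ (size w - k.+1))%N.

Definition badic_itv (R : realType) (b : nat) (w : seq 'I_b) : set R :=
  `[(badic_index w)%:R / b%:R ^+ size w,
    (badic_index w).+1%:R / b%:R ^+ size w].

(** Digits are numbered from 0: [badic_digit hb t k] is t_{k+1} for t in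
    [0, 1[.  The value at t = 1 is irrelevant, {1} being Lebesgue-null. *)
Definition badic_digit (R : realType) (b : nat) (hb : (1 < b)%N) (t : R)
    (k : nat) : 'I_b :=
  Ordinal (ltn_pmod (Num.truncn (b%:R ^+ k.+1 * t)) (ltnW hb)).

Definition badic_prefix (R : realType) (b : nat) (hb : (1 < b)%N) (t : R)
    (k : nat) : seq 'I_b :=
  [seq badic_digit hb t i | i <- iota 0 k].

(** [V w i] is the weight attached to the letter [i] at the node [w]. *)
Definition cascade_density (R : realType) (b : nat) (hb : (1 < b)%N)
    (V : seq 'I_b -> 'I_b -> R) (v : seq 'I_b) (j : nat) (t : R) : R :=
  b%:R ^+ j *
  \prod_(k < j) V (v ++ badic_prefix hb t k) (badic_digit hb t k).

(** Weak convergence, as finite measures on [0, 1], of the measures of Lebesgue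
    densities [g j] to [m].  Measures on [0, 1] are represented by measures on
    the line that do not charge the complement of [0, 1]. *)
Definition weak_cvg_density (R : realType) (g : nat -> R -> R)
    (m : {measure set R -> \bar R}) : Prop :=
  [/\ (m [set: R] < +oo)%E,
      m (~` `[0, 1]) = 0%E &
      forall f : R -> R, {within `[0, 1], continuous f} ->
        (fun j => \int[@lebesgue_measure R]_(t in `[0%R, 1%R]) (f t * g j t)%:E)%E
          @ \oo --> (\int[m]_(t in `[0%R, 1%R]) (f t)%:E)%E].

(** The weak limit; by convention the null measure if there is none. *)
Definition weak_lim_density (R : realType) (g : nat -> R -> R) :
    {measure set R -> \bar R} :=
  match pselect (exists m, weak_cvg_density g m) with
  | left h => projT1 (cid h)
  | right _ => mzero
  end.

Definition cascade_measure (R : realType) (b : nat) (hb : (1 < b)%N)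
    (V : seq 'I_b -> 'I_b -> R) (v : seq 'I_b) : {measure set R -> \bar R} :=
  weak_lim_density (cascade_density hb V v).

Definition counting_N (R : realType) (b n : nat)
    (m : {measure set R -> \bar R}) (alpha eps : R) : nat :=
  #|[pred v : n.-tuple 'I_b |
      ((b%:R `^ (- (n%:R * (alpha + eps))))%:E <= m (badic_itv v)
        <= (b%:R `^ (- (n%:R * (alpha - eps))))%:E)%E]|.

Definition mutually_independent (d d' : measure_display)
    (T : measurableType d) (T' : measurableType d') (R : realType)
    (P : probability T R) (I : eqType) (X : I -> {RV P >-> T'}) : Prop :=
  forall (s : seq I) (B : I -> set T'), uniq s ->
    (forall i, measurable (B i)) ->
    P (\bigcap_(i in [set` s]) X i @^-1` B i) =
    (\prod_(i <- s) P (X i @^-1` B i))%E.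

Definition same_law (d d' : measure_display)
    (T : measurableType d) (T' : measurableType d') (R : realType)
    (P : probability T R) (X Y : {RV P >-> T'}) : Prop :=
  forall B : set T', measurable B -> distribution P X B = distribution P Y B.

Section moment_function.
Context (d : measure_display) (T : measurableType d) (R : realType).
Context (P : probability T R) (b : nat) (W : {RV P >-> b.-tuple R}).

Definition tau_ext (q : R) : \bar R :=
  (- (lne 'E_P[(fun x => \sum_(k < b) tnth (W x) k `^ q)%R] * (ln b%:R)^-1%:E))%E.

Definition tau (q : R) : R := fine (tau_ext q).

Definition dtau (q : R) : R := derive1 tau q.

(** Outside the domain of finiteness of [tau_ext] there is no derivative, hence
    the first conjunct. *)
Definition J_set : set R :=
  [set q | tau_ext q \is a fin_num /\ 0 < dtau q * q - tau q]^°.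

End moment_function.

(** The measures mu^v and mu_q^v of the realization [W ^~ x]; the second one
    uses the weights b^{tau(q)} W_i(w)^q, where [W0] is the generic vector. *)
Definition mu_cascade (d : measure_display) (T : measurableType d)
    (R : realType) (P : probability T R) (b : nat) (hb : (1 < b)%N)
    (W : seq 'I_b -> {RV P >-> b.-tuple R}) (x : T) (v : seq 'I_b) :
    {measure set R -> \bar R} :=
  cascade_measure hb (fun w i => tnth (W w x) i) v.

Definition mu_analyzing (d : measure_display) (T : measurableType d)
    (R : realType) (P : probability T R) (b : nat) (hb : (1 < b)%N)
    (W0 : {RV P >-> b.-tuple R}) (W : seq 'I_b -> {RV P >-> b.-tuple R})
    (q : R) (x : T) (v : seq 'I_b) : {measure set R -> \bar R} :=
  cascade_measure hb
    (fun w i => b%:R `^ tau W0 q * tnth (W w x) i `^ q) v.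

Definition Y_mass (d : measure_display) (T : measurableType d)
    (R : realType) (P : probability T R) (b : nat) (hb : (1 < b)%N)
    (W0 : {RV P >-> b.-tuple R}) (W : seq 'I_b -> {RV P >-> b.-tuple R})
    (q : R) (x : T) (v : seq 'I_b) : R :=
  fine (mu_analyzing hb W0 W q x v [set: R]).

(* Main.v *)
(** Idea.  Write e(q) = q tau'(q) - tau(q).  Since e > 0 everywhere, the bounded
    variables b^tau(q) W_i^q are almost surely at most theta < 1, uniformly for
    q in a compact set: b^(n tau(p)) E sum_i W_i^(n p) = b^(n tau(p) - tau(n p))
    stays bounded as n grows.  Let Y_n be the mass at generation n of a cascade
    with such weights.  Given the first n generations, Y_(n+1) - Y_n is a sum of
    independent centred variables, the squares of whose sizes add up to at most a
    constant times theta^n Y_n, so Hoeffding's inequality and the Borel-Cantelli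
    lemma bound it by a constant times n theta^(n/2) max(1, Y_n), simultaneously for all words and all q in a
    grid of mesh b^-n, and then for all q.  It follows that almost surely, for
    all words v long enough and all q in the compact set, Y_q^v lies between
    1/P and P with P polynomial in |v|.

    The rest is deterministic.  In Y_q^w = sum_(u in A^n) Q_q(u) Y_q^(wu), the
    words u with mu^w(I_u) outside b^(-n (tau'(q) -+ eps)) contribute at most
    P^2 b^(-c n eps^2), by comparison with the masses at q +- h, with h
    proportional to eps; this is less than Y_q^w / 2, because n eps_n^2 dominates
    log n.  For the remaining u, Q_q(u) is b^(-n e(q)) up to a factor b^(n |q| eps)
    and a power of P. *)
Require Import Defs.
From HB Require Import structures.
From mathcomp Require Import all_boot all_order all_algebra.
From mathcomp Require Import all_classical all_reals all_analysis.
From mathcomp Require Import measurable_realfun ring lra.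

Set Implicit Arguments.
Unset Strict Implicit.
Unset Printing Implicit Defensive.
Import Order.TTheory GRing.Theory Num.Theory.
Import numFieldNormedType.Exports.

Local Open Scope classical_set_scope.
Local Open Scope ring_scope.

(** * Words and partial masses *)

(** The lower bound on the masses is the obstacle: the first generations below a word v fluctuate by
    a factor of order one. The masses at the words of length l + k below v, l = |v|, are therefore
    averaged with equal weights b^-k. This average starts at 1 and its relative increments add up to
    at most a constant times (l + k) b^(-k/2), so with k about 4 log_b l it never leaves [1/2, 3/2];
    restoring the true weights, each at least b^-g, costs b^(g k), a power of l. Hence the
    polynomial P.

    The union bound is affordable because exponential moments are controlled: level L involves about
    b^(4 L) estimates, and the logarithm of b^(5 L) is only a factor linear in L, harmless against
    theta^(L/2). Dividing by max(1, Y_n) keeps the exponent bounded without any prior bound on Y_n.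

    Weights are clipped to an interval that contains them almost surely, so that the bounds hold
    everywhere and, outside a null set, the rest concerns one realization. *)

Section word_sums.
Context (R : realType) (b : nat).
Implicit Types (V : seq 'I_b -> 'I_b -> R) (v u : seq 'I_b) (F : seq 'I_b -> R).

Lemma sum_tuple_cat m n F :
  \sum_(u : (m + n).-tuple 'I_b) F u =
  \sum_(u1 : m.-tuple 'I_b) \sum_(u2 : n.-tuple 'I_b) F (u1 ++ u2).
Proof.
rewrite pair_big /=.
have tk (u : (m + n).-tuple 'I_b) : size (take m u) == m.
  by rewrite size_take size_tuple; case: ltnP => // h; rewrite eqn_leq h leq_addr.
have dr (u : (m + n).-tuple 'I_b) : size (drop m u) == n.
  by rewrite size_drop size_tuple addKn.
rewrite (reindex (fun p : m.-tuple 'I_b * n.-tuple 'I_b => cat_tuple p.1 p.2)) //=.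
apply: onW_bij; exists (fun u : (m + n).-tuple _ => (Tuple (tk u), Tuple (dr u))).
- move=> [u1 u2]; congr pair; apply: val_inj => /=.
  + by rewrite take_size_cat // size_tuple.
  + by rewrite drop_size_cat // size_tuple.
- by move=> u; apply: val_inj; rewrite /= cat_take_drop.
Qed.

Lemma sum_tuple1 F : \sum_(u : 1.-tuple 'I_b) F u = \sum_(c < b) F [:: c].
Proof.
rewrite (reindex (fun c : 'I_b => [tuple c])) //=.
apply: onW_bij; exists (fun u : 1.-tuple _ => thead u) => [c|u]; first by rewrite theadE.
by rewrite [u in RHS]tuple_eta; apply: val_inj => /=; case: u => -[|x [|]].
Qed.

Lemma sum_tupleSr n F :
  \sum_(u : n.+1.-tuple 'I_b) F u =
  \sum_(u : n.-tuple 'I_b) \sum_(c < b) F (rcons u c).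
Proof.
rewrite -addn1 sum_tuple_cat; apply: eq_bigr => u _.
by rewrite (sum_tuple1 (fun u' => F (u ++ u'))); under eq_bigr do rewrite cats1.
Qed.

Fixpoint cw V v u : R :=
  if u is c :: u' then V v c * cw V (rcons v c) u' else 1.

Lemma cw_cat V v u1 u2 : cw V v (u1 ++ u2) = cw V v u1 * cw V (v ++ u1) u2.
Proof.
elim: u1 v => [|c u1 IH] v /=; first by rewrite mul1r cats0.
by rewrite IH mulrA cat_rcons.
Qed.

Lemma cw_rcons V v u c : cw V v (rcons u c) = cw V v u * V (v ++ u) c.
Proof. by rewrite -cats1 cw_cat /= mulr1. Qed.

Lemma cw_ge0 V v u : (forall w c, 0 <= V w c) -> 0 <= cw V v u.
Proof. by move=> V0; elim: u v => //= c u IH v; rewrite mulr_ge0. Qed.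

Lemma cw_le V v u t : (forall w c, 0 <= V w c <= t) -> cw V v u <= t ^+ size u.
Proof.
move=> Vt; have V0 w c : 0 <= V w c by case/andP: (Vt w c).
elim: u v => //= c u IH v; rewrite exprS ler_pM ?cw_ge0 //.
by case/andP: (Vt v c).
Qed.

Lemma cw_ge V v u t : 0 <= t -> (forall w c, t <= V w c) -> t ^+ size u <= cw V v u.
Proof.
move=> t0 Vt; elim: u v => //= c u IH v.
by rewrite exprS ler_pM ?exprn_ge0.
Qed.

(** Total mass of the n-th cascade density at [v], which equals b^n [cw V v u] on the b-adic
    interval of [u], of length b^-n. *)
Definition Ym V v n : R := \sum_(u : n.-tuple 'I_b) cw V v u.

Lemma Ym_ge0 V v n : (forall w c, 0 <= V w c) -> 0 <= Ym V v n.
Proof. by move=> V0; apply: sumr_ge0 => u _; exact: cw_ge0. Qed.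

Lemma Ym_add V v m n :
  Ym V v (m + n) = \sum_(u : m.-tuple 'I_b) cw V v u * Ym V (v ++ u) n.
Proof.
rewrite /Ym sum_tuple_cat; apply: eq_bigr => u _; rewrite big_distrr /=.
by apply: eq_bigr => u' _; rewrite cw_cat.
Qed.

Lemma YmSr V v n :
  Ym V v n.+1 = \sum_(u : n.-tuple 'I_b) cw V v u * \sum_(c < b) V (v ++ u) c.
Proof.
rewrite /Ym sum_tupleSr; apply: eq_bigr => u _; rewrite big_distrr /=.
by apply: eq_bigr => c _; rewrite cw_rcons.
Qed.

Lemma card_tupleR n : \sum_(u : n.-tuple 'I_b) (1 : R) = b%:R ^+ n.
Proof. by rewrite sumr_const card_tuple card_ord natrX. Qed.

End word_sums.

(** * Hoeffding's inequality for a cascade *)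

Section independence.
Context (d d' : measure_display) (T : measurableType d)
  (T' : measurableType d') (R : realType) (P : probability T R) (I : eqType)
  (X : I -> {RV P >-> T'}).

(** A pi-system, so that finite measures that agree on it agree on the sigma-algebra it generates.
    Turning that sigma-algebra into a measurable type on [T] makes dependence on the variables other
    than [X v] an ordinary measurability statement. *)
Definition cylinders_off (v : I) : set (set T) :=
  [set A | exists (s : seq I) (B : I -> set T'), [/\ v \notin s,
     forall i, measurable (B i) & A = \bigcap_(i in [set` s]) X i @^-1` B i]].

(* [T] with the sigma-algebra generated by the [X i], [i != v]. *)
Definition off_type (v : I) : measurableType _ :=
  g_sigma_algebraType (cylinders_off v).

Lemma measurable_cylinder (s : seq I) (B : I -> set T') :
  (forall i, measurable (B i)) ->
  measurable (\bigcap_(i in [set` s]) X i @^-1` B i).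
Proof.
move=> mB; apply: fin_bigcap_measurable => [|i _]; first exact: finite_seq.
by rewrite -[X in measurable X]setTI; exact: measurable_funPT.
Qed.

Lemma cylinders_off_measurable v : cylinders_off v `<=` measurable.
Proof. by move=> A [s [B [_ mB ->]]]; exact: measurable_cylinder. Qed.

Lemma cylinders_offI v : setI_closed (cylinders_off v).
Proof.
move=> _ _ [s [B [vs mB ->]]] [t [C [vt mC ->]]].
pose D i := (if i \in s then B i else setT) `&` (if i \in t then C i else setT).
exists (s ++ t), D; split; first by rewrite mem_cat negb_or vs.
- by move=> i; apply: measurableI; case: ifP.
- apply/seteqP; split=> x /=.
  + move=> [hB hC] i /=; rewrite /D => _; split.
    * by case: ifP => // is_; exact: (hB i).
    * by case: ifP => // is_; exact: (hC i).
  + move=> h; split=> i /= hi.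
    * by have [] := h i; rewrite /= ?mem_cat ?hi //.
    * by have [] := h i; rewrite /= ?mem_cat ?hi ?orbT.
Qed.

Lemma off_typeW (v : I) (A : set T) :
  (measurable : set (set (off_type v))) A -> measurable A.
Proof.
apply: smallest_sub; [exact: sigma_algebra_measurable|].
exact: cylinders_off_measurable.
Qed.

Lemma measurable_off_fun (v i : I) :
  i != v -> measurable_fun setT (X i : off_type v -> T').
Proof.
move=> iv _ B mB; rewrite setTI; apply: sub_sigma_algebra.
exists [:: i], (fun=> B); split => //; first by rewrite inE eq_sym.
by rewrite set_cons1 bigcap_set1.
Qed.

Lemma measurable_fun_offW (v : I) d2 (T2 : measurableType d2) (F : T -> T2) :
  measurable_fun setT (F : off_type v -> T2) -> measurable_fun setT F.
Proof. by move=> mF _ B mB; apply: (@off_typeW v); exact: mF. Qed.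

Hypothesis indep : mutually_independent X.

(** As functions of A both sides are finite measures; mutual independence makes them equal on the
    pi-system [cylinders_off v], hence on all of [off_type v]. *)
Lemma indep_off (v : I) (A : set T) (E : set T') : measurable E ->
  (measurable : set (set (off_type v))) A ->
  P (A `&` X v @^-1` E) = (P A * P (X v @^-1` E))%E.
Proof.
move=> mE mA.
have mXE : measurable (X v @^-1` E).
  by rewrite -[X in measurable X]setTI; exact: measurable_funPT.
have pfin : (P (X v @^-1` E)) \is a fin_num by exact: fin_num_measure.
have p0 : 0 <= fine (P (X v @^-1` E)) by exact: fine_ge0.
pose m2 := mscale (NngNum p0) P.
have m2E B : m2 B = (P B * P (X v @^-1` E))%E.
  by rewrite /m2 /mscale /= fineK // muleC.
rewrite -m2E -[LHS]/(mrestr P mXE A).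
apply: (@g_sigma_algebra_measure_unique _ R T (cylinders_off v)
  (@cylinders_off_measurable v) (fun=> setT)) => //.
- move=> _; exists [::], (fun=> setT); split => //.
  by apply/seteqP; split.
- by rewrite bigcup_const.
- exact: cylinders_offI.
- move=> _ [s [B [vs mB ->]]].
  rewrite [RHS]m2E /mrestr.
  have mB' i : measurable (if i == v then E else B i) by case: ifP.
  (* [mutually_independent] speaks of duplicate-free families only, whence [undup s]. *)
  have us : uniq (v :: undup s) by rewrite /= mem_undup vs undup_uniq.
  have us' : uniq (undup s) by exact: undup_uniq.
  have := indep us mB'; rewrite big_cons eqxx muleC.
  have -> : \bigcap_(i in [set` v :: undup s]) X i @^-1` (if i == v then E else B i)
    = (\bigcap_(i in [set` s]) X i @^-1` B i) `&` X v @^-1` E.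
    apply/seteqP; split => x /=.
    + move=> h; split; last by have := h v; rewrite /= inE eqxx; exact.
      move=> i /= si; have := h i; rewrite /= inE mem_undup si orbT => /(_ isT).
      by case: eqP => // iv; move: vs; rewrite -iv si.
    + move=> [h hv] i /=; rewrite inE mem_undup; case: eqP => [-> //|_ /= si].
      exact: h.
  move=> eq1; rewrite [LHS]eq1; congr (_ * _)%E.
  have -> : \bigcap_(i in [set` s]) X i @^-1` B i =
            \bigcap_(i in [set` undup s]) X i @^-1` B i.
    by congr bigcap; apply/seteqP; split => i /=; rewrite mem_undup.
  rewrite (indep us' mB) ; apply: eq_big_seq => i; rewrite mem_undup => si.
  by case: eqP => // iv; move: vs; rewrite -iv si.
- move=> k; apply: (le_lt_trans _ (ltry 1)); apply: probability_le1.
  exact: measurableI.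
Qed.

(** By [indep_off] the law of the pair (F, X v) is the product of its marginals, and Tonelli's
    theorem splits the integral. *)
Lemma ge0_integral_indep (v : I) (F : T -> R) (h : T' -> R) :
  measurable_fun setT (F : off_type v -> R) -> measurable_fun setT h ->
  (forall x, 0 <= F x) -> (forall y, 0 <= h y) ->
  (\int[P]_x (F x * h (X v x))%:E =
   \int[P]_x (F x)%:E * \int[P]_x (h (X v x))%:E)%E.
Proof.
move=> mF mh F0 h0.
have mFT : measurable_fun setT F by exact: measurable_fun_offW mF.
pose FX : {RV P >-> R} := HB.pack F (isMeasurableFun.Build _ _ _ _ _ mFT).
have mp : measurable_fun setT (fun x => (F x, X v x)) by exact: measurable_fun_pair.
pose Z : {RV P >-> (R * T')%type} :=
  HB.pack (fun x => (F x, X v x)) (isMeasurableFun.Build _ _ _ _ _ mp).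
have law : forall C, measurable C ->
    (distribution P FX \x distribution P (X v))%E C = distribution P Z C.
  apply: product_measure_unique => A B mA mB.
  rewrite /distribution /pushforward /=.
  rewrite -[LHS]/(P (F @^-1` A `&` X v @^-1` B)) indep_off //.
  by rewrite -[X in _ X]setTI; exact: mF.
(* The absolute value makes the integrand nonnegative on the whole product, as Tonelli's theorem
   requires; it vanishes again because F >= 0. *)
pose f (z : R * T') : \bar R := (`|z.1| * h z.2)%:E.
have mf : measurable_fun [set: (R * T')%type] f.
  apply/measurable_EFinP; apply: measurable_funM => //.
  - exact: measurableT_comp.
  - exact: measurableT_comp.
have f0 z : (0 <= f z)%E by rewrite lee_fin mulr_ge0.
transitivity (\int[distribution P Z]_z f z)%E.
  rewrite ge0_integral_distribution //.
  by apply: eq_integral => x _; rewrite /f /= ger0_norm.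
rewrite -(@eq_measure_integral _ _ _ _ _ (distribution P FX \x distribution P (X v))%E); last first.
  by move=> C mC _; exact: law.
rewrite (@fubini_tonelli1 _ _ _ _ _ _ _ f) //= /fubini_F.
have inner (x : R) : (\int[distribution P (X v)]_y f (x, y) =
    `|x|%:E * \int[P]_y (h (X v y))%:E)%E.
  rewrite ge0_integral_distribution //=; last first.
    by apply/measurable_EFinP; apply: measurable_funM => //=; exact: measurable_cst.
  rewrite /f /=; under eq_integral do rewrite EFinM.
  rewrite ge0_integralZl //.
  - by apply/measurable_EFinP; exact: measurableT_comp.
  - by move=> y _; rewrite lee_fin.
under eq_integral do rewrite inner.
have c0 : (0 <= \int[P]_y (h (X v y))%:E)%E.
  by apply: integral_ge0 => y _; rewrite lee_fin.
rewrite ge0_integral_distribution //=; last 2 first.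
- apply: emeasurable_funM => //; apply/measurable_EFinP.
  exact: normr_measurable.
- by move=> x; rewrite mule_ge0.
under eq_integral do rewrite muleC.
rewrite ge0_integralZl //.
- rewrite muleC; congr (_ * _)%E.
  by apply: eq_integral => x _; rewrite ger0_norm.
- by apply/measurable_EFinP; exact: measurableT_comp.
Qed.

End independence.

(** Here e^y <= 1 / (1 - y), and (1 - y)(1 + y + 2 y^2) = 1 + y^2 (1 - 2 y) >= 1. *)
Lemma expR_le_quadratic (R : realType) (y : R) :
  y <= 2^-1 -> expR y <= 1 + y + 2 * y ^+ 2.
Proof.
move=> yle; have y1 : 0 < 1 - y by lra.
have h : expR y <= (1 - y)^-1.
  rewrite -[expR y]invrK -expRN lef_pV2 ?posrE ?expR_gt0 //.
  by have := expR_ge1Dx (- y); lra.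
apply: (le_trans h); rewrite -[leLHS]mul1r ler_pdivrMr //.
have : 0 <= y ^+ 2 * (1 - 2 * y) by rewrite mulr_ge0 ?sqr_ge0 //; lra.
by nra.
Qed.

Section hoeffding.
Context (d d' : measure_display) (T : measurableType d)
  (T' : measurableType d') (R : realType) (P : probability T R) (I : eqType)
  (X : I -> {RV P >-> T'}).
Hypothesis indep : mutually_independent X.
Variables (Z : T' -> R) (C : R).
Hypotheses (mZ : measurable_fun setT Z) (ZC : forall y, `|Z y| <= C)
  (EZ : forall i, (\int[P]_x (Z (X i x) + C)%:E = C%:E)%E).

Let C0 : 0 <= C.
Proof. by apply: le_trans (ZC point). Qed.

(** With t = 2 (C s)^2 and s' = s e^-t one has e^(s z - t) <= (1 + t + s z) e^-t <= 1 + s' z, and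
    the linear term has mean zero given the other variables. The hypothesis [EZ] expresses the
    centring of Z through the nonnegative function Z + C. *)
Lemma hoeffding_step (v : I) (F s : T -> R) :
  measurable_fun setT (F : off_type X v -> R) ->
  measurable_fun setT (s : off_type X v -> R) ->
  (forall x, 0 <= F x) -> (forall x, 0 <= s x) ->
  (forall x, s x * C <= 2^-1) ->
  (\int[P]_x (F x * expR (s x * Z (X v x) - 2 * (C * s x) ^+ 2))%:E
    <= \int[P]_x (F x)%:E)%E.
Proof.
move=> mF ms F0 s0 sC.
pose s' x := s x * expR (- (2 * (C * s x) ^+ 2)).
have s'0 x : 0 <= s' x by rewrite mulr_ge0 // expR_ge0.
have s's x : s' x <= s x.
  rewrite ler_piMr // -expR0 ler_expR oppr_le0 mulr_ge0 // sqr_ge0 //.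
have s'C x : s' x * C <= 2^-1 by apply: le_trans (sC x); exact: ler_wpM2r.
have ms' : measurable_fun setT (s' : off_type X v -> R).
  apply: measurable_funM => //; apply: measurableT_comp => //.
  apply: measurableT_comp => //; apply: measurable_funM => //.
  by apply: measurable_funX; exact: measurable_funM.
have m1 : measurable_fun setT ((fun x => F x * (1 - s' x * C)) : off_type X v -> R).
  apply: measurable_funM => //; apply: measurable_funB => //.
  exact: measurable_funM.
have m2 : measurable_fun setT ((fun x => F x * s' x) : off_type X v -> R).
  exact: measurable_funM.
have mZC : measurable_fun setT (fun y => Z y + C) by exact: measurable_funD.
have ZC0 y : 0 <= Z y + C.
  by have := ZC y; rewrite ler_norml => /andP[]; lra.
have t1 x : 0 <= F x * (1 - s' x * C).
  by rewrite mulr_ge0 // subr_ge0; apply: le_trans (s'C x) _; lra.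
have t2 x : 0 <= F x * s' x by rewrite mulr_ge0.
have mFT := measurable_fun_offW mF.
have msT := measurable_fun_offW ms.
have m1T := measurable_fun_offW m1.
have m2T := measurable_fun_offW m2.
have mZX : measurable_fun setT (fun x => Z (X v x)) by exact: measurableT_comp.
have mZCX : measurable_fun setT (fun x => Z (X v x) + C) by exact: measurable_funD.
(* Writing 1 + s' Z as (1 - s' C) + s' (Z + C) leaves only integrals of nonnegative functions. *)
apply: (@le_trans _ _ (\int[P]_x (F x * (1 - s' x * C) +
    F x * s' x * (Z (X v x) + C))%:E)%E).
  apply: ge0_le_integral => //.
  - by move=> x _; rewrite lee_fin mulr_ge0 // expR_ge0.
  - apply/measurable_EFinP; apply: measurable_funM => //.
    apply: measurableT_comp => //; apply: measurable_funB.
      exact: measurable_funM.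
    apply: measurable_funM => //.
    by apply: measurable_funX; exact: measurable_funM.
  - apply/measurable_EFinP; apply: measurable_funD => //.
    exact: measurable_funM.
  - move=> x _; rewrite lee_fin -mulrA -mulrDr ler_wpM2l //.
    set z := Z _; set t := 2 * _.
    have Zz : `|z| <= C by exact: ZC.
    have sz : `|s x * z| <= s x * C by rewrite normrM (ger0_norm (s0 x)) ler_wpM2l.
    have q : expR (s x * z) <= 1 + s x * z + t.
      apply: le_trans (expR_le_quadratic _) _.
        by apply: le_trans (sC x); apply: le_trans sz; exact: ler_norm.
      rewrite lerD2l /t ler_wpM2l // -[leLHS]real_normK ?num_real //.
      by apply: lerXn2r; rewrite ?nnegrE ?normr_ge0 ?mulr_ge0 // (mulrC C).
    rewrite expRD; apply: le_trans (ler_wpM2r (expR_ge0 _) q) _.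
    have -> : 1 - s' x * C + s' x * (z + C) = 1 + s x * z * expR (- t).
      by rewrite /s' -/t; ring.
    have -> : (1 + s x * z + t) * expR (- t) = (1 + t) * expR (- t) + s x * z * expR (- t) by ring.
    rewrite lerD2r.
    by rewrite expRN ler_pdivrMr ?expR_gt0 // mul1r; exact: expR_ge1Dx.
under eq_integral do rewrite EFinD.
rewrite ge0_integralD //; first last.
- by apply/measurable_EFinP; exact: measurable_funM.
- by move=> x _; rewrite lee_fin mulr_ge0.
- exact/measurable_EFinP.
- by move=> x _; rewrite lee_fin.
have -> := @ge0_integral_indep _ _ _ _ _ _ _ _ indep v _ (fun y => Z y + C) m2 mZC t2 ZC0.
rewrite EZ -ge0_integralZr //; first last.
- by move=> x _; rewrite lee_fin.
- exact/measurable_EFinP.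
rewrite -ge0_integralD //; first last.
- by apply/measurable_EFinP; exact: measurable_funM.
- by move=> x _; rewrite lee_fin mulr_ge0.
- exact/measurable_EFinP.
- by move=> x _; rewrite lee_fin.
apply: ge0_le_integral => //.
- by move=> x _; rewrite -EFinM -EFinD lee_fin; apply: addr_ge0 => //; apply: mulr_ge0.
- by apply/measurable_EFinP; apply: measurable_funD => //; exact: measurable_funM.
- exact/measurable_EFinP.
- move=> x _; rewrite -EFinM -EFinD lee_fin.
  by rewrite le_eqVlt; apply/orP; left; apply/eqP; ring.
Qed.

(** No coefficient [s u] involves a variable [X v] with v in r, so the factors are integrated out
    one at a time, the remaining product being the F of [hoeffding_step]. *)
Lemma hoeffding_prod (r : seq I) (s : I -> T -> R) : uniq r ->
  (forall u v, u \in r -> v \in r -> measurable_fun setT (s u : off_type X v -> R)) ->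
  (forall u x, u \in r -> 0 <= s u x) ->
  (forall u x, u \in r -> s u x * C <= 2^-1) ->
  (\int[P]_x (\prod_(u <- r) expR (s u x * Z (X u x) - 2 * (C * s u x) ^+ 2))%:E
    <= 1)%E.
Proof.
elim: r => [_ _ _ _|v r IH /=].
  by under eq_integral do rewrite big_nil; rewrite integral_cst // mul1e probability_le1.
move=> /andP[vr ur] ms s0 sC.
under eq_integral do rewrite big_cons mulrC.
apply: (le_trans (hoeffding_step (v := v) _ _ _ _ _)).
- apply: measurable_prod => u ur'.
  have uv : u != v by apply: contraNneq vr => <-.
  have mu : measurable_fun setT (s u : off_type X v -> R).
    by apply: ms; rewrite inE ?ur' ?orbT ?eqxx.
  apply: measurableT_comp => //; apply: measurable_funB.
    apply: measurable_funM => //; apply: measurableT_comp => //.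
    exact: measurable_off_fun.
  by apply: measurable_funM => //; apply: measurable_funX; exact: measurable_funM.
- by apply: ms; rewrite inE eqxx.
- by move=> x; apply: prodr_ge0 => u _; exact: expR_ge0.
- by move=> x; apply: s0; rewrite inE eqxx.
- by move=> x; apply: sC; rewrite inE eqxx.
apply: IH => //.
- by move=> u w ur' wr; apply: ms; rewrite inE ?ur' ?wr orbT.
- by move=> u x ur'; apply: s0; rewrite inE ur' orbT.
- by move=> u x ur'; apply: sC; rewrite inE ur' orbT.
Qed.

End hoeffding.

Section cascade_measurability.
Context (d : measure_display) (T : measurableType d) (R : realType) (b : nat).
Variable V : T -> seq 'I_b -> 'I_b -> R.

Lemma measurable_cw (v u : seq 'I_b) :
  (forall w i, (size w < size v + size u)%N -> measurable_fun setT (fun x => V x w i)) ->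
  measurable_fun setT (fun x => cw (V x) v u).
Proof.
elim: u v => [|c u IH] v mV /=; first exact: measurable_cst.
apply: measurable_funM; first by apply: mV; rewrite -addSnnS ltn_addr.
by apply: IH => w i; rewrite size_rcons addSnnS; exact: mV.
Qed.

Lemma measurable_Ym (v : seq 'I_b) n :
  (forall w i, (size w < size v + n)%N -> measurable_fun setT (fun x => V x w i)) ->
  measurable_fun setT (fun x => Ym (V x) v n).
Proof.
move=> mV; apply: measurable_sum => u; apply: measurable_cw => w i.
by rewrite size_tuple; exact: mV.
Qed.

End cascade_measurability.

(* With c = |v| + k, the mass of [uniform_below c V] at v is the average of the
   masses of V at the words v ++ u, u of length k: the large deviation estimate
   for this modified cascade is what bounds the masses at all long words at once. *)
Definition uniform_below (R : realType) (b c : nat) (V : seq 'I_b -> 'I_b -> R)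
    (w : seq 'I_b) (i : 'I_b) : R :=
  if (size w < c)%N then b%:R^-1 else V w i.

Section cascade_hoeffding.
Context (d d' : measure_display) (T : measurableType d)
  (T' : measurableType d') (R : realType) (P : probability T R) (b : nat)
  (W : seq 'I_b -> {RV P >-> T'}).
Hypothesis indep : mutually_independent W.
Variables (phi : T' -> 'I_b -> R) (C : R).
Hypotheses (mphi : forall i, measurable_fun setT (phi ^~ i))
  (phi0 : forall y i, 0 <= phi y i)
  (C1 : 1 <= C)
  (phiC : forall y, `|\sum_(i < b) phi y i - 1| <= C)
  (Ephi : forall w, (\int[P]_x (\sum_(i < b) phi (W w x) i)%:E = 1)%E).

Let V c x := uniform_below c (fun w i => phi (W w x) i).

Let V0 c x w i : 0 <= V c x w i.
Proof. by rewrite /V /uniform_below; case: ifP => // _; rewrite invr_ge0. Qed.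

(** As c <= |v| + N, generation N carries the true weights, and the increment is the sum over u of
    cw(u) times a centred variable bounded by C. Since the cw(u)^2 add up to at most a Y_N, and Y_N
    <= max(1, Y_N)^2, the factor (2 C sqrt a)^-1 brings the quadratic corrections to a total of at
    most 1/2; finally e^(1/2) <= 2. *)
Lemma cascade_hoeffding (c : nat) (v : seq 'I_b) (N : nat) (a : R) (sg : bool) :
  0 < a <= 1 -> (c <= size v + N)%N ->
  (forall x (u : N.-tuple 'I_b), cw (V c x) v u <= a) ->
  (\int[P]_x (expR ((-1) ^+ sg * (2 * C * Num.sqrt a)^-1 *
      ((Ym (V c x) v N.+1 - Ym (V c x) v N) / Num.max 1 (Ym (V c x) v N))))%:E
    <= 2%:E)%E.
Proof.
move=> /andP[a0 a1] cN cwa.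
have C0 : 0 < C by apply: lt_le_trans C1.
pose Z y := (-1) ^+ sg * (\sum_(i < b) phi y i - 1).
pose lam := (2 * C * Num.sqrt a)^-1.
pose M x := Num.max 1 (Ym (V c x) v N).
have sa0 : 0 < Num.sqrt a by rewrite sqrtr_gt0.
have lam0 : 0 <= lam by rewrite invr_ge0 !mulr_ge0 // ltW.
have M1 x : 1 <= M x by rewrite le_max lexx.
have M0 x : 0 < M x by apply: lt_le_trans (M1 x).
(* Coefficients are indexed by nodes, as in [hoeffding_prod]; for a node w = v ++ u,
   [drop (size v) w] gives back u. *)
pose s (w : seq 'I_b) x := lam * cw (V c x) v (drop (size v) w) * (M x) `^ (-1).
have sE (u : N.-tuple 'I_b) x : s (v ++ u) x = lam * cw (V c x) v u / M x.
  by rewrite /s drop_size_cat // powR_inv1 // ltW.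
pose r := [seq v ++ val u | u <- index_enum (N.-tuple 'I_b)].
have rP w : w \in r -> exists u : N.-tuple 'I_b, w = v ++ u.
  by move=> /mapP[u _ ->]; exists u.
have mZ : measurable_fun setT Z.
  apply: measurable_funM => //; apply: measurable_funB => //.
  exact: measurable_sum.
have ZC y : `|Z y| <= C by rewrite /Z normrM normrX normrN1 expr1n mul1r.
have mphiW w i : measurable_fun setT (fun x => phi (W w x) i).
  exact: measurableT_comp (mphi i) _.
have mS w : measurable_fun setT (fun x => \sum_(i < b) phi (W w x) i).
  exact: measurable_sum.
have EZ w : (\int[P]_x (Z (W w x) + C)%:E = C%:E)%E.
  have S0 x : 0 <= \sum_(i < b) phi (W w x) i by apply: sumr_ge0.
  have C10 : 0 <= C - 1 by rewrite subr_ge0.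
  (* For the sign -1 the mean of Z + C is obtained by adding the sum of the weights, of mean 1, and
     cancelling it afterwards: both integrands are nonnegative. *)
  case: sg @Z mZ ZC => Z mZ ZC.
  - have e1 : (\int[P]_x (Z (W w x) + C)%:E + \int[P]_x (\sum_(i < b) phi (W w x) i)%:E
        = C%:E + 1)%E.
      rewrite -ge0_integralD //.
      + have ZE y : Z y + C + \sum_(i < b) phi y i = C + 1 by rewrite /Z expr1; ring.
        under eq_integral do rewrite -EFinD ZE.
        rewrite integral_cst //; rewrite [X in (_ * X)%E](@probability_setT _ _ _ P).
        by rewrite mule1.
      + by move=> x _; rewrite lee_fin; have := ZC (W w x); rewrite ler_norml => /andP[]; lra.
      + apply/measurable_EFinP; apply: measurable_funD => //.
        exact: measurableT_comp.
      + by move=> x _; rewrite lee_fin.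
      + exact/measurable_EFinP.
    by move: e1; rewrite Ephi => /(congr1 (fun y => y - 1)%E); rewrite !addeK.
  - have ZE y : Z y + C = \sum_(i < b) phi y i + (C - 1) by rewrite /Z expr0; ring.
    under eq_integral do rewrite ZE EFinD.
    rewrite ge0_integralD //.
    + rewrite Ephi integral_cst // [X in (_ * X)%E](@probability_setT _ _ _ P).
      by rewrite mule1 -EFinD; congr (_%:E); ring.
    + by move=> x _; rewrite lee_fin.
    + exact/measurable_EFinP.
have cwpos x (u : N.-tuple 'I_b) : 0 <= cw (V c x) v u by apply: cw_ge0 => w i; exact: V0.
have := @hoeffding_prod _ _ _ _ _ _ _ W indep Z C mZ ZC EZ r s.
have -> : uniq r.
  rewrite map_inj_uniq ?index_enum_uniq //.
  by move=> u1 u2 /eqP; rewrite eqseq_cat // eqxx => /eqP /val_inj.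
move=> /(_ isT) H.
apply: (@le_trans _ _ (2%:E * \int[P]_x
  (\prod_(u <- r) expR (s u x * Z (W u x) - 2 * (C * s u x) ^+ 2))%:E)%E); last first.
  rewrite -[leRHS]mule1; apply: lee_pmul => //.
    by apply: integral_ge0 => x _; rewrite lee_fin; apply: prodr_ge0 => u _; exact: expR_ge0.
  apply: H.
  - move=> u w /rP[{}u ->] /rP[{}w ->].
    have mVoff w' i : (size w' < size v + N)%N ->
        measurable_fun setT ((fun x => V c x w' i) : off_type W (v ++ w) -> R).
      move=> sw; rewrite /V /uniform_below.
      case: (size w' < c)%N; first exact: measurable_cst.
      apply: (measurableT_comp (mphi i)).
      apply: measurable_off_fun; apply/eqP => ww.
      by move: sw; rewrite ww size_cat size_tuple ltnn.
    apply: measurable_funM.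
      apply: measurable_funM; first exact: measurable_cst.
      rewrite drop_size_cat //; apply: measurable_cw => w' i.
      by rewrite size_tuple; exact: mVoff.
    apply: (measurableT_comp (measurable_powR (-1))).
    have mYoff : measurable_fun setT ((fun x => Ym (V c x) v N) : off_type W (v ++ w) -> R).
      exact: measurable_Ym.
    exact: (measurable_maxr (measurable_cst _) mYoff).
  - move=> w x /rP[u ->]; rewrite sE.
    by rewrite !mulr_ge0 // invr_ge0 ltW.
  - move=> w x /rP[u ->]; rewrite sE.
    have h : lam * cw (V c x) v u / M x <= lam * a.
      apply: le_trans (_ : lam * cw (V c x) v u <= _); last exact: ler_wpM2l.
      by rewrite ler_pdivrMr // ler_peMr // mulr_ge0.
    apply: le_trans (ler_wpM2r (ltW C0) h) _.
    have -> : lam * a * C = Num.sqrt a / 2.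
      rewrite /lam -{2}(sqr_sqrtr (ltW a0)); field.
      by rewrite (gt_eqF C0) (gt_eqF sa0).
    by rewrite ler_pdivrMr // mulVf // -sqrtr1 ler_sqrt.
have mY n : measurable_fun setT (fun x => Ym (V c x) v n).
  by apply: measurable_Ym => w i _; rewrite /V /uniform_below; case: (size w < c)%N.
have ms u : u \in r -> measurable_fun setT (s u).
  move=> /rP[{}u ->]; apply: measurable_funM.
    apply: measurable_funM; first exact: measurable_cst.
    by apply: measurable_cw => w i _; rewrite /V /uniform_below; case: (size w < c)%N.
  apply: (measurableT_comp (measurable_powR (-1))).
  exact: (measurable_maxr (measurable_cst _) (mY N)).
have mprod : measurable_fun setT (fun x => \prod_(u <- r)
    expR (s u x * Z (W u x) - 2 * (C * s u x) ^+ 2)).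
  apply: measurable_prod => u ur; apply: measurableT_comp => //.
  apply: measurable_funB; first exact: measurable_funM (ms _ ur) (measurableT_comp mZ _).
  by apply: measurable_funM => //; apply: measurable_funX; apply: measurable_funM => //; exact: ms.
rewrite -ge0_integralZl //; last 2 first.
- exact/measurable_EFinP.
- by move=> x _; rewrite lee_fin; apply: prodr_ge0 => u _; exact: expR_ge0.
apply: ge0_le_integral => //.
- apply/measurable_EFinP; apply: measurableT_comp => //.
  apply: measurable_funM => //; apply: measurable_funM; first exact: measurable_funB.
  under eq_fun do rewrite -powR_inv1 ?(ltW (M0 _)) //.
  apply: (measurableT_comp (measurable_powR (-1))).
  exact: (measurable_maxr (measurable_cst _) (mY N)).
- apply/measurable_EFinP; exact: measurable_funM.
move=> x _; rewrite -EFinM lee_fin -expR_sum big_map sumrB.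
have cwE (u : N.-tuple 'I_b) i : V c x (v ++ u) i = phi (W (v ++ u) x) i.
  by rewrite /V /uniform_below size_cat size_tuple ltnNge cN.
have -> : \sum_(u : N.-tuple 'I_b) s (v ++ u) x * Z (W (v ++ u) x) =
    (-1) ^+ sg * lam * ((Ym (V c x) v N.+1 - Ym (V c x) v N) / M x).
  rewrite YmSr /Ym -sumrB big_distrl big_distrr /=; apply: eq_bigr => u _.
  rewrite sE /Z; under [in RHS]eq_bigr do rewrite cwE.
  by ring.
rewrite expRD -/lam -/(M x) [leRHS]mulrCA ler_peMr ?expR_ge0 //.
rewrite expRN -ler_pdivrMr ?invr_gt0 ?expR_gt0 // invrK mul1r.
apply: (@le_trans _ _ (expR 2^-1)); last first.
  by apply: le_trans (expR_le_quadratic (lexx _)) _; lra.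
rewrite ler_expR.
have -> : \sum_(u : N.-tuple 'I_b) 2 * (C * s (v ++ u) x) ^+ 2 =
   (2 * C ^+ 2 * lam ^+ 2 / M x ^+ 2) * \sum_(u : N.-tuple 'I_b) cw (V c x) v u ^+ 2.
  rewrite big_distrr /=; apply: eq_bigr => u _; rewrite sE; field.
  by rewrite (gt_eqF (M0 x)).
have -> : 2 * C ^+ 2 * lam ^+ 2 / M x ^+ 2 = 2^-1 * (a * M x ^+ 2)^-1.
  rewrite /lam -{2}(sqr_sqrtr (ltW a0)); field.
  by rewrite (gt_eqF (M0 x)) (gt_eqF C0) (gt_eqF sa0).
rewrite -mulrA ler_piMr // ler_pdivrMl ?mulr_gt0 ?exprn_gt0 // mulr1.
apply: (@le_trans _ _ (a * Ym (V c x) v N)).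
  rewrite /Ym big_distrr /=; apply: ler_sum => u _; rewrite expr2.
  by rewrite ler_wpM2r.
rewrite ler_wpM2l ?(ltW a0) //.
apply: (@le_trans _ _ (M x)); first by rewrite le_max lexx orbT.
by rewrite expr2 ler_peMr // ltW.
Qed.

End cascade_hoeffding.

(** The form of the Borel-Cantelli lemma that suits exponential moments: the sum of the [f n] has a
    finite integral, so it is almost surely finite, and it bounds each of its terms. *)
Lemma ae_bounded_series d (T : measurableType d) (R : realType)
    (P : probability T R) (f : nat -> T -> R) (a : nat -> R) (A : R) :
  (forall n, measurable_fun setT (f n)) -> (forall n x, 0 <= f n x) ->
  (forall n, (\int[P]_x (f n x)%:E <= (a n)%:E)%E) ->
  (forall n, \sum_(i < n) a i <= A) ->
  {ae P, forall x, exists M, forall n, f n x <= M}.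
Proof.
move=> mf f0 fa aA.
pose F x := (\sum_(n <oo) (f n x)%:E)%E.
have f0' n x : (0 <= (f n x)%:E)%E by rewrite lee_fin.
have F0 x : (0 <= F x)%E by exact: nneseries_ge0.
have mF : measurable_fun setT F.
  by apply: ge0_emeasurable_sum => // n _; exact/measurable_EFinP.
have IF : (\int[P]_x F x <= A%:E)%E.
  rewrite integral_nneseries //; last by move=> n; exact/measurable_EFinP.
  apply: lime_le.
    by apply: is_cvg_nneseries => n _ _; exact: integral_ge0.
  apply: nearW => n; apply: (@le_trans _ _ (\sum_(0 <= i < n) (a i)%:E)%E).
    by apply: lee_sum => i _; exact: fa.
  by rewrite sumEFin lee_fin big_mkord; exact: aA.
have iF : P.-integrable setT F.
  apply/integrableP; split => //.
  under eq_integral do rewrite gee0_abs //.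
  exact: le_lt_trans IF (ltry _).
have := integrable_ae measurableT iF.
apply: filterS => x /(_ I) Ffin; exists (fine (F x)) => n.
rewrite -lee_fin fineK //.
apply: (le_trans _ (nneseries_lim_ge n.+1 _)) => //.
by rewrite big_nat_recr //= leeDr // sume_ge0.
Qed.

Section cut_bounds.
Context (R : realType) (b : nat).
Implicit Types (V : seq 'I_b -> 'I_b -> R).

Lemma cw_cut c V v u : (size v + size u <= c)%N ->
  cw (uniform_below c V) v u = b%:R^-1 ^+ size u.
Proof.
elim: u v => //= i u IH v vuc; rewrite exprS.
rewrite {1}/uniform_below (leq_trans _ vuc) ?IH ?size_rcons ?addSnnS //.
by rewrite -addSnnS ltn_addr.
Qed.

Lemma cut_bounds c V lo hi : lo <= b%:R^-1 <= hi ->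
  (forall w i, lo <= V w i <= hi) -> forall w i, lo <= uniform_below c V w i <= hi.
Proof. by move=> lh Vlh w i; rewrite /uniform_below; case: ifP. Qed.

Lemma cw_cut_le c V v u t : b%:R^-1 <= t -> (forall w i, 0 <= V w i <= t) ->
  (size v <= c <= size v + size u)%N ->
  cw (uniform_below c V) v u <= b%:R^-1 ^+ (c - size v) * t ^+ (size v + size u - c).
Proof.
move=> bt Vt /andP[vc cu].
have b0 : 0 <= (b%:R^-1 : R) by rewrite invr_ge0.
have cutt : forall w i, 0 <= uniform_below c V w i <= t by apply: cut_bounds => //; rewrite b0.
have cut0 w i : 0 <= uniform_below c V w i by case/andP: (cutt w i).
have ku : (c - size v <= size u)%N by rewrite leq_subLR.
rewrite -[u in cw _ _ u](cat_take_drop (c - size v)) cw_cat.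
have st : size (take (c - size v) u) = (c - size v)%N by rewrite size_takel.
rewrite cw_cut st ?subnKC // ler_wpM2l ?exprn_ge0 //.
have -> : (size v + size u - c = size (drop (c - size v) u))%N.
  by rewrite size_drop subnBA // addnC.
exact: cw_le.
Qed.

End cut_bounds.

(** * Increments of the masses, uniformly in the parameter and the word *)

Section uniform_grid.
Context (d d' : measure_display) (T : measurableType d)
  (T' : measurableType d') (R : realType) (P : probability T R) (b : nat)
  (W : seq 'I_b -> {RV P >-> T'}).
Hypotheses (indep : mutually_independent W) (b1 : (1 < b)%N).
Variables (phi : R -> T' -> 'I_b -> R) (B : nat) (theta : R).
Hypotheses (mphi : forall q i, measurable_fun setT (phi q ^~ i))
  (theta_lt1 : theta < 1) (btheta : b%:R^-1 <= theta)
  (phi_bounds : forall q y i, `|q| <= B%:R -> 0 <= phi q y i <= theta)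
  (Ephi : forall q w, `|q| <= B%:R ->
     (\int[P]_x (\sum_(i < b) phi q (W w x) i)%:E = 1)%E).

Definition grid (L i : nat) : R := - B%:R + i%:R / b%:R ^+ L.

Definition grid_size (L : nat) : nat := (B.*2 * b ^ L).+1.

Let b0 : 0 < (b%:R : R). Proof. by rewrite ltr0n ltnW. Qed.

Lemma grid_bound L i : (i < grid_size L)%N -> `|grid L i| <= B%:R.
Proof.
rewrite /grid_size ltnS => iB.
have h : i%:R / b%:R ^+ L <= B%:R + B%:R :> R.
  by rewrite ler_pdivrMr ?exprn_gt0 // -natrD addnn -natrX -natrM ler_nat.
have h0 : 0 <= i%:R / b%:R ^+ L :> R by rewrite divr_ge0 ?exprn_ge0 // ltW.
by rewrite /grid ler_norml; apply/andP; split; lra.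
Qed.

(* Upper bound for the weights at generation l + N of the cascade modified below c. *)
Definition grid_scale (l c N : nat) : R :=
  b%:R^-1 ^+ (c - l) * theta ^+ (l + N - c).

Definition rel_incr (V : seq 'I_b -> 'I_b -> R) v N : R :=
  (Ym V v N.+1 - Ym V v N) / Num.max 1 (Ym V v N).

Let Vcut q c x : seq 'I_b -> 'I_b -> R := uniform_below c (fun w i => phi q (W w x) i).

Let theta0 : 0 < theta.
Proof. by apply: lt_le_trans btheta; rewrite invr_gt0. Qed.

Lemma grid_scale_gt0 l c N : 0 < grid_scale l c N.
Proof. by rewrite mulr_gt0 // exprn_gt0 // invr_gt0. Qed.

Lemma grid_scale_le1 l c N : grid_scale l c N <= 1.
Proof.
have bi : b%:R^-1 <= 1 :> R by rewrite invf_le1 // ler1n ltnW.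
by rewrite mulr_ile1 // ?exprn_ge0 ?exprn_ile1 ?invr_ge0 // ltW.
Qed.

(** A word of length l <= L is encoded as a prefix of a word of length L, and inadmissible indices
    contribute 0, so that all estimates of level L are summed over one finite type. *)
Let term L (u : seq 'I_b) (l c i : nat) (sg : bool) x : R :=
  if [&& (l <= c)%N, (c <= L)%N & (i < grid_size L)%N] then
  expR ((-1) ^+ sg * (2 * b%:R * Num.sqrt (grid_scale l c (L - l)))^-1 *
    rel_incr (Vcut (grid L i) c x) (take l u) (L - l)) else 0.

Let measurable_VV q c w i : measurable_fun setT (fun x => Vcut q c x w i).
Proof.
rewrite /Vcut /uniform_below; case: (size w < c)%N; first exact: measurable_cst.
exact: (measurableT_comp (mphi q i)).
Qed.

Let measurable_term L u l c i sg : measurable_fun setT (term L u l c i sg).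
Proof.
rewrite /term; case: ([&& _, _ & _]); last exact: measurable_cst.
apply: measurableT_comp => //; apply: measurable_funM => //.
have mY n : measurable_fun setT (fun x => Ym (Vcut (grid L i) c x) (take l u) n).
  by apply: measurable_Ym => w j _; exact: measurable_VV.
rewrite /rel_incr; apply: measurable_funM; first exact: measurable_funB.
have M0 x : 0 < Num.max 1 (Ym (Vcut (grid L i) c x) (take l u) (L - l)).
  by rewrite lt_max ltr01.
under eq_fun do rewrite -powR_inv1 ?(ltW (M0 _)) //.
apply: (measurableT_comp (measurable_powR (-1))).
exact: (measurable_maxr (measurable_cst _) (mY _)).
Qed.

Let term_ge0 L u l c i sg x : 0 <= term L u l c i sg x.
Proof. by rewrite /term; case: ifP => // _; exact: expR_ge0. Qed.

(** The weights lie in [0, 1], so their sum over the letters differs from 1 by at most b: this is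
    the constant C of [cascade_hoeffding]. *)
Let integral_term L (u : L.-tuple 'I_b) l c i sg :
  (\int[P]_x (term L u l c i sg x)%:E <= 2%:E)%E.
Proof.
have [/and3P[lc cL iG]|/negbTE e] :=
  boolP [&& (l <= c)%N, (c <= L)%N & (i < grid_size L)%N]; last first.
  by rewrite /term e integral0 lee_fin.
rewrite /term lc cL iG /=.
have gB := grid_bound iG.
have lL := leq_trans lc cL.
have sv : size (take l u) = l by rewrite size_takel ?size_tuple.
have := @cascade_hoeffding _ _ _ _ _ P b W indep (phi (grid L i)) b%:R
  (mphi _) _ _ _ (fun w => Ephi w gB) c (take l u) (L - l)
  (grid_scale l c (L - l)) sg.
apply.
- by move=> y j; case/andP: (phi_bounds y j gB).
- by rewrite ler1n ltnW.
- move=> y; have h0 : 0 <= \sum_(j < b) phi (grid L i) y j.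
    by apply: sumr_ge0 => j _; case/andP: (phi_bounds y j gB).
  have h1 : \sum_(j < b) phi (grid L i) y j <= b%:R.
    have -> : (b%:R : R) = \sum_(j < b) 1 by rewrite sumr_const card_ord.
    apply: ler_sum => j _.
    by case/andP: (phi_bounds y j gB) => _ h; apply: le_trans h (ltW _).
  have hb : 1 <= b%:R :> R by rewrite ler1n ltnW.
  by rewrite ler_norml; apply/andP; split; lra.
- by rewrite grid_scale_gt0 grid_scale_le1.
- by rewrite sv subnKC.
- move=> x w; have := @cw_cut_le R b c (fun w i0 => phi (grid L i) (W w x) i0)
    (take l u) w theta btheta.
  rewrite sv size_tuple; apply; last by rewrite lc subnKC.
  by move=> w' j; exact: phi_bounds.
Qed.

(** Union bound: words, two levels, grid points and signs make at most 2 (2 B + 1) b^(4 L) terms of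
    mean at most 2, so the weight b^(-5 L) leaves a geometric series in b^-L. *)
Lemma ae_grid_bound : {ae P, forall x, exists M, forall L (u : L.-tuple 'I_b) l c i
    (sg : bool), (l <= c)%N -> (c <= L)%N -> (i < grid_size L)%N ->
  expR ((-1) ^+ sg * (2 * b%:R * Num.sqrt (grid_scale l c (L - l)))^-1 *
    rel_incr (Vcut (grid L i) c x) (take l u) (L - l)) <= M * b%:R ^+ (5 * L)}.
Proof.
pose f L x := b%:R^-1 ^+ (5 * L) * \sum_(z : L.-tuple 'I_b * 'I_L.+1 * 'I_L.+1 *
    'I_(grid_size L) * bool) term L z.1.1.1.1 z.1.1.1.2 z.1.1.2 z.1.2 z.2 x.
have bi0 : 0 <= (b%:R^-1 : R) by rewrite invr_ge0 ltW.
have mS L : measurable_fun setT (fun x => \sum_(z : L.-tuple 'I_b * 'I_L.+1 * 'I_L.+1 *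
    'I_(grid_size L) * bool) term L z.1.1.1.1 z.1.1.1.2 z.1.1.2 z.1.2 z.2 x).
  by apply: measurable_sum => z; exact: measurable_term.
have S0 L x : 0 <= \sum_(z : L.-tuple 'I_b * 'I_L.+1 * 'I_L.+1 *
    'I_(grid_size L) * bool) term L z.1.1.1.1 z.1.1.1.2 z.1.1.2 z.1.2 z.2 x.
  by apply: sumr_ge0.
have N0 : {ae P, forall x, exists M, forall n, f n x <= M}.
  apply: (@ae_bounded_series _ T R P f
    (fun L => 4 * (B.*2.+1)%:R * b%:R^-1 ^+ L) (8 * (B.*2.+1)%:R)).
  - by move=> L; exact: measurable_funM.
  - by move=> L x; rewrite mulr_ge0 // exprn_ge0.
  - move=> L; under eq_integral do rewrite EFinM.
    rewrite ge0_integralZl //; last 2 first.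
    + exact/measurable_EFinP.
    + by move=> x _; rewrite lee_fin.
    under eq_integral do rewrite -sumEFin.
    rewrite ge0_integral_sum //; last 2 first.
    + by move=> z; apply/measurable_EFinP; exact: measurable_term.
    + by move=> z x _; rewrite lee_fin.
    apply: (@le_trans _ _ ((b%:R^-1 ^+ (5 * L))%:E * (\sum_(z : L.-tuple 'I_b * 'I_L.+1 * 'I_L.+1 *
      'I_(grid_size L) * bool) 2%:E))%E).
      rewrite lee_wpmul2l ?lee_fin ?exprn_ge0 //; apply: lee_sum => z _.
      exact: integral_term.
    rewrite sumEFin -EFinM lee_fin sumr_const -(mulr_natl 2).
    rewrite !card_prod card_tuple !card_ord card_bool.
    have count : (b ^ L * L.+1 * L.+1 * grid_size L * 2 <= 2 * (B.*2.+1) * b ^ (4 * L))%N.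
      have Lb : (L < b ^ L)%N by exact: ltn_expl.
      have Gb : (grid_size L <= B.*2.+1 * b ^ L)%N.
        by rewrite /grid_size mulSn -addn1 addnC leq_add2r expn_gt0 ltnW.
      apply: (@leq_trans (b ^ L * b ^ L * b ^ L * (B.*2.+1 * b ^ L) * 2)).
        by rewrite !leq_mul.
      have -> : (b ^ (4 * L) = b ^ L * b ^ L * b ^ L * b ^ L)%N.
        by rewrite -!expnD !mulSn mul0n addn0 !addnA.
      by rewrite leq_eqVlt; apply/orP; left; apply/eqP; ring.
    apply: (@le_trans _ _ (b%:R^-1 ^+ (5 * L) *
        ((2 * (B.*2.+1) * b ^ (4 * L))%N%:R * 2))).
      by rewrite ler_wpM2l ?exprn_ge0 // ler_wpM2r // ler_nat.
    rewrite !natrM natrX (mulSn 4 L) exprD exprVn.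
    rewrite le_eqVlt; apply/orP; left; apply/eqP.
    rewrite [(b%:R^-1) ^+ (4 * L)]exprVn; field.
    by rewrite !expf_neq0 // gt_eqF.
  - move=> n; rewrite -big_distrr /=.
    rewrite [leRHS](_ : _ = 4 * (B.*2.+1)%:R * 2); last by ring.
    rewrite ler_wpM2l ?mulr_ge0 //.
    have geo m : \sum_(i < m) (b%:R^-1 : R) ^+ i <= 2 * (1 - 2^-1 ^+ m).
      elim: m => [|m IH]; first by rewrite big_ord0 expr0 subrr mulr0.
      rewrite big_ord_recr /=.
      have : (b%:R^-1 : R) ^+ m <= 2^-1 ^+ m.
        apply: lerXn2r; rewrite ?nnegrE ?invr_ge0 //.
        by rewrite lef_pV2 ?posrE // ler_nat.
      by rewrite exprS; lra.
    apply: le_trans (geo n) _; have : 0 <= (2^-1 : R) ^+ n by rewrite exprn_ge0.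
    by lra.
apply: filterS N0 => x [M fM]; exists M => L u l c i sg lc cL iG.
have lL := leq_trans lc cL.
have := fM L; rewrite /f exprVn mulrC ler_pdivrMr ?exprn_gt0 //.
apply: le_trans; pose z := (u, Ordinal (lL : (l < L.+1)%N), Ordinal (cL : (c < L.+1)%N), Ordinal iG, sg).
rewrite (bigD1 z) //= /term /= lc cL iG lerDl.
by apply: sumr_ge0 => i0 _; case: ifP => // _; exact: expR_ge0.
Qed.

End uniform_grid.

Lemma expRB1_le (R : realType) (t : R) : expR t - 1 <= t * expR t.
Proof.
have := expR_ge1Dx (- t); rewrite expRN => h.
have e0 := expR_gt0 t.
have : (1 - t) * expR t <= 1.
  by rewrite -ler_pdivlMr // mul1r.
lra.
Qed.

Section off_grid.
Context (R : realType) (b : nat).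
Hypothesis b1 : (1 < b)%N.
Variables (V : R -> seq 'I_b -> 'I_b -> R) (B : nat) (theta kappa : R).
Hypotheses (theta_lt1 : theta < 1) (btheta : b%:R^-1 <= theta) (kappa0 : 0 <= kappa)
  (V_bounds : forall q w i, `|q| <= B%:R -> 0 < V q w i <= theta)
  (V_lip : forall q q' w i, `|q| <= B%:R -> `|q'| <= B%:R ->
     V q' w i <= expR (kappa * `|q - q'|) * V q w i).

Let b0 : 0 < (b%:R : R). Proof. by rewrite ltr0n ltnW. Qed.

Lemma near_grid (L : nat) (q : R) : `|q| <= B%:R ->
  exists2 i, (i < grid_size b B L)%N & `|q - grid R b B L i| <= b%:R^-1 ^+ L.
Proof.
rewrite ler_norml => /andP[q1 q2].
have bL : 0 < (b%:R ^+ L : R) by rewrite exprn_gt0.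
have x0 : 0 <= (q + B%:R) * b%:R ^+ L.
  by rewrite mulr_ge0 ?(ltW bL) //; lra.
exists (Num.truncn ((q + B%:R) * b%:R ^+ L)).
  rewrite /grid_size ltnS -(ler_nat R); have /andP[tx _] := truncn_itv x0; apply: le_trans tx _.
  by rewrite natrM natrX ler_wpM2r ?(ltW bL) // -addnn natrD; lra.
have /andP[t1 t2] := truncn_itv x0.
set k := Num.truncn _ in t1 t2 *.
have e1 : k%:R / b%:R ^+ L <= q + B%:R by rewrite ler_pdivrMr.
have e2 : q + B%:R - k%:R / b%:R ^+ L <= b%:R^-1 ^+ L.
  rewrite lerBlDr exprVn [(_ ^+ L)^-1 + _](_ : _ = (k%:R + 1) / b%:R ^+ L); last by ring.
  by rewrite ler_pdivlMr // natr1 ltW.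
by rewrite /grid ler_norml; apply/andP; split; lra.
Qed.

Let C c q := uniform_below c (V q).

Let C_bounds c q w i : `|q| <= B%:R -> 0 < C c q w i <= theta.
Proof.
by move=> qB; rewrite /C /uniform_below; case: ifP => _; [rewrite invr_gt0 b0|exact: V_bounds].
Qed.

Lemma Ym_lip c q q' v n : `|q| <= B%:R -> `|q'| <= B%:R ->
  Ym (uniform_below c (V q')) v n <= expR (kappa * `|q - q'|) ^+ n * Ym (uniform_below c (V q)) v n.
Proof.
move=> qB qB'; rewrite /Ym big_distrr; apply: ler_sum => u _ /=.
rewrite -[in X in X * _](size_tuple u).
elim: (val u) v => [|i w IH] v /=; first by rewrite expr0 mul1r.
rewrite exprS mulrACA.
have g0 (p : R) w' : `|p| <= B%:R -> 0 <= cw (C c p) (rcons v i) w'.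
  by move=> pB; apply: cw_ge0 => w'' j; case/andP: (C_bounds c w'' j pB) => /ltW.
have h0 (p : R) : `|p| <= B%:R -> 0 <= C c p v i.
  by move=> pB; case/andP: (C_bounds c v i pB) => /ltW.
apply: ler_pM; [exact: h0|exact: g0| |exact: IH].
rewrite /uniform_below; case: ifP => _; last exact: V_lip.
by rewrite ler_peMl ?invr_ge0 ?(ltW b0) // -expR0 ler_expR mulr_ge0.
Qed.

Lemma Ym_cut_succ_le c q v n : `|q| <= B%:R ->
  Ym (uniform_below c (V q)) v n.+1 <= b%:R * Ym (uniform_below c (V q)) v n.
Proof.
move=> qB; rewrite YmSr /Ym big_distrr; apply: ler_sum => u _ /=.
rewrite mulrC; apply: ler_wpM2r.
  by apply: cw_ge0 => w j; case/andP: (C_bounds c w j qB) => /ltW.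
have -> : (b%:R : R) = \sum_(j < b) 1 by rewrite sumr_const card_ord.
apply: ler_sum => j _; case/andP: (C_bounds c (v ++ u) j qB) => _ h.
exact: le_trans h (ltW _).
Qed.

(** This compares the mesh b^-L of the grid, L = l + N, with the size of the fluctuations: replacing
    a parameter by a grid point costs no more than the fluctuations themselves. *)
Lemma grid_scale_ge l c N : (l <= c <= l + N)%N ->
  b%:R^-1 ^+ (l + N) <= Num.sqrt (grid_scale b theta l c N).
Proof.
move=> /andP[lc cN].
have bi0 : 0 <= (b%:R^-1 : R) by rewrite invr_ge0 ltW.
have bi1 : (b%:R^-1 : R) <= 1 by rewrite invf_le1 // ler1n ltnW.
have th0 : 0 <= theta by apply: le_trans btheta.
have s0 : 0 <= grid_scale b theta l c N by rewrite mulr_ge0 // exprn_ge0.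
have s1 : grid_scale b theta l c N <= 1.
  by rewrite mulr_ile1 ?exprn_ge0 ?exprn_ile1 // ltW.
apply: (@le_trans _ _ (grid_scale b theta l c N)).
  apply: (@le_trans _ _ (b%:R^-1 ^+ (c - l) * b%:R^-1 ^+ (l + N - c))).
    rewrite -exprD; apply: ler_wiXn2l => //.
    by rewrite addnC addnBA // subnK // leq_subr.
  by rewrite ler_wpM2l ?exprn_ge0 // lerXn2r // nnegrE.
rewrite -{1}(sqr_sqrtr s0) expr2 ler_piMr ?sqrtr_ge0 //.
by rewrite -sqrtr1 ler_sqrt.
Qed.

(** At a grid point p within b^-L of q, the logarithm of the hypothesis bounds the increment by a
    multiple of (1 + L) times the square root of the scale. From p to q the masses change by a
    factor between 1/E and E, with E = e^(kappa |q - p| (N + 1)); as |q - p| (N + 1) <= b^-L (1 + L)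
    <= 1, the error E - 1 has the same order by [grid_scale_ge]. *)
Lemma increments_off_grid (M : R) :
  (forall L (u : L.-tuple 'I_b) l c i (sg : bool),
     (l <= c)%N -> (c <= L)%N -> (i < grid_size b B L)%N ->
   expR ((-1) ^+ sg * (2 * b%:R * Num.sqrt (grid_scale b theta l c (L - l)))^-1 *
     rel_incr (uniform_below c (V (grid R b B L i))) (take l u) (L - l)) <= M * b%:R ^+ (5 * L)) ->
  exists2 H : R, 0 <= H & forall q v c N, `|q| <= B%:R ->
    (size v <= c <= size v + N)%N ->
    `|Ym (uniform_below c (V q)) v N.+1 - Ym (uniform_below c (V q)) v N| <=
      H * (1 + (size v + N)%:R) * Num.sqrt (grid_scale b theta (size v) c N) *
      Num.max 1 (Ym (uniform_below c (V q)) v N).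
Proof.
move=> gridM.
pose M' := Num.max 1 M.
have M1 : 1 <= M' by rewrite le_max lexx.
have M0 : 0 < M' by apply: lt_le_trans M1.
(* Chosen so that ln (M' b^(5 L)) <= H0 (1 + L). *)
pose H0 := ln M' + 5 * ln b%:R.
have lnb0 : 0 <= ln (b%:R : R) by rewrite ln_ge0 // ler1n ltnW.
have lnM0 : 0 <= ln M' by rewrite ln_ge0.
have H00 : 0 <= H0 by rewrite addr_ge0 // mulr_ge0.
exists (2 * b%:R * H0 * expR kappa + kappa * (b%:R + 1) * expR kappa ^+ 2).
  have bb := ltW b0; have ek := expR_ge0 kappa.
  by apply: addr_ge0; rewrite !mulr_ge0 ?exprn_ge0 // addr_ge0.
move=> q v c N qB /andP[vc cN]; set L := (size v + N)%N.
have c0 : 'I_b by exact: (Ordinal (ltnW b1)).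
have su : size (v ++ nseq N c0) == L by rewrite size_cat size_nseq.
have [i iG qi] := near_grid L qB.
set p := grid R b B L i in qi.
have pB : `|p| <= B%:R by exact: grid_bound.
set sa := Num.sqrt _.
have sa_ge : b%:R^-1 ^+ L <= sa by apply: grid_scale_ge; rewrite vc.
have sa0 : 0 < sa by apply: lt_le_trans sa_ge; rewrite exprn_gt0 // invr_gt0.
set y := Ym (uniform_below c (V q)) v N; set y' := Ym (uniform_below c (V q)) v N.+1.
set z := Ym (uniform_below c (V p)) v N; set z' := Ym (uniform_below c (V p)) v N.+1.
have Cp0 (r : R) n : `|r| <= B%:R -> 0 <= Ym (uniform_below c (V r)) v n.
  by move=> rB; apply: Ym_ge0 => w j; case/andP: (C_bounds c w j rB) => /ltW.
have z0 : 0 <= z by exact: Cp0.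
have z'0 : 0 <= z' by exact: Cp0.
have y0 : 0 <= y by exact: Cp0.
have y'0 : 0 <= y' by exact: Cp0.
have mz1 : 0 < Num.max 1 z by rewrite lt_max ltr01.
have L0 : 0 <= (L%:R : R) by [].
have dz : `|z' - z| <= 2 * b%:R * H0 * (1 + L%:R) * sa * Num.max 1 z.
  have lnbd : ln (M' * b%:R ^+ (5 * L)) <= H0 * (1 + L%:R).
    rewrite lnM ?posrE ?exprn_gt0 // lnXn // -(mulr_natl (ln b%:R)) natrM /H0.
    rewrite [leRHS]mulrDr mulr1 mulrDl.
    have : 0 <= ln M' * L%:R by rewrite mulr_ge0.
    lra.
  have key (sg : bool) : (-1) ^+ sg * ((z' - z) / Num.max 1 z) <=
      2 * b%:R * sa * (H0 * (1 + L%:R)).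
    have := gridM L (Tuple su) (size v) c i sg vc cN iG.
    rewrite /= take_size_cat // [(L - size v)%N]addKn -/p -/sa => h.
    have h2 : expR ((-1) ^+ sg / (2 * b%:R * sa) * ((z' - z) / Num.max 1 z)) <=
        M' * b%:R ^+ (5 * L).
      apply: le_trans h _; apply: ler_wpM2r; first by rewrite exprn_ge0 // ltW.
      by rewrite le_max lexx orbT.
    rewrite -ler_ln ?posrE ?expR_gt0 ?mulr_gt0 ?exprn_gt0 // expRK in h2.
    rewrite -ler_pdivrMl ?mulr_gt0 //; apply: le_trans lnbd.
    by apply: le_trans h2; rewrite mulrCA mulrA.
  rewrite -ler_pdivrMr // -[X in _ / X]gtr0_norm // -normf_div.
  rewrite ler_norml lerNl.
  have := key true; have := key false; rewrite expr0 expr1 mul1r mulN1r.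
  by rewrite (_ : 2 * b%:R * sa * (H0 * (1 + L%:R)) = 2 * b%:R * H0 * (1 + L%:R) * sa);
    [move=> -> ->|ring].
pose D := `|q - p|.
have D0 : 0 <= D by exact: normr_ge0.
pose E := expR (kappa * D) ^+ N.+1.
have e1 : 1 <= expR (kappa * D) by rewrite -expR0 ler_expR mulr_ge0.
have E1 : 1 <= E by rewrite exprn_ege1.
have EN : expR (kappa * D) ^+ N <= E by apply: ler_weXn2l.
have zy : z <= E * y.
  by apply: le_trans (Ym_lip _ _ _ qB pB) _; rewrite ler_wpM2r.
have yz : y <= E * z.
  by apply: le_trans (Ym_lip _ _ _ pB qB) _; rewrite distrC ler_wpM2r.
have zy' : z' <= E * y' by exact: Ym_lip.
have yz' : y' <= E * z' by apply: le_trans (Ym_lip _ _ _ pB qB) _; rewrite distrC.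
have z'bz : z' <= b%:R * z by exact: Ym_cut_succ_le.
have NL : N.+1%:R <= 1 + L%:R :> R by rewrite -natr1 addrC lerD2l ler_nat leq_addl.
have Lb : 1 + L%:R <= b%:R ^+ L :> R.
  by rewrite -natrX addrC natr1 ler_nat ltn_expl.
have EE : E = expR (kappa * D * N.+1%:R) by rewrite /E expRM_natr.
have DN : D * N.+1%:R <= b%:R^-1 ^+ L * (1 + L%:R) by rewrite ler_pM.
have DN1 : D * N.+1%:R <= 1.
  apply: le_trans DN _; rewrite exprVn ler_pdivrMl ?exprn_gt0 // mulr1.
  exact: Lb.
have Ek : E <= expR kappa by rewrite EE ler_expR -mulrA ler_piMr.
have E1k : E - 1 <= kappa * (1 + L%:R) * sa * expR kappa.
  rewrite EE; apply: le_trans (expRB1_le _) _; rewrite -EE.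
  apply: ler_pM => //; first by rewrite !mulr_ge0.
    by apply: le_trans E1.
  rewrite -!mulrA ler_wpM2l //; apply: le_trans DN _.
  by rewrite mulrC ler_wpM2l // addr_ge0.
have E0 : 0 <= E by apply: le_trans E1.
have dy : `|y' - y| <= `|z' - z| + (E - 1) * (b%:R + 1) * z.
  have h1 : (E - 1) * z' <= (E - 1) * (b%:R * z) by rewrite ler_wpM2l // subr_ge0.
  (* This is 1 / E >= 2 - E, a lower bound for the factor that is linear in E - 1. *)
  have half (s t : R) : 0 <= s -> s <= E * t -> s - (E - 1) * s <= t.
    move=> s0 st; rewrite -(@ler_pM2l _ E); last by apply: lt_le_trans E1.
    apply: le_trans st; rewrite -subr_ge0.
    have -> : s - E * (s - (E - 1) * s) = s * (E - 1) ^+ 2 by ring.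
    by rewrite mulr_ge0 // sqr_ge0.
  have g1 := half z y z0 zy; have g2 := half z' y' z'0 zy'.
  have g3 : z' - z <= `|z' - z| by exact: ler_norm.
  have g4 : z - z' <= `|z' - z| by rewrite distrC ler_norm.
  rewrite ler_norml; apply/andP; split; lra.
have mzy : Num.max 1 z <= E * Num.max 1 y.
  rewrite ge_max; apply/andP; split.
    by apply: mulr_ege1 => //; rewrite le_max lexx.
  by apply: le_trans zy _; rewrite ler_wpM2l // le_max lexx orbT.
apply: le_trans dy _.
set my := Num.max 1 y in mzy *.
have my0 : 0 <= my by rewrite le_max ler01.
have mzk : Num.max 1 z <= expR kappa * my.
  by apply: le_trans mzy _; rewrite ler_wpM2r.
have zk : z <= expR kappa * my by apply: le_trans mzk; rewrite le_max lexx orbT.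
have L1 : 0 <= 1 + L%:R :> R by rewrite addr_ge0.
have g1 : `|z' - z| <= 2 * b%:R * H0 * (1 + L%:R) * sa * (expR kappa * my).
  by apply: le_trans dz _; rewrite ler_wpM2l // !mulr_ge0 // ltW.
have g2 : (E - 1) * (b%:R + 1) * z <=
    kappa * (1 + L%:R) * sa * expR kappa * (b%:R + 1) * (expR kappa * my).
  apply: ler_pM => //; first by rewrite mulr_ge0 ?subr_ge0 // addr_ge0 // ltW.
  by rewrite ler_wpM2r // addr_ge0 // ltW.
apply: le_trans (lerD g1 g2) _.
by rewrite le_eqVlt; apply/orP; left; apply/eqP; ring.
Qed.

End off_grid.

(** * Polynomial bounds on the masses *)

Section multiplicative_increments.
Context (R : realType).
Implicit Types (y delta : nat -> R).

(** The left side is a partial sum of the power series of (1 - r)^-2; its closed form is proved by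
    induction. *)
Lemma sum_linear_geometric (r : R) n : 0 <= r < 1 ->
  \sum_(i < n) (1 + i%:R) * r ^+ i <= (1 - r) ^- 2.
Proof.
move=> /andP[r0 r1]; have h : 0 < 1 - r by rewrite subr_gt0.
have e : (1 - r) ^+ 2 * \sum_(i < n) (1 + i%:R) * r ^+ i =
    1 - (1 + n%:R * (1 - r)) * r ^+ n.
  elim: n => [|n IH]; first by rewrite big_ord0 expr0 mulr0 mul0r addr0 mulr1 subrr.
  by rewrite big_ord_recr /= mulrDr IH -natr1 (exprS r n); ring.
rewrite -[leRHS]mulr1 ler_pdivlMl ?exprn_gt0 // e.
rewrite lerBlDr lerDl mulr_ge0 ?exprn_ge0 // addr_ge0 // mulr_ge0 //.
exact: ltW.
Qed.

(** Discrete Gronwall argument: max(1, y) grows at each step by a factor at most 1 + delta <=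
    e^delta, hence stays bounded, and the increments are then absolutely summable. *)
Lemma cvgn_rel_increments y delta (D : R) :
  (forall n, 0 <= y n) -> (forall n, 0 <= delta n) ->
  (forall n, \sum_(i < n) delta i <= D) ->
  (forall n, `|y n.+1 - y n| <= delta n * Num.max 1 (y n)) -> cvgn y.
Proof.
move=> y0 d0 dD dy.
have grow n : Num.max 1 (y n) <= Num.max 1 (y 0%N) * expR (\sum_(i < n) delta i).
  elim: n => [|n IH]; first by rewrite big_ord0 expR0 mulr1.
  rewrite big_ord_recr /= expRD mulrA.
  have m0 : 0 <= Num.max 1 (y n) by rewrite le_max ler01.
  have h1 : (1 + delta n) * Num.max 1 (y n) <=
     expR (delta n) * (Num.max 1 (y 0%N) * expR (\sum_(i < n) delta i)).
    by apply: ler_pM => //; [rewrite addr_ge0|exact: expR_ge1Dx].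
  rewrite mulrC; apply: le_trans h1.
  have h2 : y n.+1 <= y n + delta n * Num.max 1 (y n).
    by rewrite -lerBlDl; apply: le_trans (dy n); exact: ler_norm.
  have h3 : 0 <= delta n * Num.max 1 (y n) by rewrite mulr_ge0.
  have [h4 h5] : 1 <= Num.max 1 (y n) /\ y n <= Num.max 1 (y n).
    by rewrite !le_max !lexx orbT.
  by rewrite ge_max mulrDl mul1r; apply/andP; split; lra.
pose K := Num.max 1 (y 0%N) * expR D.
have K0 : 0 <= K by rewrite mulr_ge0 ?expR_ge0 // le_max ler01.
have yK n : Num.max 1 (y n) <= K.
  apply: le_trans (grow n) _; rewrite ler_wpM2l ?le_max ?ler01 //.
  by rewrite ler_expR.
have -> : y = (fun n => y 0%N + series (fun k => y k.+1 - y k) n).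
  apply/funext => n; rewrite /series /= telescope_sumr //.
  by rewrite addrC subrK.
apply: is_cvgD; first exact: is_cvg_cst.
apply: normed_cvg; apply: nondecreasing_is_cvgn.
  by apply: nondecreasing_series => n _ _; exact: normr_ge0.
exists (D * K) => _ [n _ <-] /=; rewrite /series /= big_mkord.
apply: (@le_trans _ _ (\sum_(i < n) delta i * K)).
  apply: ler_sum => i _; apply: le_trans (dy i) _.
  by rewrite ler_wpM2l.
by rewrite -big_distrl /=; apply: ler_wpM2r => //; exact: dD.
Qed.

(** Bootstrap: while |y n - 1| <= 1/2 the maximum is at most 2, so the next increment is at most 2
    delta, and these add up to at most 1/2. *)
Lemma rel_increments_near1 y delta :
  y 0%N = 1 -> (forall n, 0 <= delta n) ->
  (forall n, \sum_(i < n) delta i <= 4^-1) ->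
  (forall n, `|y n.+1 - y n| <= delta n * Num.max 1 (y n)) ->
  forall n, 2^-1 <= y n <= 3 / 2.
Proof.
move=> y0 d0 dD dy n.
suff h : `|y n - 1| <= 2 * \sum_(i < n) delta i.
  by have := dD n; move: h; rewrite ler_norml => /andP[h1 h2] h3;
    apply/andP; split; lra.
elim: n => [|n IH]; first by rewrite big_ord0 y0 subrr normr0 mulr0.
have := dD n => h3.
have y2 : Num.max 1 (y n) <= 2.
  by move: IH; rewrite ler_norml => /andP[h1 h2]; rewrite ge_max; apply/andP; split; lra.
have h4 : `|y n.+1 - y n| <= delta n * 2.
  by apply: le_trans (dy n) _; rewrite ler_wpM2l.
rewrite big_ord_recr /= mulrDr.
have -> : y n.+1 - 1 = (y n - 1) + (y n.+1 - y n) by ring.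
apply: le_trans (ler_normD _ _) _; lra.
Qed.

End multiplicative_increments.

Section polynomial_masses.
Context (R : realType) (b : nat).
Hypothesis b1 : (1 < b)%N.
Variables (V : R -> seq 'I_b -> 'I_b -> R) (B g : nat) (theta H : R).
Hypotheses (theta_lt1 : theta < 1) (btheta : b%:R^-1 <= theta) (g1 : (0 < g)%N)
  (V_bounds : forall q w i, `|q| <= B%:R -> b%:R^-1 ^+ g <= V q w i <= theta)
  (H0 : 0 <= H)
  (V_incr : forall q v c N, `|q| <= B%:R -> (size v <= c <= size v + N)%N ->
    `|Ym (uniform_below c (V q)) v N.+1 - Ym (uniform_below c (V q)) v N| <=
      H * (1 + (size v + N)%:R) * Num.sqrt (grid_scale b theta (size v) c N) *
      Num.max 1 (Ym (uniform_below c (V q)) v N)).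

Let b0 : 0 < (b%:R : R). Proof. by rewrite ltr0n ltnW. Qed.
Let bi0 : 0 <= (b%:R^-1 : R). Proof. by rewrite invr_ge0 ltW. Qed.
Let r := Num.sqrt theta.
Let theta0 : 0 < theta.
Proof. by apply: lt_le_trans btheta; rewrite invr_gt0. Qed.
Let r01 : 0 <= r < 1.
Proof. by rewrite sqrtr_ge0 -sqrtr1 ltr_sqrt. Qed.

Let sqrtrX (x : R) n : 0 <= x -> Num.sqrt (x ^+ n) = Num.sqrt x ^+ n.
Proof.
move=> x0; elim: n => [|n IH]; first by rewrite !expr0 sqrtr1.
by rewrite !exprS sqrtrM // IH.
Qed.

Let V_ge0 q w i : `|q| <= B%:R -> 0 <= V q w i.
Proof. by move=> qB; case/andP: (V_bounds w i qB) => h _; apply: le_trans h; rewrite exprn_ge0. Qed.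

Lemma Ym_cut_id c U v n : (c <= size v)%N -> Ym (@uniform_below R b c U) v n = Ym U v n.
Proof.
move=> cv; apply: eq_bigr => u _.
elim: (val u) v cv => //= i w IH v cv; rewrite IH ?size_rcons ?(leq_trans cv) //.
by rewrite /uniform_below ltnNge cv.
Qed.

Lemma cvgn_mass q v : `|q| <= B%:R -> cvgn (Ym (V q) v).
Proof.
move=> qB.
have [r0 r1] := andP r01.
pose delta n := H * (1 + (size v)%:R) * ((1 + n%:R) * r ^+ n).
have C0 : 0 <= H * (1 + (size v)%:R) by rewrite mulr_ge0 // addr_ge0.
apply: (@cvgn_rel_increments _ _ delta (H * (1 + (size v)%:R) * (1 - r) ^- 2)).
- by move=> n; apply: Ym_ge0 => w i; exact: V_ge0.
- by move=> n; rewrite mulr_ge0 // mulr_ge0 ?exprn_ge0 // addr_ge0.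
- move=> n; rewrite -big_distrr /= ler_wpM2l //.
  exact: sum_linear_geometric.
(* With c = [size v] no weight is modified and the scale is theta^n. *)
- move=> n; have := @V_incr q v (size v) n qB.
  rewrite leqnn leq_addr !Ym_cut_id // => /(_ isT) h; apply: le_trans h _.
  rewrite ler_wpM2r ?le_max ?ler01 //.
  rewrite /grid_scale subnn expr0 mul1r addKn sqrtrX ?(ltW theta0) // -/r /delta.
  rewrite [leRHS]mulrA ler_wpM2r ?exprn_ge0 // -mulrA ler_wpM2l //.
  rewrite natrD mulrDl mulrDr !mulr1 !mul1r.
  have : 0 <= (size v)%:R * n%:R :> R by rewrite mulr_ge0.
  by lra.
Qed.

Lemma shifted_mass q v k m : `|q| <= B%:R ->
  Ym (uniform_below (size v + k) (V q)) v (k + m) =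
  \sum_(u : k.-tuple 'I_b) b%:R^-1 ^+ k * Ym (V q) (v ++ u) m.
Proof.
move=> qB; rewrite Ym_add; apply: eq_bigr => u _.
by rewrite cw_cut ?size_tuple // Ym_cut_id // size_cat size_tuple.
Qed.

(** At generation k the modified mass is exactly b^k b^-k = 1, and from there on the relative
    increments add up to the small quantity of the hypothesis, so [rel_increments_near1] applies. *)
Lemma shifted_mass_bounds q v k : `|q| <= B%:R ->
  H * (1 + (size v + k)%:R) * Num.sqrt (b%:R^-1 ^+ k) * (1 - r) ^- 2 <= 4^-1 ->
  forall m, 2^-1 <= Ym (uniform_below (size v + k) (V q)) v (k + m) <= 3 / 2.
Proof.
move=> qB small.
have [r0 r1] := andP r01.
set C := H * _ * _ in small.
have C0 : 0 <= C by rewrite !mulr_ge0 ?sqrtr_ge0 // addr_ge0.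
pose delta m := C * ((1 + m%:R) * r ^+ m).
apply: (@rel_increments_near1 _ _ delta).
- rewrite addn0 /Ym (eq_bigr (fun=> b%:R^-1 ^+ k)).
    by rewrite sumr_const card_tuple card_ord -(mulr_natr (b%:R^-1 ^+ k)) natrX -exprMn mulVf ?expr1n ?gt_eqF.
  by move=> u _; rewrite cw_cut ?size_tuple.
- by move=> n; rewrite mulr_ge0 // mulr_ge0 ?exprn_ge0 // addr_ge0.
- move=> n; rewrite -big_distrr /=; apply: le_trans small.
  by rewrite ler_wpM2l // sum_linear_geometric.
- move=> m; rewrite addnS; have := @V_incr q v (size v + k) (k + m) qB.
  rewrite leq_addr addnA leq_addr => /(_ isT) h; apply: le_trans h _.
  rewrite ler_wpM2r ?le_max ?ler01 //.
  rewrite /grid_scale addKn -addnA addnA addKn sqrtrM ?exprn_ge0 //.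
  rewrite [Num.sqrt (theta ^+ _)]sqrtrX ?(ltW theta0) // -/r /delta /C.
  set s := Num.sqrt _.
  rewrite mulrA [leRHS]mulrA ler_wpM2r ?exprn_ge0 //.
  rewrite -!mulrA ler_wpM2l // [leRHS]mulrCA [leLHS]mulrC ler_wpM2l ?sqrtr_ge0 //.
  rewrite natrD mulrDl mulrDr !mulr1 !mul1r.
  have : 0 <= (size v + k)%:R * m%:R :> R by rewrite mulr_ge0.
  by lra.
Qed.

(** The power comes from b^(g k) with k = 4 e and b^e <= b l, the cost of k generations of weights
    at least b^-g; the factor 2 covers both 1/2 and 3/2. *)
Definition mass_poly_bound (l : nat) : R := 2 * (b * l)%:R ^+ (4 * g).

(** The average of the masses k generations below v lies in [1/2, 3/2]. The mass at v is the same
    sum with the true weights, which lie between b^(-g k) and 1, in place of b^-k. *)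
Lemma masses_polynomial : exists l0, forall l, (l0 <= l)%N -> forall q v,
  `|q| <= B%:R -> size v = l ->
  (forall n, Ym (V q) v n <= mass_poly_bound l) /\
  (\forall n \near \oo, (mass_poly_bound l)^-1 <= Ym (V q) v n).
Proof.
have [r0 r1] := andP r01.
pose A := (1 - r) ^- 2.
have A0 : 0 <= A by rewrite invr_ge0 exprn_ge0 // subr_ge0 ltW.
(* The smallness condition reduces to 6 H A / l <= 1/4, and l >= 2 serves the logarithm [up_log]. *)
exists (Num.truncn (24 * H * A)).+2 => l l0l q v qB vl.
have l24 : 24 * H * A <= l%:R.
  have HA0 : 0 <= 24 * H * A by rewrite !mulr_ge0.
  have /andP[_ h] := truncn_itv HA0; apply: le_trans (ltW h) _.
  by rewrite ler_nat ltnW.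
have l1 : (1 < l)%N by apply: leq_trans l0l.
have lR0 : 0 < (l%:R : R) by rewrite ltr0n ltnW.
have [e [le_ eb el]] : exists e, [/\ (l <= b ^ e)%N, (b ^ e <= b * l)%N & (e <= l)%N].
  exists (up_log b l); split; first exact: up_logP.
    have /andP[h _] := up_log_bounds b1 l1.
    have e0 : (0 < up_log b l)%N by rewrite up_log_gt0 b1.
    by rewrite -(prednK e0) expnS leq_mul2l ltnW ?orbT.
  by apply: up_log_min => //; apply: ltnW; exact: ltn_expl.
(* k generations are averaged: b^k is polynomial in l, whereas the scale
   sqrt (b^-k) <= l^-2 beats the linear factor of the increments. *)
pose k := (4 * e)%N.
have sk : Num.sqrt (b%:R^-1 ^+ k) <= (l%:R ^+ 2)^-1 :> R.
  rewrite -[leRHS]sqr_sqrtr ?invr_ge0 ?exprn_ge0 // -sqrtrX ?invr_ge0 ?exprn_ge0 //.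
  rewrite ler_sqrt; last by rewrite exprn_ge0 // invr_ge0 exprn_ge0.
  rewrite !exprVn -exprM lef_pV2 ?posrE ?exprn_gt0 //.
  rewrite -[(2 * 2)%N]/4%N /k (mulnC 4 e) exprM.
  by rewrite lerXn2r ?nnegrE ?exprn_ge0 ?(ltW b0) // -natrX ler_nat.
have small : H * (1 + (size v + k)%:R) * Num.sqrt (b%:R^-1 ^+ k) * A <= 4^-1.
  have h1 : 1 + (size v + k)%:R <= 6 * l%:R :> R.
    rewrite vl (_ : 1 = 1%:R) // -natrD -natrM ler_nat /k.
    rewrite (_ : 6 * l = 1 * l + (l + 4 * l))%N; last by ring.
    apply: leq_add; first by rewrite mul1n ltnW.
    by rewrite leq_add2l leq_mul2l el orbT.
  have h2 : (1 + (size v + k)%:R) * Num.sqrt (b%:R^-1 ^+ k) <= 6 * l%:R * (l%:R ^+ 2)^-1 :> R.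
    by apply: ler_pM; [rewrite addr_ge0|exact: sqrtr_ge0|exact: h1|exact: sk].
  have h3 : 6 * l%:R * (l%:R ^+ 2)^-1 = 6 / l%:R :> R by field; rewrite gt_eqF.
  rewrite h3 in h2.
  have h4 : H * A * ((1 + (size v + k)%:R) * Num.sqrt (b%:R^-1 ^+ k)) <= H * A * (6 / l%:R).
    by apply: ler_wpM2l h2; exact: mulr_ge0.
  rewrite (_ : H * _ * _ * A = H * A * ((1 + (size v + k)%:R) * Num.sqrt (b%:R^-1 ^+ k)));
    last by ring.
  apply: le_trans h4 _; rewrite mulrA ler_pdivrMr //; lra.
have z := shifted_mass_bounds qB small.
have bk : b%:R ^+ k <= (b * l)%:R ^+ 4 :> R.
  by rewrite /k (mulnC 4 e) exprM lerXn2r ?nnegrE ?exprn_ge0 ?(ltW b0) // -natrX ler_nat.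
have bl1 : 1 <= (b * l)%:R :> R by rewrite ler1n muln_gt0 (ltnW b1) (ltnW l1).
have bl4 : (b * l)%:R ^+ 4 <= (b * l)%:R ^+ (4 * g) :> R.
  by rewrite ler_weXn2l // leq_pmulr.
have P0 : 0 < mass_poly_bound l.
  by rewrite mulr_gt0 // exprn_gt0 // (lt_le_trans _ bl1).
have bi1 : (b%:R^-1 : R) <= 1 by rewrite invf_le1 // ler1n ltnW.
have cwb (u : k.-tuple 'I_b) : b%:R^-1 ^+ (g * k) <= cw (V q) v u <= 1.
  apply/andP; split.
    rewrite exprM -[X in _ ^+ X](size_tuple u); apply: cw_ge; first by rewrite exprn_ge0.
    by move=> w i; case/andP: (V_bounds w i qB).
  rewrite -(expr1n _ (size u)); apply: cw_le => w i; rewrite V_ge0 //=.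
  by case/andP: (V_bounds w i qB) => _ h; apply: le_trans h (ltW _).
have Yp u n : 0 <= Ym (V q) u n by apply: Ym_ge0 => w i; exact: V_ge0.
have zE m : b%:R ^+ k * Ym (uniform_below (size v + k) (V q)) v (k + m) =
    \sum_(u : k.-tuple 'I_b) Ym (V q) (v ++ u) m.
  rewrite shifted_mass // -big_distrr /= mulrA -exprMn divff ?gt_eqF //.
  by rewrite expr1n mul1r.
have up m : Ym (V q) v (k + m) <= mass_poly_bound l.
  have /andP[_ z2] := z m.
  apply: (@le_trans _ _ (b%:R ^+ k * (3 / 2))).
    apply: (@le_trans _ _ (b%:R ^+ k * Ym (uniform_below (size v + k) (V q)) v (k + m))).
      rewrite zE Ym_add; apply: ler_sum => u _.
      by rewrite ler_piMl //; case/andP: (cwb u).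
    by rewrite ler_wpM2l // exprn_ge0 // ltW.
  rewrite /mass_poly_bound mulrC; apply: ler_pM.
  - lra.
  - by rewrite exprn_ge0 // ltW.
  - lra.
  - exact: le_trans bk bl4.
split.
  move=> n; have [kn|nk] := leqP k n; first by rewrite -(subnKC kn).
  (* Before generation k the weights, at most 1, bound the mass by the number of words. *)
  apply: (@le_trans _ _ (b%:R ^+ n)).
    rewrite -(card_tupleR R b n) /Ym; apply: ler_sum => u _.
    rewrite -(expr1n _ (size u)); apply: cw_le => w i; rewrite V_ge0 //=.
    by case/andP: (V_bounds w i qB) => _ h; apply: le_trans h (ltW _).
  apply: (@le_trans _ _ (b%:R ^+ k)).
    by rewrite ler_weXn2l // ?ler1n ltnW.
  apply: le_trans bk _; apply: le_trans bl4 _; rewrite /mass_poly_bound.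
  by rewrite ler_peMl // ?exprn_ge0 // ?ler1n.
exists k => // n /= kn; rewrite -(subnKC kn); set m := (n - k)%N.
have /andP[z1 _] := z m.
apply: (@le_trans _ _ (b%:R^-1 ^+ (g * k) * (b%:R ^+ k * 2^-1))).
  rewrite /mass_poly_bound invfM mulrA mulrC ler_pM2r ?invr_gt0 //.
  apply: (@le_trans _ _ (b%:R^-1 ^+ (g * k))).
    rewrite exprVn lef_pV2 ?posrE ?exprn_gt0 // ?(lt_le_trans _ bl1) //.
    rewrite mulnC exprM [leRHS]exprM lerXn2r ?nnegrE ?exprn_ge0 // ltW //.
  rewrite ler_peMr ?exprn_ge0 // exprn_ege1 // ler1n ltnW //.
apply: (@le_trans _ _ (b%:R^-1 ^+ (g * k) *
    (b%:R ^+ k * Ym (uniform_below (size v + k) (V q)) v (k + m)))).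
  by rewrite ler_wpM2l ?exprn_ge0 // ler_wpM2l // exprn_ge0 // ltW.
rewrite zE Ym_add big_distrr /=; apply: ler_sum => u _.
by rewrite ler_wpM2r //; case/andP: (cwb u).
Qed.

End polynomial_masses.

(** * The limit measures on b-adic intervals *)

Section badic_cells.
Context (R : realType) (b : nat).
Hypothesis hb : (1 < b)%N.
Implicit Types (u : seq 'I_b) (t : R).

Let b0 : 0 < (b%:R : R). Proof. by rewrite ltr0n ltnW. Qed.

Lemma badic_index_rcons u (c : 'I_b) :
  badic_index (rcons u c) = (badic_index u * b + c)%N.
Proof.
rewrite /badic_index size_rcons big_ord_recr /= subnn expn0 muln1.
rewrite map_rcons nth_rcons size_map ltnn eqxx; congr addn.
rewrite big_distrl /=; apply: eq_bigr => k _.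
rewrite nth_rcons size_map ltn_ord -mulnA; congr muln.
by rewrite subSS -[(size u - k)%N]prednK ?subn_gt0 // expnSr -subnS.
Qed.

Lemma badic_index_nil : badic_index ([::] : seq 'I_b) = 0%N.
Proof. by rewrite /badic_index big_ord0. Qed.

Lemma badic_index_lt u : (badic_index u < b ^ size u)%N.
Proof.
elim/last_ind: u => [|u c IH]; first by rewrite badic_index_nil.
rewrite badic_index_rcons size_rcons expnSr.
by apply: (@leq_trans ((badic_index u).+1 * b)); rewrite ?leq_mul2r ?IH ?orbT // mulSn addnC ltn_add2r.
Qed.

Lemma badic_index_inj u u' :
  size u = size u' -> badic_index u = badic_index u' -> u = u'.
Proof.
elim/last_ind: u u' => [|u c IH] u'.
  by case: u'.
elim/last_ind: u' => [|u' c' _]; first by rewrite size_rcons.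
rewrite !size_rcons !badic_index_rcons => -[suu'] e.
have cc : c = c'.
  by apply: val_inj; have := congr1 (modn^~ b) e; rewrite /= !modnMDl !modn_small.
move: e; rewrite cc => /addIn /eqP; rewrite eqn_mul2r.
by rewrite gtn_eqF ?(ltnW hb) //= => /eqP /(IH _ suu') ->.
Qed.

(** Division by b erases the last base b digit of the integer part of b^(n+1) t. *)
Lemma truncnM_div t n : 0 <= t ->
  (Num.truncn (b%:R ^+ n.+1 * t) %/ b)%N = Num.truncn (b%:R ^+ n * t).
Proof.
move=> t0.
have bn k : 0 <= b%:R ^+ k * t by rewrite mulr_ge0 ?exprn_ge0 // ltW.
have /andP[h1 h2] := truncn_itv (bn n).
have /andP[h3 h4] := truncn_itv (bn n.+1).
set m := Num.truncn (b%:R ^+ n * t) in h1 h2 *.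
set M := Num.truncn _ in h3 h4 *.
have e : b%:R ^+ n.+1 * t = b%:R * (b%:R ^+ n * t) by rewrite exprS mulrA.
have g1 : (b * m < M.+1)%N.
  by rewrite -(ltr_nat R); apply: le_lt_trans h4; rewrite e natrM ler_pM2l.
have g2 : (M < b * m.+1)%N.
  by rewrite -(ltr_nat R); apply: le_lt_trans h3 _; rewrite e natrM ltr_pM2l.
apply/eqP; rewrite eqn_leq -ltnS ltn_divLR ?(ltnW hb) // mulnC g2 /=.
by rewrite leq_divRL ?(ltnW hb) // mulnC -ltnS.
Qed.

Lemma badic_prefixS t n :
  badic_prefix hb t n.+1 = rcons (badic_prefix hb t n) (badic_digit hb t n).
Proof. by rewrite /badic_prefix -addn1 iotaD map_cat cats1. Qed.

Lemma size_badic_prefix t n : size (badic_prefix hb t n) = n.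
Proof. by rewrite size_map size_iota. Qed.

Lemma badic_index_prefix t n : 0 <= t < 1 ->
  badic_index (badic_prefix hb t n) = Num.truncn (b%:R ^+ n * t).
Proof.
move=> /andP[t0 t1]; elim: n => [|n IH].
  rewrite badic_index_nil expr0 mul1r.
  by apply/esym/truncn_def; rewrite t0.
rewrite badic_prefixS badic_index_rcons IH -truncnM_div //=.
exact/esym/divn_eq.
Qed.

(** Half-open, so that the cells of one generation partition [0, 1[, and defined by digits, so that
    the cascade densities are visibly constant on them. *)
Definition badic_cell u : set R :=
  [set t | 0 <= t < 1 /\ badic_prefix hb t (size u) = u].

Lemma badic_cellE u : badic_cell u =
  [set` `[(badic_index u)%:R / b%:R ^+ size u,
          (badic_index u).+1%:R / b%:R ^+ size u[%R].
Proof.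
have bn : 0 < (b%:R ^+ size u : R) by rewrite exprn_gt0.
apply/seteqP; split => t.
  move=> [t01 e]; rewrite /= in_itv /=; have := badic_index_prefix (size u) t01.
  rewrite e => ->; have /andP[t0 t1] := t01.
  have x0 : 0 <= b%:R ^+ size u * t by rewrite mulr_ge0 // ltW.
  have /andP[h1 h2] := truncn_itv x0.
  by rewrite ler_pdivrMr // ltr_pdivlMr // (mulrC t) h1 h2.
rewrite /= in_itv /= => /andP[h1 h2].
have t0 : 0 <= t by apply: le_trans h1; rewrite divr_ge0 // ltW.
have t1 : t < 1.
  apply: lt_le_trans h2 _; rewrite ler_pdivrMr // mul1r -natrX ler_nat.
  exact: badic_index_lt.
split; first by rewrite t0.
apply: badic_index_inj; first by rewrite size_badic_prefix.
rewrite badic_index_prefix ?t0 //; apply/eqP; rewrite truncn_eq; last by rewrite mulr_ge0 // ltW.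
by rewrite mulrC -ler_pdivrMr // h1 /= -ltr_pdivlMr.
Qed.

Lemma measurable_badic_cell u : measurable (badic_cell u).
Proof. by rewrite badic_cellE; exact: measurable_itv. Qed.

Lemma lebesgue_badic_cell u :
  lebesgue_measure (badic_cell u) = (b%:R ^- size u)%:E.
Proof.
rewrite badic_cellE lebesgue_measure_itv /= lte_fin.
have bn : 0 < (b%:R ^+ size u : R) by rewrite exprn_gt0.
rewrite ltr_pM2r ?invr_gt0 // ltr_nat ltnSn -EFinB -mulrBl -natr1.
by rewrite addrAC subrr add0r mul1r.
Qed.

Lemma badic_cell_left u :
  badic_cell u ((badic_index u)%:R / b%:R ^+ size u).
Proof.
rewrite badic_cellE /= in_itv /= lexx /= ltr_pM2r ?ltr_nat //.
by rewrite invr_gt0 exprn_gt0.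
Qed.

Lemma trivIset_badic_cell n (D : set (n.-tuple 'I_b)) :
  trivIset D (fun u : n.-tuple 'I_b => badic_cell u).
Proof.
move=> u1 u2 _ _ [t [[_ e] [_ e']]]; apply: val_inj.
by rewrite /= -e -e' !size_tuple.
Qed.

Lemma badic_cell_cover n :
  \big[setU/set0]_(u : n.-tuple 'I_b) badic_cell u = `[(0 : R), 1[%classic.
Proof.
rewrite -bigcup_seq; apply/seteqP; split => t.
  by move=> [u _ [t01 _]]; rewrite /= in_itv.
rewrite /= in_itv => t01.
have s : size (badic_prefix hb t n) == n by rewrite size_badic_prefix.
by exists (Tuple s) => /=; rewrite ?mem_index_enum //; split; rewrite ?size_badic_prefix.
Qed.

Lemma badic_cell_cat_cover u n :
  \big[setU/set0]_(w : n.-tuple 'I_b) badic_cell (u ++ w) = badic_cell u.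
Proof.
have prefixD t m : badic_prefix hb t (m + n) =
    badic_prefix hb t m ++ [seq badic_digit hb t i | i <- iota m n].
  by rewrite /badic_prefix iotaD map_cat.
rewrite -bigcup_seq; apply/seteqP; split => t.
  move=> [w _ [t01 e]]; split => //; move: e.
  rewrite size_cat size_tuple prefixD => /eqP.
  by rewrite eqseq_cat ?size_badic_prefix // => /andP[/eqP].
move=> [t01 e].
have s : size [seq badic_digit hb t i | i <- iota (size u) n] == n.
  by rewrite size_map size_iota.
exists (Tuple s) => /=; rewrite ?mem_index_enum //; split => //.
by rewrite size_cat (eqP s) prefixD e.
Qed.

Lemma trivIset_badic_cell_cat u n (D : set (n.-tuple 'I_b)) :
  trivIset D (fun w : n.-tuple 'I_b => badic_cell (u ++ w)).
Proof.
move=> w w' _ _ [t [[_ e] [_ e']]]; apply: val_inj.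
have sz : size (u ++ w') = size (u ++ w) by rewrite !size_cat !size_tuple.
by move: e'; rewrite sz e => /eqP; rewrite eqseq_cat // eqxx => /eqP.
Qed.

End badic_cells.

Section badic_mass.
Context (R : realType) (b : nat).
Hypothesis hb : (1 < b)%N.
Variable M : seq 'I_b -> R.
Hypotheses (M0 : forall u, 0 <= M u)
  (M_split : forall u n, M u = \sum_(w : n.-tuple 'I_b) M (u ++ w))
  (M_small : forall e, 0 < e -> exists n, forall u : n.-tuple 'I_b, M u <= e).

Let b0 : 0 < (b%:R : R). Proof. by rewrite ltr0n ltnW. Qed.

(** The value at i b^-n of the distribution function to be built; [G_refine] says that it does not
    depend on the generation. *)
Let G n i : R := \sum_(u : n.-tuple 'I_b | (badic_index u < i)%N) M u.

Let G0 n : G n 0 = 0.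
Proof. by rewrite /G big_pred0. Qed.

Let Gtop n i : (b ^ n <= i)%N -> G n i = M [::].
Proof.
move=> ni; rewrite /G [RHS](M_split _ n); apply: eq_bigl => u.
by rewrite (leq_trans _ ni) // -[X in (_ < _ ^ X)%N](size_tuple u) badic_index_lt.
Qed.

Let G_le n i j : (i <= j)%N -> G n i <= G n j.
Proof.
move=> ij; rewrite /G big_mkcond [leRHS]big_mkcond; apply: ler_sum => u _.
by case: ifP => ui; [rewrite (leq_trans ui)|case: ifP].
Qed.

Let badic_index_cat (u w : seq 'I_b) :
  badic_index (u ++ w) = (badic_index u * b ^ size w + badic_index w)%N.
Proof.
elim/last_ind: w => [|w c IH]; first by rewrite cats0 badic_index_nil muln1 addn0.
rewrite -rcons_cat !badic_index_rcons // IH size_rcons expnSr; ring.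
Qed.

Let G_refine n m i : G (n + m) (i * b ^ m) = G n i.
Proof.
rewrite /G big_mkcond
  (sum_tuple_cat _ _ (fun u => if (badic_index u < i * b ^ m)%N then M u else 0)).
rewrite [RHS]big_mkcond; apply: eq_bigr => u _.
have bm : (0 < b ^ m)%N by rewrite expn_gt0 ltnW.
have lt_ (w : m.-tuple 'I_b) :
    (badic_index (u ++ w) < i * b ^ m)%N = (badic_index u < i)%N.
  rewrite badic_index_cat size_tuple.
  have := badic_index_lt w; rewrite size_tuple => h.
  by rewrite -ltn_divLR // divnMDl // divn_small // addn0.
under eq_bigr do rewrite lt_.
by case: ifP => _; [rewrite -M_split|rewrite big1].
Qed.

Let G_step n i e : 0 <= e -> (forall u : n.-tuple 'I_b, M u <= e) ->
  G n i.+1 <= G n i + e.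
Proof.
move=> e0 Me; rewrite /G.
rewrite (bigID (fun u : n.-tuple 'I_b => (badic_index u < i)%N)) /=.
apply: lerD.
  rewrite big_mkcond [leRHS]big_mkcond; apply: ler_sum => u _.
  by case: ifP => [/andP[_ ->] //|_]; case: ifP.
rewrite (eq_bigl (fun u : n.-tuple 'I_b => badic_index u == i)); last first.
  by move=> u; rewrite -leqNgt ltnS eqn_leq.
case: (pickP (fun u : n.-tuple 'I_b => badic_index u == i)) => [u0 /eqP u0i|none].
  rewrite (bigD1 u0) /= ?u0i // big1 ?addr0 // => u /andP[/eqP ui /negP[]].
  apply/eqP/val_inj; apply: (badic_index_inj hb); first by rewrite !size_tuple.
  by rewrite ui u0i.
by rewrite big_pred0.
Qed.

Let G_index n (u : n.-tuple 'I_b) : G n (badic_index u).+1 - G n (badic_index u) = M u.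
Proof.
rewrite /G (bigID (fun u' : n.-tuple 'I_b => (badic_index u' < badic_index u)%N)) /=.
rewrite (eq_bigl (fun u' : n.-tuple 'I_b => (badic_index u' < badic_index u)%N)); last first.
  by move=> u'; rewrite ltnS andb_idl // => /ltnW.
rewrite addrAC subrr add0r (bigD1 u) /=; last by rewrite ltnS leqnn ltnn.
rewrite big1 ?addr0 // => u' /andP[h /negP[]].
apply/eqP/val_inj; apply: (badic_index_inj hb); first by rewrite !size_tuple.
case/andP: h => h1; rewrite -leqNgt => h2; apply/eqP.
by rewrite eqn_leq h2 andbT -ltnS.
Qed.

Let tr n (t : R) := Num.truncn (b%:R ^+ n * t).
Let h n t := G n (tr n t).
(** The distribution function: the supremum of its prescribed values at the b-adic points obtained
    by truncating t. *)
Let F t := sup (range (h ^~ t)).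

Let h_le_top n t : h n t <= M [::].
Proof. by rewrite -(@Gtop n (maxn (b ^ n) (tr n t))) ?leq_maxl // G_le ?leq_maxr. Qed.

Let h_has_sup t : has_sup (range (h ^~ t)).
Proof.
split; first by exists (h 0 t), 0%N.
by exists (M [::]) => _ [n _ <-]; exact: h_le_top.
Qed.

Let h_le_F n t : h n t <= F t.
Proof. by apply: ub_le_sup; [case: (h_has_sup t)|exists n]. Qed.

Let tr_refine n m t : 0 <= t ->
  (tr n t * b ^ m <= tr (n + m) t < (tr n t).+1 * b ^ m)%N.
Proof.
move=> t0; have bn k : 0 <= b%:R ^+ k * t by rewrite mulr_ge0 ?exprn_ge0 // ltW.
have /andP[h1 h2] := truncn_itv (bn n).
have bm : 0 < (b%:R ^+ m : R) by rewrite exprn_gt0.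
have e : b%:R ^+ (n + m) * t = b%:R ^+ n * t * b%:R ^+ m by rewrite exprD; ring.
rewrite truncn_ge_nat // truncn_lt_nat // !natrM !natrX e.
by rewrite ler_pM2r // h1 ltr_pM2r.
Qed.

Let tr_neg n t : t <= 0 -> tr n t = 0%N.
Proof.
move=> t0; apply/eqP; rewrite -leqn0 truncn_le_nat.
by apply: le_lt_trans ltr01; rewrite mulr_ge0_le0 ?exprn_ge0 // ltW.
Qed.

Let h_nd n m t : h n t <= h (n + m) t.
Proof.
have [t0|/ltW t0] := leP 0 t; last by rewrite /h !tr_neg // !G0.
by rewrite /h -(G_refine n m); apply: G_le; case/andP: (tr_refine n m t0).
Qed.

Let F_le n t : F t <= G n (tr n t).+1.
Proof.
apply: ge_sup; first by case: (h_has_sup t).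
move=> _ [k _ <-].
have [t0|/ltW t0] := leP 0 t; last first.
  by rewrite /h !tr_neg // G0 /G sumr_ge0.
apply: le_trans (h_nd k n t) _; rewrite addnC /h -(G_refine n k); apply: G_le.
by rewrite ltnW //; case/andP: (tr_refine n k t0).
Qed.

Let F_nd : nondecreasing F.
Proof.
move=> s t st; apply: ge_sup; first by case: (h_has_sup s).
move=> _ [k _ <-]; apply: le_trans (h_le_F k t); apply: G_le.
by apply: le_truncn; rewrite ler_wpM2l // exprn_ge0 // ltW.
Qed.

(** Points less than b^-n apart lie in the same or in adjacent cells of generation n, so F varies by
    at most the mass of two cells. Continuity of F and the absence of atoms both follow. *)
Let F_osc n e s t : (forall u : n.-tuple 'I_b, M u <= e) ->
  s <= t -> t < s + b%:R ^- n -> F t <= F s + 2 * e.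
Proof.
move=> Me st ts.
have c0 : 'I_b by exact: (Ordinal (ltnW hb)).
have e0 : 0 <= e by apply: le_trans (Me [tuple of nseq n c0]).
have bn : 0 < (b%:R ^+ n : R) by rewrite exprn_gt0.
have tr2 : (tr n t <= (tr n s).+1)%N.
  rewrite truncn_le_nat; have [s0|s0] := leP 0 s.
    have x0 : 0 <= b%:R ^+ n * s by rewrite mulr_ge0 // ltW.
    have /andP[_ hs] := truncn_itv x0.
    have := ltr_pM2l bn t (s + b%:R ^- n); rewrite ts mulrDr divff ?gt_eqF // => {}ts.
    by rewrite -natr1; apply: lt_trans ts _; rewrite ltrD2r.
  apply: (@lt_le_trans _ _ 1); last by rewrite ler1n.
  have : t < b%:R ^- n by apply: lt_le_trans ts _; rewrite gerDr ltW.
  by rewrite -(ltr_pM2l bn) divff ?gt_eqF.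
apply: le_trans (F_le n t) _.
apply: (@le_trans _ _ (G n (tr n s).+2)); first exact: G_le.
have := G_step (tr n s).+1 e0 Me; have := G_step (tr n s) e0 Me.
have := h_le_F n s; rewrite /h; lra.
Qed.

Let F_cts : continuous F.
Proof.
move=> s; apply/(@cvgrPdist_le _ R^o) => e e0.
have [n Mn] := M_small (divr_gt0 e0 (ltr0n _ 2)).
have bn : 0 < (b%:R ^- n : R) by rewrite invr_gt0 exprn_gt0.
near=> t.
have d : `|s - t| < b%:R ^- n.
  by near: t; apply: cvgr_dist_lt => //; exact: cvg_id.
have e2 : 2 * (e / 2) = e by field.
move: d; rewrite ltr_norml => /andP[d1 d2].
have [st|/ltW ts] := leP s t.
  have := F_nd st; have := F_osc Mn st; rewrite e2.
  have -> : t < s + b%:R ^- n by lra.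
  by move=> /(_ isT) ? ?; rewrite ler_norml; apply/andP; split; lra.
have := F_nd ts; have := F_osc Mn ts; rewrite e2.
have -> : s < t + b%:R ^- n by lra.
by move=> /(_ isT) ? ?; rewrite ler_norml; apply/andP; split; lra.
Unshelve. all: by end_near. Qed.

Let F_badic n i : F (i%:R / b%:R ^+ n) = G n i.
Proof.
have bn : 0 < (b%:R ^+ n : R) by rewrite exprn_gt0.
have tE m : tr (n + m) (i%:R / b%:R ^+ n) = (i * b ^ m)%N.
  rewrite /tr (_ : _ * _ = (i * b ^ m)%:R) ?natrK //.
  by rewrite natrM natrX exprD; field; rewrite gt_eqF.
apply/eqP; rewrite eq_le; apply/andP; split; last first.
  by have := h_le_F (n + 0) (i%:R / b%:R ^+ n); rewrite /h tE G_refine.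
apply: ge_sup; first by case: (h_has_sup (i%:R / b%:R ^+ n)).
move=> _ [k _ <-]; apply: le_trans (h_nd k n _) _.
by rewrite addnC /h tE G_refine.
Qed.

Let F_le0 t : t <= 0 -> F t = 0.
Proof.
move=> t0; apply/eqP; rewrite eq_le; apply/andP; split.
  apply: ge_sup; first by case: (h_has_sup t).
  by move=> _ [k _ <-]; rewrite /h tr_neg // G0.
by apply: le_trans (h_le_F 0 t); rewrite /h tr_neg // G0.
Qed.

Let F_ge1 t : 1 <= t -> F t = M [::].
Proof.
move=> t1; apply/eqP; rewrite eq_le; apply/andP; split.
  apply: ge_sup; first by case: (h_has_sup t).
  by move=> _ [k _ <-]; exact: h_le_top.
apply: le_trans (h_le_F 0 t); rewrite /h Gtop // expn0.
by rewrite truncn_ge_nat expr0 mul1r // (le_trans ler01).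
Qed.

Let F_rc := right_continuousW F_cts.

#[local] HB.instance Definition _ := isCumulative.Build R _ R F F_nd F_rc.

(** The Lebesgue-Stieltjes measure of F. Consistency of the masses fixes F at b-adic points, and
    uniform smallness makes F continuous, so end points carry no mass and cells receive exactly
    M. *)
Lemma badic_mass_measure : exists m : {measure set R -> \bar R},
  [/\ forall u, m (badic_cell hb u) = (M u)%:E,
      m (~` `[0, 1[) = 0%E & forall x, m [set x] = 0%E].
Proof.
have mid : measurable_fun setT (idfun : measurableTypeR R -> R).
  exact: (@measurable_id _ _ setT).
pose m' : {measure set R -> \bar R} :=
  pushforward (lebesgue_stieltjes_measure F) (idfun : measurableTypeR R -> R).
pose m := m' mid.
have moc a c : a <= c -> m `]a, c]%classic = (F c - F a)%:E.
  move=> ac; rewrite /m /m' /= /pushforward preimage_id.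
  rewrite /lebesgue_stieltjes_measure /measure_extension/=.
  by rewrite measurable_mu_extE/= ?wlength_itv_bnd//; exact: is_ocitv.
have m1 x : m [set x] = 0%E.
  apply/eqP; rewrite eq_le measure_ge0 andbT; apply/lee_addgt0Pr => e e0.
  rewrite add0e.
  have [n Mn] := M_small (divr_gt0 e0 (ltr0n _ 2)).
  have bn : 0 < (b%:R ^- n : R) by rewrite invr_gt0 exprn_gt0.
  pose s := x - b%:R ^- n / 2.
  have sx : s < x by rewrite /s gtrDl oppr_lt0 divr_gt0.
  apply: (@le_trans _ _ (m `]s, x]%classic)).
    by apply: le_measure; rewrite ?inE //; move=> _ -> /=; rewrite in_itv /= sx lexx.
  rewrite moc ?(ltW sx) // lee_fin lerBlDl.
  have -> : F s + e = F s + 2 * (e / 2) by field.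
  by apply: F_osc Mn (ltW sx) _; rewrite /s; lra.
have mco a c : a < c -> m `[a, c[%classic = (F c - F a)%:E.
  move=> ac; rewrite -moc ?(ltW ac) //.
  transitivity (m `[a, c]%classic).
    rewrite -(@setUitv1 _ _ _ c true) ?bnd_simp ?(ltW ac) // measureU //.
      by rewrite [X in (_ + X)%E]m1 adde0.
    by apply/seteqP; split => x //= [] /[swap] ->; rewrite in_itv /= ltxx andbF.
  rewrite -(@setU1itv _ _ _ a false) ?bnd_simp ?(ltW ac) // measureU //.
    by rewrite [X in (X + _)%E]m1 add0e.
  by apply/seteqP; split => x //= [] ->; rewrite in_itv /= ltxx.
exists m; split => //.
- move=> u; rewrite badic_cellE // mco.
    by rewrite !F_badic -(@G_index _ (in_tuple u)).
  by rewrite ltr_pM2r ?invr_gt0 ?exprn_gt0 // ltr_nat.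
(* F is constant on each side of [0, 1], so the complement is covered by countably many null
   intervals and the null point 1. *)
- have cover : ~` `[(0 : R), 1[%classic `<=` \bigcup_n (`]- n%:R, 0]%classic `|`
      ([set 1] `|` `]1, n%:R + 1]%classic)).
    move=> x.
    rewrite /= in_itv /= => /negP; rewrite negb_and -ltNge -leNgt => /orP xx.
    exists (Num.truncn `|x|).+1 => //.
    have /andP[_ xn] := truncn_itv (normr_ge0 x).
    move: xn; rewrite ltr_norml => /andP[x1 x2].
    case: xx => xx; first by left; rewrite /= in_itv /= x1 ltW.
    right; move: xx; rewrite le_eqVlt => /predU1P[<-|xx]; [by left|right].
    by rewrite /= in_itv /= xx; lra.
  apply/negligibleP; first exact: measurableC.
  apply: (negligibleS cover).
  apply: negligible_bigcup => n; apply: negligibleU.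
    apply/negligibleP => //; rewrite [LHS]moc ?oppr_le0 //.
    by rewrite !F_le0 ?oppr_le0 // subrr.
  apply: negligibleU; first by apply/negligibleP => //; exact: m1.
  apply/negligibleP => //; rewrite [LHS]moc ?lerDr //.
  by rewrite !F_ge1 ?lerDr // subrr.
Qed.

End badic_mass.

(** * Weak convergence of the cascade densities *)

Lemma heine_cantor_itv (R : realType) (f : R -> R) (e : R) :
  {within `[0, 1], continuous f} -> 0 < e ->
  exists2 dl : R, 0 < dl & forall x y, 0 <= x <= 1 -> 0 <= y <= 1 ->
    `|x - y| < dl -> `|f x - f y| < e.
Proof.
move=> /subspace_continuousP cf e0.
pose K : set R := `[0, 1]%classic.
pose Pd (dl x : R) := K x -> forall y, K y -> `|x - y| < dl -> `|f x - f y| < e.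
have cK : compact K by exact: segment_compact.
have /compact_near_coveringP nc := cK.
have := nc R (0^'+) Pd _.
case=> [x Kx|dl /= dl0 sub].
- have /cvgrPdist_lt /(_ _ (divr_gt0 e0 (ltr0n _ 2))) := cf x Kx.
  move=> /nbhs_ballP[r /= r0 xr].
  have r2 : 0 < r / 2 by rewrite divr_gt0.
  exists (ball x (r / 2), [set dl | 0 < dl < r / 2]) => /=.
    split; first exact: nbhsx_ballx.
    exists (r / 2) => //= z; rewrite /= sub0r normrN => zr z0.
    by rewrite z0 (le_lt_trans (ler_norm z)).
  move=> [x' dl] /= [xx' /andP[d0 dr]] Kx' y Ky x'y.
  have h1 : `|f x - f x'| < e / 2.
    by apply: xr => //; rewrite /ball /= (lt_trans xx') // ltr_pdivrMr // ltr_pMr // ltr1n.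
  have h2 : `|f x - f y| < e / 2.
    apply: xr => //; rewrite /ball /=.
    have -> : x - y = (x - x') + (x' - y) by ring.
    apply: le_lt_trans (ler_normD _ _) _.
    by have := xx'; rewrite /ball /=; move: x'y dr; lra.
  have -> : f x' - f y = (f x - f y) - (f x - f x') by ring.
  by apply: le_lt_trans (ler_normB _ _) _; move: h1 h2; lra.
- pose d1 := dl / 2; have d10 : 0 < d1 by rewrite divr_gt0.
  exists d1 => // x y x01 y01 xy.
  apply: (sub d1) => //.
  rewrite /ball /= sub0r normrN gtr0_norm //.
  by rewrite /d1 ltr_pdivrMr // ltr_pMr // ltr1n.
Qed.

Section piecewise_constant_approximation.
Context d (T : measurableType d) (R : realType).
Variables (mu : {measure set T -> \bar R}) (I : finType) (D : I -> set T).
Variables (f g : T -> R) (c : I -> R) (e C : R).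
Let U := \big[setU/set0]_(i : I) D i.
Hypotheses (mD : forall i, measurable (D i)) (tD : trivIset setT D)
  (ig : mu.-integrable U (EFin \o g)) (g0 : forall x, U x -> 0 <= g x)
  (mf : measurable_fun U f) (fC : forall x, U x -> `|f x| <= C)
  (fc : forall i x, D i x -> `|f x - c i| <= e).

Let mU : measurable U. Proof. exact: bigsetU_measurable. Qed.
Let DU i : D i `<=` U.
Proof. by rewrite /U -bigcup_seq => x Dx; exists i => //=; rewrite mem_index_enum. Qed.

Lemma integrable_bounded_mul : mu.-integrable U (fun x => (f x * g x)%:E).
Proof.
apply: (@le_integrable _ _ _ _ _ _ _ (fun x => (C%:E * (g x)%:E)%E)) => //.
- apply/measurable_EFinP; apply: measurable_funM => //.
  by apply/measurable_EFinP; exact: measurable_int ig.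
- move=> x Ux; rewrite -EFinM !abse_EFin lee_fin !normrM.
  rewrite ler_wpM2r // (le_trans (fC Ux)) // ler_norm //.
- exact: integrableZl.
Qed.

(** Serves on both sides of the weak convergence: with g a cascade density and Lebesgue measure, and
    with g = 1 and the limit measure. *)
Lemma integral_piecewise_gap :
  `|\int[mu]_(x in U) (f x * g x) - \sum_(i : I) c i * \int[mu]_(x in D i) g x|
  <= e * \int[mu]_(x in U) g x.
Proof.
have igD i : mu.-integrable (D i) (EFin \o g) by exact: integrableS ig.
have ifgD i : mu.-integrable (D i) (EFin \o (fun x => f x * g x)).
  exact: integrableS integrable_bounded_mul.
have split_ (h : T -> R) : mu.-integrable U (EFin \o h) ->
    \int[mu]_(x in U) h x = \sum_(i : I) \int[mu]_(x in D i) h x.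
  move=> ih; rewrite /Rintegral integral_bigsetU_EFin //.
  - rewrite -sum_fine // => i _.
    by apply: integrable_fin_num => //; exact: integrableS ih.
  - exact: index_enum_uniq.
  - exact: sub_trivIset tD.
  - exact: measurable_int ih.
rewrite (split_ _ integrable_bounded_mul) (split_ _ ig) -sumrB big_distrr /=.
apply: le_trans (ler_norm_sum _ _ _) _; apply: ler_sum => i _.
have icg (r : R) : mu.-integrable (D i) (EFin \o (fun x => r * g x)).
  have h := integrableZl (mD i) r (igD i).
  by apply: eq_integrable h => //; exact: mD.
rewrite -!RintegralZl // -RintegralB //.
have iB : mu.-integrable (D i) (EFin \o (fun x => f x * g x - c i * g x)).
  have h := integrableB (mD i) (ifgD i) (icg (c i)).
  by apply: eq_integrable h => //; exact: mD.
apply: le_trans (le_normr_Rintegral _ _) _ => //.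
apply: le_Rintegral => //; first exact: integrable_norm.
move=> x Dx; rewrite -mulrBl normrM (ger0_norm (g0 (DU Dx))).
by rewrite ler_wpM2r ?fc // g0 //; exact: DU Dx.
Qed.

End piecewise_constant_approximation.

Section weak_limits.
Context (R : realType).

(** The inner maximum is the distance from t to [a, c]: these continuous functions decrease to the
    indicator of [a, c] as k grows. *)
Definition tent (a c : R) (k : nat) (t : R) : R :=
  Num.max 0 (1 - k%:R * Num.max 0 (Num.max (a - t) (t - c))).

Lemma cvg_integral_tent (m : {measure set R -> \bar R}) (a c : R) :
  (m `[0%R, 1%R]%classic < +oo)%E -> 0 <= a -> c <= 1 ->
  (fun k => \int[m]_(t in `[0%R, 1%R])
     (tent a c k t)%:E)%E
    @ \oo --> m `[a, c]%classic.
Proof.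
move=> mfin a0 c1.
have -> : m `[a, c]%classic =
    (\int[m]_(t in `[0%R, 1%R]) (\1_(`[a, c]%classic) t)%:E)%E.
  rewrite integral_indic // setIidl // => t /=; rewrite !in_itv /= => /andP[at_ tc].
  by rewrite (le_trans a0) // (le_trans tc).
pose f_ (k : nat) (t : R) := (tent a c k t)%:E.
have mf k : measurable_fun setT (tent a c k).
  apply: (measurable_maxr (measurable_cst _)).
  apply: measurable_funB => //; apply: measurable_funM => //.
  apply: (measurable_maxr (measurable_cst _)).
  by apply: measurable_maxr; exact: measurable_funB.
have := @dominated_cvg _ R R m `[0%R, 1%R]%classic (measurable_itv _) f_
  (fun t => (\1_(`[a, c]%classic) t)%:E) (cst 1%E).
apply => //.
- move=> k; apply/measurable_EFinP; exact: measurable_funTS.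
- move=> t _; rewrite /f_ /tent indicE.
  set dd := Num.max 0 (Num.max (a - t) (t - c)).
  have [tac|tac] := boolP (t \in `[a, c]%classic).
  + have dd0 : dd = 0.
      move: tac; rewrite inE /= in_itv /= => /andP[h1 h2].
      by apply/max_idPl; rewrite ge_max !subr_le0 h1 h2.
    by rewrite dd0; under eq_fun do rewrite mulr0 subr0 max_r //; exact: cvg_cst.
  + have dd0 : 0 < dd.
      move: tac; rewrite /dd lt_max ltxx /= lt_max !subr_gt0 notin_setE /= in_itv /=.
      by move=> /negP; rewrite negb_and -!ltNge.
    apply: cvg_near_cst; near=> k; congr EFin.
    rewrite max_l // subr_le0 -ler_pdivrMr // mul1r.
    by near: k; exact: nbhs_infty_ger.
- apply/integrableP; split => //; under eq_integral do rewrite abse1.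
  by rewrite integral_cst // mul1e.
- move=> k t _; rewrite /f_ /tent abse_EFin lee_fin ger0_norm ?le_max ?lexx //.
  by rewrite ge_max ler01 /= gerDl oppr_le0 mulr_ge0 // le_max lexx.
Unshelve. all: by end_near. Qed.

Lemma continuous_tent (a c : R) (k : nat) :
  continuous (tent a c k).
Proof.
move=> t; rewrite /tent.
have cm (f g : R -> R) : {for t, continuous f} -> {for t, continuous g} ->
   {for t, continuous (fun x => Num.max (f x) (g x))} by exact: continuous_max.
apply: (cm); first exact: cst_continuous.
apply: (@continuousB _ R^o); first exact: cst_continuous.
apply: (@continuousM _ R^o); first exact: cst_continuous.
apply: (cm); first exact: cst_continuous.
apply: (cm); apply: (@continuousB _ R^o); try exact: cst_continuous; exact: cvg_id.
Qed.

(** [weak_lim_density] selects some limit. The total mass and the masses of closed intervals are all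
    that the counting sees, and tent functions determine them. *)
Lemma weak_cvg_density_unique (g : nat -> R -> R) (m1 m2 : {measure set R -> \bar R}) :
  weak_cvg_density g m1 -> weak_cvg_density g m2 ->
  m1 [set: R] = m2 [set: R] /\
  forall a c, 0 <= a -> c <= 1 -> m1 `[a, c]%classic = m2 `[a, c]%classic.
Proof.
move=> [f1 n1 w1] [f2 n2 w2].
have itv_fin (m : {measure set R -> \bar R}) : (m [set: R] < +oo)%E ->
    (m `[0%R, 1%R]%classic < +oo)%E.
  by move=> h; apply: (le_lt_trans _ h); apply: le_measure; rewrite ?inE //; exact: measurable_itv.
have itv_eq a c : 0 <= a -> c <= 1 -> m1 `[a, c]%classic = m2 `[a, c]%classic.
  move=> a0 c1; have h1 := cvg_integral_tent (itv_fin _ f1) a0 c1.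
  have h2 := cvg_integral_tent (itv_fin _ f2) a0 c1.
  rewrite -(cvg_lim _ h1) // -(cvg_lim _ h2) //; apply: congr_lim; apply/funext => k.
  have ck : {within `[0, 1], continuous (tent a c k)}.
    by apply: continuous_subspaceT; exact: continuous_tent.
  by rewrite -(cvg_lim _ (w1 _ ck)) // -(cvg_lim _ (w2 _ ck)).
split => //.
have full (m : {measure set R -> \bar R}) : m (~` `[0%R, 1%R]) = 0%E ->
    m [set: R] = m `[0%R, 1%R]%classic.
  move=> m0; rewrite -(setUv `[0%R, 1%R]%classic) measureU.
  - by rewrite [X in (_ + X)%E]m0 adde0.
  - exact: measurable_itv.
  - by apply: measurableC; exact: measurable_itv.
  - exact: setICr.
by rewrite !full // itv_eq.
Qed.

End weak_limits.

Lemma measurable_fun_bigsetU d d' (T : measurableType d) (T' : measurableType d')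
    (I : Type) (s : seq I) (D : I -> set T) (f : T -> T') :
  (forall i, measurable (D i)) -> (forall i, measurable_fun (D i) f) ->
  measurable_fun (\big[setU/set0]_(i <- s) D i) f.
Proof.
move=> mD mf; elim: s => [|i s IH].
  by rewrite big_nil; exact: measurable_fun_set0.
rewrite big_cons; apply/measurable_funU => //.
by apply: bigsetU_measurable => j _; exact: mD.
Qed.

Lemma cvg_sumr (R : realType) (I : Type) (s : seq I) (f : I -> nat -> R) (l : I -> R) :
  (forall i, f i n @[n --> \oo] --> l i) ->
  (\sum_(i <- s) f i n) @[n --> \oo] --> \sum_(i <- s) l i.
Proof.
move=> fl; elim: s => [|i s IH].
  by under eq_fun do rewrite big_nil; rewrite big_nil; exact: cvg_cst.
under eq_fun do rewrite big_cons.
by rewrite big_cons; apply: cvgD => //; exact: fl.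
Qed.

Section cascade_limit.
Context (R : realType) (b : nat).
Hypothesis hb : (1 < b)%N.
Variables (V : seq 'I_b -> 'I_b -> R) (v : seq 'I_b) (Y : seq 'I_b -> R).
Hypotheses (V0 : forall w i, 0 <= V w i)
  (VY : forall w, Ym V w n @[n --> \oo] --> Y w)
  (small : forall e, 0 < e -> exists n, forall u : n.-tuple 'I_b,
     cw V v u * Y (v ++ u) <= e).

Let M u := cw V v u * Y (v ++ u).

Let Y0 w : 0 <= Y w.
Proof.
rewrite -(cvg_lim _ (@VY w)) //; apply: limr_ge; first by apply/cvg_ex; exists (Y w).
by apply: nearW => n; exact: Ym_ge0.
Qed.

Let M0 u : 0 <= M u.
Proof. by rewrite mulr_ge0 // cw_ge0. Qed.

Let Y_split w n : Y w = \sum_(u : n.-tuple 'I_b) cw V w u * Y (w ++ u).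
Proof.
have h1 : Ym V w (n + m) @[m --> \oo] --> Y w.
  by under eq_fun do rewrite addnC; exact: (cvg_comp _ _ (cvg_addnr n) (@VY w)).
have h2 : Ym V w (n + m) @[m --> \oo] -->
    \sum_(u : n.-tuple 'I_b) cw V w u * Y (w ++ u).
  under eq_fun do rewrite Ym_add.
  by apply: cvg_sumr => u; apply: cvgM; [exact: cvg_cst|exact: VY].
by rewrite -(cvg_lim _ h1) // -(cvg_lim _ h2).
Qed.

Let M_split u n : M u = \sum_(w : n.-tuple 'I_b) M (u ++ w).
Proof.
rewrite /M {1}(Y_split (v ++ u) n) big_distrr /=; apply: eq_bigr => w _.
by rewrite cw_cat mulrA catA.
Qed.

Let b0 : 0 < (b%:R : R). Proof. by rewrite ltr0n ltnW. Qed.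

Lemma density_on_cell u t : badic_cell hb u t ->
  cascade_density hb V v (size u) t = b%:R ^+ size u * cw V v u.
Proof.
move=> [_ e]; rewrite /cascade_density; congr (_ * _); rewrite -[in RHS]e.
elim: (size u) => [|n IH]; first by rewrite big_ord0.
by rewrite badic_prefixS cw_rcons big_ord_recr /= IH.
Qed.

Let mdens_cell u (n : nat) : size u = n ->
  measurable_fun (badic_cell hb u) (cascade_density hb V v n).
Proof.
move=> <-; apply: (eq_measurable_fun (cst (b%:R ^+ size u * cw V v u))) => //.
by move=> t; rewrite inE => /density_on_cell ->.
Qed.

Lemma measurable_density_cell u k :
  measurable_fun (badic_cell hb u) (cascade_density hb V v (size u + k)).
Proof.
rewrite -(@badic_cell_cat_cover R b hb u k); apply: measurable_fun_bigsetU.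
  by move=> w; exact: measurable_badic_cell.
by move=> w; apply: mdens_cell; rewrite size_cat size_tuple.
Qed.

Lemma integral_density_cell u k :
  (\int[@lebesgue_measure R]_(t in badic_cell hb u)
    (cascade_density hb V v (size u + k) t)%:E = (cw V v u * Ym V (v ++ u) k)%:E)%E.
Proof.
rewrite -(@badic_cell_cat_cover R b hb u k) integral_bigsetU_EFin.
- rewrite /Ym big_distrr /= -sumEFin; apply: eq_bigr => w _.
  rewrite (eq_integral (cst (b%:R ^+ (size u + k) * cw V v (u ++ w))%:E)); last first.
    move=> t; rewrite inE => /density_on_cell.
    by rewrite size_cat size_tuple => ->.
  rewrite integral_cst; last exact: measurable_badic_cell.
  rewrite [X in (_ * X)%E](@lebesgue_badic_cell R b hb (u ++ w)) -EFinM size_cat size_tuple cw_cat; congr EFin.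
  by rewrite mulrAC mulfV ?mul1r // expf_neq0 // gt_eqF.
- by move=> w; exact: measurable_badic_cell.
- exact: index_enum_uniq.
- exact: trivIset_badic_cell_cat.
- apply/measurable_EFinP; rewrite (@badic_cell_cat_cover R b hb u k).
  exact: measurable_density_cell.
Qed.

Lemma density_ge0 j t : 0 <= cascade_density hb V v j t.
Proof. by rewrite mulr_ge0 ?exprn_ge0 ?prodr_ge0 // ltW. Qed.

Let cell_nil : badic_cell hb [::] = `[(0 : R), 1[%classic.
Proof.
rewrite -(@badic_cell_cover R b hb 0); apply/seteqP; split => t; rewrite -bigcup_seq.
  by move=> h; exists [tuple] => //=; rewrite ?mem_index_enum.
by move=> [u _]; rewrite (tuple0 u).
Qed.

Let integrable_density (u : seq 'I_b) j : (size u <= j)%N ->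
  (@lebesgue_measure R).-integrable (badic_cell hb u) (EFin \o cascade_density hb V v j).
Proof.
move=> uj; rewrite -(subnKC uj); apply/integrableP; split.
  by apply/measurable_EFinP; exact: measurable_density_cell.
under eq_integral do rewrite /= ger0_norm ?density_ge0 //.
by rewrite integral_density_cell ltry.
Qed.

(** Riemann sums: f is nearly constant on the cells of a fixed generation n. The integral of the
    j-th density over the cell of u is cw(u) times the mass at v ++ u after j - n generations, which
    tends to m of that cell. *)
Lemma cascade_weak_cvg (m : {measure set R -> \bar R}) :
  (forall u, m (badic_cell hb u) = (M u)%:E) ->
  m (~` `[0, 1[) = 0%E -> (forall x, m [set x] = 0%E) ->
  weak_cvg_density (cascade_density hb V v) m.
Proof.
move=> mM m01 m1.
have mtot : m `[0, 1[%classic = (Y v)%:E by rewrite -cell_nil mM /M /= mul1r cats0.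
have mT : m [set: R] = (Y v)%:E.
  rewrite -(setUv `[0%R, 1%R[%classic) measureU.
  - by rewrite [X in (_ + X)%E]m01 adde0.
  - exact: measurable_itv.
  - by apply: measurableC; exact: measurable_itv.
  - exact: setICr.
split; first by rewrite mT ltry.
  apply/eqP; rewrite eq_le measure_ge0 andbT -m01; apply: le_measure; rewrite ?inE.
  - by apply: measurableC; exact: measurable_itv.
  - by apply: measurableC; exact: measurable_itv.
  - apply: subsetC => x /=; rewrite !in_itv /= => /andP[-> /ltW ->] //.
move=> f cf.
pose I01 : set R := `[0, 1]%classic; pose Ico : set R := `[0, 1[%classic.
have mf : measurable_fun I01 f.
  by apply: subspace_continuous_measurable_fun => //; exact: measurable_itv.
have mf' : measurable_fun Ico f.
  apply: measurable_funS mf; first exact: measurable_itv.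
  by move=> x; rewrite /Ico /I01 /= !in_itv /= => /andP[-> /ltW ->].
pose lam : {measure set (measurableTypeR R) -> \bar R} := @lebesgue_measure R.
have cellU n := @badic_cell_cover R b hb n.
pose lft (u : seq 'I_b) : R := (badic_index u)%:R / b%:R ^+ size u.
have approx e : 0 < e -> exists n, forall (u : n.-tuple 'I_b) t,
    badic_cell hb u t -> `|f t - f (lft u)| <= e.
  move=> e0; have [dl dl0 hdl] := heine_cantor_itv cf e0.
  have dli : 0 <= dl^-1 by rewrite invr_ge0 ltW.
  pose n := (Num.truncn dl^-1).+1; exists n => u t ut.
  have bn : 0 < (b%:R ^+ n : R) by rewrite exprn_gt0.
  have ndl : b%:R ^- n < dl.
    rewrite invf_plt ?posrE //; have /andP[_ h] := truncn_itv dli.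
    by apply: lt_trans h _; rewrite -natrX ltr_nat ltn_expl.
  have [t01 _] := ut; have [l01 _] := @badic_cell_left R b hb u.
  apply/ltW/hdl.
  - by case/andP: t01 => -> /ltW ->.
  - by case/andP: l01 => -> /ltW ->.
  - apply: lt_trans ndl; move: ut; rewrite badic_cellE size_tuple /= in_itv /= => /andP[h1 h2].
    rewrite /lft size_tuple ger0_norm ?subr_ge0 // ltrBlDr.
    by apply: lt_le_trans h2 _; rewrite -natr1 mulrDl mul1r addrC.
have bnd : exists C, forall t, 0 <= t < 1 -> `|f t| <= C.
  have [n hn] := approx 1 ltr01.
  exists (1 + \sum_(u : n.-tuple 'I_b) `|f (lft u)|) => t t01.
  have : `[(0 : R), 1[%classic t by rewrite /= in_itv.
  rewrite -(cellU n) -bigcup_seq => -[u _ ut].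
  have -> : f t = (f t - f (lft u)) + f (lft u) by ring.
  apply: le_trans (ler_normD _ _) _; apply: lerD; first exact: hn.
  by rewrite (bigD1 u) //= lerDl sumr_ge0.
have [C fC] := bnd.
have fC' t : Ico t -> `|f t| <= C by rewrite /Ico /= in_itv; exact: fC.
have ig j : lam.-integrable Ico (EFin \o cascade_density hb V v j).
  by rewrite /Ico -cell_nil; exact: integrable_density.
have i1 : m.-integrable Ico (EFin \o cst 1).
  apply/integrableP; split; first exact/measurable_EFinP.
  under eq_integral do rewrite /= normr1.
  by rewrite integral_cst /Ico ?mtot ?mul1e ?ltry //; exact: measurable_itv.
have mcell n (u : n.-tuple 'I_b) : measurable (badic_cell hb u : set R).
  exact: measurable_badic_cell.
pose J j := \int[lam]_(t in Ico) (f t * cascade_density hb V v j t).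
pose Jm := \int[m]_(t in Ico) (f t * cst 1 t).
have gap j e n : (n <= j)%N -> (forall (u : n.-tuple 'I_b) t,
    badic_cell hb u t -> `|f t - f (lft u)| <= e) ->
    `|J j - \sum_(u : n.-tuple 'I_b) f (lft u) * (cw V v u * Ym V (v ++ u) (j - n))|
    <= e * Ym V v j.
  move=> nj hn.
  have := @integral_piecewise_gap _ _ R lam _ (fun u : n.-tuple 'I_b => badic_cell hb u)
    f (cascade_density hb V v j) (fun u => f (lft u)) e C (@mcell n)
    (@trivIset_badic_cell R b hb n _).
  rewrite cellU => /(_ (ig j) (fun t _ => density_ge0 j t) mf' fC' hn).
  have -> : \int[lam]_(t in Ico) cascade_density hb V v j t = Ym V v j.
    rewrite /Rintegral /Ico -cell_nil.
    by rewrite (integral_density_cell [::] j) /= mul1r cats0.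
  congr (`|_ - _| <= _); apply: eq_bigr => u _; congr (_ * _).
  have := integral_density_cell u (j - n); rewrite size_tuple subnKC // /Rintegral => e1.
  by rewrite [X in fine X]e1.
have gapm e n : (forall (u : n.-tuple 'I_b) t,
    badic_cell hb u t -> `|f t - f (lft u)| <= e) ->
    `|Jm - \sum_(u : n.-tuple 'I_b) f (lft u) * M u| <= e * Y v.
  move=> hn.
  have := @integral_piecewise_gap _ _ R m _ (fun u : n.-tuple 'I_b => badic_cell hb u)
    f (cst 1) (fun u => f (lft u)) e C (@mcell n) (@trivIset_badic_cell R b hb n _).
  rewrite cellU => /(_ i1 (fun t _ => ler01) mf' fC' hn).
  rewrite Rintegral_cst; last exact: measurable_itv.
  rewrite mtot mul1r; congr (`|_ - _| <= _); apply: eq_bigr => u _; congr (_ * _).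
  rewrite Rintegral_cst; last exact: mcell.
  by rewrite mM mul1r.
(* The point 1, outside every cell, is null for m and for Lebesgue measure. *)
have -> : (\int[m]_(t in `[0%R, 1%R]) (f t)%:E)%E = Jm%:E.
  have II : Ico `|` [set 1] = `[0%R, 1%R]%classic.
    by rewrite /Ico (@setUitv1 _ _ _ 1 true) // bnd_simp.
  have mII : measurable_fun (Ico `|` [set 1]) (EFin \o f).
    by rewrite II; apply/measurable_EFinP.
  rewrite -II integral_setU //; last 2 first.
  - exact: measurable_itv.
  - by rewrite disj_set2E; apply/eqP/seteqP; split => x // -[]; rewrite /Ico /= in_itv /= => /[swap] ->; rewrite ltxx andbF.
  have z : (\int[m]_(x in [set 1%R]) (f x)%:E = 0)%E.
    apply: null_set_integral; [exact: measurable_set1|exact: measurable_fun_set1|exact: m1].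
  rewrite z adde0.
  have ifm : m.-integrable Ico (EFin \o (fun t => f t * cst 1 t)).
    have := @integrable_bounded_mul _ _ R m _ (fun u : 0.-tuple 'I_b => badic_cell hb u)
      f (cst 1) C (@mcell 0).
    by rewrite cellU; apply.
  rewrite /Jm /Rintegral fineK; last by apply: integrable_fin_num => //; exact: measurable_itv.
  by apply: eq_integral => t _; rewrite /= mulr1.
have JE j : (\int[lam]_(t in `[0%R, 1%R]) (f t * cascade_density hb V v j t)%:E)%E = (J j)%:E.
  have ifl : lam.-integrable Ico (EFin \o (fun t => f t * cascade_density hb V v j t)).
    have := @integrable_bounded_mul _ _ R lam _ (fun u : 0.-tuple 'I_b => badic_cell hb u)
      f (cascade_density hb V v j) C (@mcell 0).
    by rewrite cellU; apply.
  rewrite /J /Rintegral fineK; last by apply: integrable_fin_num => //; exact: measurable_itv.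
  rewrite -integral_itv_bndo_bndc //.
  exact: measurable_int ifl.
rewrite (_ : (fun j => _) = EFin \o J); last by apply/funext => j; exact: JE.
apply: cvg_EFin; first exact: nearW.
rewrite (_ : fine \o _ = J) //.
apply/(@cvgrPdist_le _ R^o) => e e0.
(* Both total masses are eventually at most Y + 1, so an oscillation e / (4 (Y + 1)) of f costs e /
   4 on each side; the finite sums take the remaining e / 2. *)
have Y1 : 0 < 4 * (Y v + 1) by rewrite mulr_gt0 // ltr_wpDl.
have [n hn] := approx _ (divr_gt0 e0 Y1).
have cS : \sum_(u : n.-tuple 'I_b) f (lft u) * (cw V v u * Ym V (v ++ u) (j - n))
    @[j --> \oo] --> \sum_(u : n.-tuple 'I_b) f (lft u) * M u.
  apply: cvg_sumr => u; apply: cvgM; first exact: cvg_cst.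
  apply: cvgM; first exact: cvg_cst.
  exact: (cvg_comp _ _ (cvg_subnr n) (@VY _)).
have e2 : 0 < e / 2 by rewrite divr_gt0.
have /cvgrPdist_le /(_ _ e2) cS' := cS.
have /cvgrPdist_le /(_ _ ltr01) cY := @VY v.
near=> j.
have nj : (n <= j)%N by near: j; exact: nbhs_infty_ge.
have g1 := gap j _ n nj hn; have g2 := gapm _ n hn.
have g3 : `|\sum_(u : n.-tuple 'I_b) f (lft u) * M u -
   \sum_(u : n.-tuple 'I_b) f (lft u) * (cw V v u * Ym V (v ++ u) (j - n))| <= e / 2.
  by near: j.
have g4 : `|Y v - Ym V v j| <= 1 by near: j.
have Yj : Ym V v j <= Y v + 1 by move: g4; rewrite ler_norml; lra.
set S1 := \sum_u _ in g1 g3; set S2 := \sum_u _ in g2 g3.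
have -> : Jm - J j = (Jm - S2) + (S2 - S1) - (J j - S1) by ring.
have e4 : 0 <= e / (4 * (Y v + 1)) by rewrite ltW // divr_gt0.
have g1' : `|J j - S1| <= e / 4.
  apply: le_trans g1 _; apply: le_trans (ler_wpM2l e4 Yj) _.
  by rewrite le_eqVlt; apply/orP; left; apply/eqP; field; rewrite gt_eqF // ltr_wpDl.
have g2' : `|Jm - S2| <= e / 4.
  apply: le_trans g2 _; apply: le_trans (ler_wpM2l e4 (_ : Y v <= Y v + 1)) _; first by rewrite lerDl.
  by rewrite le_eqVlt; apply/orP; left; apply/eqP; field; rewrite gt_eqF // ltr_wpDl.
apply: le_trans (ler_normB _ _) _; apply: (le_trans (lerD (ler_normD _ _) (lexx _))).
by move: g1' g2' g3; lra.
Unshelve. all: by end_near. Qed.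

Lemma cascade_measureE :
  cascade_measure hb V v [set: R] = (Y v)%:E /\
  forall u, cascade_measure hb V v (badic_itv u : set R) = (cw V v u * Y (v ++ u))%:E.
Proof.
have [m [mM m01 m1]] := badic_mass_measure hb M0 M_split small.
have wm := cascade_weak_cvg mM m01 m1.
have [w' [itvE mT]] : weak_cvg_density (cascade_density hb V v) (cascade_measure hb V v) /\
    (forall u, m (badic_itv u : set R) = (M u)%:E) /\ m [set: R] = (Y v)%:E.
  split.
    rewrite /cascade_measure /weak_lim_density; case: pselect => [h|[]].
      exact: projT2 (cid h).
    by exists m.
  split.
    move=> u; have bn : 0 < (b%:R ^+ size u : R) by rewrite exprn_gt0.
    have lt_ : (badic_index u)%:R / b%:R ^+ size u < (badic_index u).+1%:R / b%:R ^+ size u :> R.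
      by rewrite ltr_pM2r ?invr_gt0 // ltr_nat.
    rewrite /badic_itv -(@setUitv1 _ _ _ _ true) ?bnd_simp ?(ltW lt_) // -badic_cellE //.
    rewrite measureU.
    - by rewrite [X in (_ + X)%E]m1 adde0; exact: mM.
    - exact: measurable_badic_cell.
    - exact: measurable_set1.
    - apply/seteqP; split => x // -[]; rewrite badic_cellE //= in_itv /= => /[swap] ->.
      by rewrite ltxx andbF.
  rewrite -(setUv `[0%R, 1%R[%classic) measureU.
  - rewrite [X in (_ + X)%E]m01 adde0.
    by have := mM [::]; rewrite cell_nil /M /= mul1r cats0.
  - exact: measurable_itv.
  - by apply: measurableC; exact: measurable_itv.
  - exact: setICr.
have [T1 I1] := weak_cvg_density_unique w' wm.
split; first by rewrite T1.
move=> u; rewrite -[RHS]itvE; apply: I1; first by rewrite divr_ge0 ?exprn_ge0 // ltW.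
by rewrite ler_pdivrMr ?exprn_gt0 // mul1r -natrX ler_nat badic_index_lt.
Qed.

End cascade_limit.

(** * The structure function tau *)

Lemma expR_taylor2 (R : realType) (y : R) :
  0 <= expR y - 1 - y <= y ^+ 2 * expR `|y|.
Proof.
have h1 := expR_ge1Dx y; have h2 := expRB1_le y.
apply/andP; split; first by lra.
have h3 : expR y - 1 - y <= y * (expR y - 1) by rewrite mulrBr mulr1; lra.
apply: le_trans h3 _.
have [y0|y0] := leP 0 y.
  rewrite ger0_norm // expr2 -mulrA ler_wpM2l //.
have e1 : 1 <= expR `|y| by rewrite -expR0 ler_expR.
apply: (@le_trans _ _ (y ^+ 2)).
  have ey : expR y <= 1 by rewrite -expR0 ler_expR ltW.
  by rewrite expr2 -[leLHS]mulrNN -[leRHS]mulrNN; apply: ler_pM; lra.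
by rewrite ler_peMr // sqr_ge0.
Qed.

Section bounded_moments.
Context (d : measure_display) (T : measurableType d) (R : realType)
  (P : probability T R) (I : finType) (U : T -> I -> R) (a : R).
Hypotheses (mU : forall i, measurable_fun setT (U ^~ i))
  (Ua : forall x i, `|U x i| <= a).

Let bnd_int (f : T -> R) C : measurable_fun setT f -> (forall x, `|f x| <= C) ->
  P.-integrable setT (EFin \o f).
Proof.
move=> mf fC; apply: measurable_bounded_integrable => //.
  exact: le_lt_trans (probability_le1 P measurableT) (ltry 1).
by exists C; split; rewrite ?num_real // => M CM x _; apply: le_trans (fC x) (ltW CM).
Qed.

(** For U = ln W this is the moment function b^(-tau(q)), and [Psi] is its derivative. *)
Definition Phi (q : R) : R := \int[P]_x (\sum_(i : I) expR (q * U x i)).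
Definition Psi (q : R) : R := \int[P]_x (\sum_(i : I) U x i * expR (q * U x i)).

Let mPhi q : measurable_fun setT (fun x => \sum_(i : I) expR (q * U x i)).
Proof.
by apply: measurable_sum => i; apply: measurableT_comp => //; exact: measurable_funM.
Qed.

Let mPsi q : measurable_fun setT (fun x => \sum_(i : I) U x i * expR (q * U x i)).
Proof.
apply: measurable_sum => i; apply: measurable_funM => //.
by apply: measurableT_comp => //; exact: measurable_funM.
Qed.

Let a0 (i : I) : 0 <= a. Proof. by apply: le_trans (Ua point i). Qed.

Let qU q x i : `|q * U x i| <= `|q| * a.
Proof. by rewrite normrM ler_wpM2l. Qed.

Let expqU q x i : expR (- (`|q| * a)) <= expR (q * U x i) <= expR (`|q| * a).
Proof. by rewrite !ler_expR -ler_norml. Qed.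

Lemma integrable_Phi q : P.-integrable setT (EFin \o (fun x => \sum_(i : I) expR (q * U x i))).
Proof.
apply: (@bnd_int _ (\sum_(i : I) expR (`|q| * a))) => // x.
rewrite ger0_norm; last by apply: sumr_ge0 => i _; exact: expR_ge0.
by apply: ler_sum => i _; case/andP: (expqU q x i).
Qed.

Lemma integrable_Psi q :
  P.-integrable setT (EFin \o (fun x => \sum_(i : I) U x i * expR (q * U x i))).
Proof.
apply: (@bnd_int _ (\sum_(i : I) a * expR (`|q| * a))) => // x.
apply: le_trans (ler_norm_sum _ _ _) _; apply: ler_sum => i _.
rewrite normrM (ger0_norm (expR_ge0 _)) ler_pM ?expR_ge0 //.
by case/andP: (expqU q x i).
Qed.

Let Rint_cst (c : R) : \int[P]_x c = c.
Proof. by rewrite Rintegral_cst // [X in _ * fine X]probability_setT mulr1. Qed.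

Lemma Phi_ge q : #|I|%:R * expR (- (`|q| * a)) <= Phi q.
Proof.
rewrite -[leLHS]Rint_cst; apply: le_Rintegral => //.
- exact: (@bnd_int _ `|#|I|%:R * expR (- (`|q| * a))|).
- exact: integrable_Phi.
- move=> x _; rewrite mulr_natl -sumr_const; apply: ler_sum => i _.
  by case/andP: (expqU q x i).
Qed.

Lemma Phi_lip q q' : Phi q' <= expR (a * `|q - q'|) * Phi q.
Proof.
rewrite -RintegralZl //; last exact: integrable_Phi.
apply: le_Rintegral => //.
- exact: integrable_Phi.
- have h := integrableZl measurableT (expR (a * `|q - q'|)) (integrable_Phi q).
  by apply: eq_integrable h.
- move=> x _; rewrite big_distrr /=; apply: ler_sum => i _.
  rewrite -expRD ler_expR -lerBlDr -mulrBl.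
  apply: le_trans (ler_norm _) _; rewrite normrM distrC mulrC.
  by rewrite ler_wpM2r.
Qed.

Lemma Phi_taylor q h :
  `|Phi (q + h) - Phi q - h * Psi q| <=
    #|I|%:R * (a ^+ 2 * expR ((`|q| + `|h|) * a)) * h ^+ 2.
Proof.
have iq := integrable_Phi q; have iqh := integrable_Phi (q + h).
have ihp : P.-integrable setT (EFin \o (fun x => h * \sum_(i : I) U x i * expR (q * U x i))).
  by have e := integrableZl measurableT h (integrable_Psi q); apply: eq_integrable e.
have iB : P.-integrable setT (EFin \o (fun x =>
    \sum_(i : I) expR ((q + h) * U x i) - \sum_(i : I) expR (q * U x i))).
  by have e := integrableB measurableT iqh iq; apply: eq_integrable e.
have iB2 : P.-integrable setT (EFin \o (fun x =>
    \sum_(i : I) expR ((q + h) * U x i) - \sum_(i : I) expR (q * U x i) -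
    h * \sum_(i : I) U x i * expR (q * U x i))).
  by have e := integrableB measurableT iB ihp; apply: eq_integrable e.
rewrite -RintegralZl ?integrable_Psi // -RintegralB // -RintegralB //.
apply: le_trans (le_normr_Rintegral _ iB2) _ => //.
rewrite -[leRHS]Rint_cst; apply: le_Rintegral => //.
- exact: integrable_norm.
- exact: (@bnd_int _ `|#|I|%:R * (a ^+ 2 * expR ((`|q| + `|h|) * a)) * h ^+ 2|).
- move=> x _; rewrite -sumrB big_distrr -sumrB /=.
  apply: le_trans (ler_norm_sum _ _ _) _.
  rewrite -mulrA mulr_natl -sumr_const; apply: ler_sum => i _.
  have -> : expR ((q + h) * U x i) - expR (q * U x i) - h * (U x i * expR (q * U x i)) =
      expR (q * U x i) * (expR (h * U x i) - 1 - h * U x i).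
    by rewrite mulrDl expRD; ring.
  have /andP[t0 t1] := expR_taylor2 (h * U x i).
  rewrite normrM (ger0_norm (expR_ge0 _)) (ger0_norm t0).
  have /andP[_ e1] := expqU q x i.
  apply: (@le_trans _ _ (expR (`|q| * a) * ((h * U x i) ^+ 2 * expR (`|h| * a)))).
    apply: ler_pM => //.
    apply: le_trans t1 _; rewrite ler_wpM2l ?sqr_ge0 // ler_expR; exact: qU.
  rewrite mulrDl expRD exprMn.
  have U2 : U x i ^+ 2 <= a ^+ 2 by rewrite -real_normK ?num_real // lerXn2r ?nnegrE ?a0.
  have -> : expR (`|q| * a) * (h ^+ 2 * U x i ^+ 2 * expR (`|h| * a)) =
     (expR (`|q| * a) * expR (`|h| * a) * h ^+ 2) * U x i ^+ 2 by ring.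
  have -> : a ^+ 2 * (expR (`|q| * a) * expR (`|h| * a)) * h ^+ 2 =
     (expR (`|q| * a) * expR (`|h| * a) * h ^+ 2) * a ^+ 2 by ring.
  apply: ler_wpM2l => //; rewrite mulr_ge0 ?sqr_ge0 // mulr_ge0 ?expR_ge0 //.
Qed.

Lemma is_derive_Phi (q : R) : is_derive q 1 Phi (Psi q).
Proof.
(* The sign of [a] is known only when [I] is inhabited, whence its absolute value. *)
pose C := #|I|%:R * (a ^+ 2 * expR ((`|q| + 1) * `|a|)).
have C0 : 0 <= C by rewrite mulr_ge0 // mulr_ge0 ?sqr_ge0 ?expR_ge0.
have C1 : 0 < C + 1 by rewrite ltr_wpDl.
have lim_ : h^-1 *: ((Phi \o shift q) (h *: 1) - Phi q) @[h --> 0^'] --> Psi q.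
  apply/cvgrPdist_le => e e0; near=> h.
  have h0 : h != 0 by near: h; exact: nbhs_dnbhs_neq.
  have h1 : `|h| <= 1.
    near: h; apply: dnbhs0_le; exact: ltr01.
  have he : `|h| <= e / (C + 1).
    near: h; apply: dnbhs0_le; exact: divr_gt0.
  have := Phi_taylor q h; rewrite /= /shift /= [h *: 1]mulr1 [h + q]addrC => tay.
  have -> : Psi q - h^-1 *: (Phi (q + h) - Phi q) =
      - h^-1 * (Phi (q + h) - Phi q - h * Psi q).
    rewrite -[h^-1 *: _]/(h^-1 * _); field; exact: h0.
  rewrite normrM normrN normfV ler_pdivrMl ?normr_gt0 //.
  apply: le_trans tay _; rewrite -(real_normK (num_real h)) (expr2 `|h|) [leLHS]mulrA [leLHS]mulrC.
  rewrite ler_wpM2l //; apply: (@le_trans _ _ (C * `|h|)).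
    rewrite ler_wpM2r // /C ler_wpM2l // ler_wpM2l ?sqr_ge0 // ler_expR.
    apply: le_trans (_ : (`|q| + `|h|) * `|a| <= _).
      by rewrite ler_wpM2l ?addr_ge0 // ler_norm.
    by rewrite ler_wpM2r // lerD2l.
  apply: le_trans (ler_wpM2l C0 he) _.
  rewrite mulrA ler_pdivrMr // mulrDr mulr1 [e * C]mulrC lerDl ltW //.
split; first by apply/cvg_ex; exists (Psi q).
exact: cvg_lim lim_.
Unshelve. all: by end_near. Qed.

(** Log-convexity of Phi: integrate e^y >= e^c (1 + y - c) at y = (q - p) U against the density e^(p
    U); c is the value for which the linear term integrates to zero. *)
Lemma Phi_tangent p q : 0 < Phi p ->
  expR ((q - p) * (Psi p / Phi p)) * Phi p <= Phi q.
Proof.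
move=> Fp; set c := (q - p) * _.
have cF : c * Phi p = (q - p) * Psi p by rewrite /c; field; rewrite gt_eqF.
pose g x := \sum_(i : I) expR (p * U x i).
pose g1 x := \sum_(i : I) U x i * expR (p * U x i).
have i1 : P.-integrable setT (EFin \o (fun x => expR c * (1 - c) * g x)).
  by have e := integrableZl measurableT (expR c * (1 - c)) (integrable_Phi p); apply: eq_integrable e.
have i2 : P.-integrable setT (EFin \o (fun x => expR c * (q - p) * g1 x)).
  by have e := integrableZl measurableT (expR c * (q - p)) (integrable_Psi p); apply: eq_integrable e.
have i3 : P.-integrable setT (EFin \o (fun x => expR c * (1 - c) * g x + expR c * (q - p) * g1 x)).
  by have e := integrableD measurableT i1 i2; apply: eq_integrable e.
have -> : expR c * Phi p = \int[P]_x (expR c * (1 - c) * g x + expR c * (q - p) * g1 x).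
  rewrite RintegralD // !RintegralZl ?integrable_Phi ?integrable_Psi //.
  rewrite -[\int[P]_x g x]/(Phi p) -[\int[P]_x g1 x]/(Psi p).
  by rewrite -[expR c * (q - p) * _]mulrA -cF; ring.
apply: le_Rintegral => //; first exact: integrable_Phi.
move=> x _; rewrite /g /g1 !big_distrr -big_split /=; apply: ler_sum => i _.
have -> : expR (q * U x i) = expR c * (expR (p * U x i) * expR ((q - p) * U x i - c)).
  by rewrite -!expRD; congr expR; ring.
have -> : expR c * (1 - c) * expR (p * U x i) + expR c * (q - p) * (U x i * expR (p * U x i)) =
   expR c * (expR (p * U x i) * (1 + ((q - p) * U x i - c))) by ring.
by rewrite ler_wpM2l ?expR_ge0 // ler_wpM2l ?expR_ge0 // expR_ge1Dx.
Qed.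

End bounded_moments.

Section structure_function.
Context (d : measure_display) (T : measurableType d) (R : realType)
  (P : probability T R) (b : nat) (W0 : {RV P >-> b.-tuple R}) (A : R).
Hypotheses (hb : (1 < b)%N) (A1 : 1 < A)
  (W0A : {ae P, forall x, forall i : 'I_b, A^-1 <= tnth (W0 x) i <= A}).

(** Clipping turns almost sure bounds into bounds everywhere, so that U = ln box is a bounded
    variable; almost surely it changes nothing. *)
Let box x (i : 'I_b) : R := Num.max A^-1 (Num.min A (tnth (W0 x) i)).
Let U x i : R := ln (box x i).
Let lnb_sig : {l : R | l = ln b%:R}. Proof. by exists (ln b%:R). Qed.
Let lnb : R := sval lnb_sig.
Let lnbE : lnb = ln b%:R. Proof. exact: svalP lnb_sig. Qed.

Let A0 : 0 < A. Proof. exact: lt_trans A1. Qed.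
Let Ai0 : 0 < A^-1. Proof. by rewrite invr_gt0. Qed.
Let b0 : 0 < (b%:R : R). Proof. by rewrite ltr0n ltnW. Qed.
Let lnb0 : 0 < lnb. Proof. by rewrite lnbE ln_gt0 // ltr1n. Qed.

Let box_bounds x i : A^-1 <= box x i <= A.
Proof.
rewrite le_max lexx /= ge_max ge_min lexx andbT.
by rewrite (le_trans _ (ltW A1)) // invf_le1 // ltW.
Qed.

Let box_gt0 x i : 0 < box x i.
Proof. by case/andP: (box_bounds x i) => h _; exact: lt_le_trans h. Qed.

Let UA x i : `|U x i| <= ln A.
Proof.
have /andP[h1 h2] := box_bounds x i.
by rewrite ler_norml -lnV ?posrE // !ler_ln ?posrE ?box_gt0 // h1.
Qed.

Let mW i : measurable_fun setT (fun x => tnth (W0 x) i).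
Proof. by apply: (measurableT_comp (measurable_tnth i)). Qed.

Let mU i : measurable_fun setT (U ^~ i).
Proof.
apply: measurableT_comp => //; apply: (measurable_maxr (measurable_cst _)).
exact: (measurable_minr (measurable_cst _)).
Qed.

Let boxE : {ae P, forall x, forall i : 'I_b, box x i = tnth (W0 x) i}.
Proof.
move: W0A; apply: filterS => x h i; have /andP[h1 h2] := h i.
by rewrite /box min_r // max_r.
Qed.

Let F_sig : {f : R -> R | f = Phi P U}. Proof. by exists (Phi P U). Qed.
Let F : R -> R := sval F_sig.
Let FE : Phi P U = F. Proof. exact/esym/(svalP F_sig). Qed.
Let F'_sig : {f : R -> R | f = Psi P U}. Proof. by exists (Psi P U). Qed.
Let F' : R -> R := sval F'_sig.
Let F'E : Psi P U = F'. Proof. exact/esym/(svalP F'_sig). Qed.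

Let F_gt0 q : 0 < F q.
Proof.
rewrite -FE; apply: (lt_le_trans _ (Phi_ge P mU UA q)).
by rewrite mulr_gt0 ?expR_gt0 // card_ord.
Qed.

Let integral_F q : (\int[P]_x (\sum_(i < b) expR (q * U x i))%:E = (F q)%:E)%E.
Proof.
rewrite -FE /Phi /Rintegral fineK //; apply: integrable_fin_num => //.
exact: (integrable_Phi P mU UA).
Qed.

Local Opaque Phi Psi ln.

Lemma tau_extE q : tau_ext W0 q = (- (ln (F q) / lnb))%:E.
Proof.
rewrite /tau_ext unlock.
have -> : (\int[P]_w (\sum_(k < b) tnth (W0 w) k `^ q)%:E = (F q)%:E)%E.
  rewrite -integral_F; apply: ae_eq_integral => //.
  - apply/measurable_EFinP; apply: measurable_sum => i.
    exact: (measurableT_comp (measurable_powR q)).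
  - exact: (measurable_int _ (integrable_Phi P mU UA q)).
  - move: boxE; apply: filterS => x h _; congr EFin; apply: eq_bigr => i _.
    by rewrite /U h /powR -h gt_eqF.
by rewrite lne_EFin // -EFinM -lnbE.
Qed.

Lemma tauE q : tau W0 q = - (ln (F q) / lnb).
Proof. by rewrite /tau tau_extE. Qed.

Let is_derive_tau (q : R) : is_derive q 1 (tau W0) (- (F' q / (F q * lnb))).
Proof.
rewrite (_ : tau W0 = (fun q => - (lnb^-1 * (@ln R \o F) q))); last first.
  by apply/funext => p; rewrite tauE mulrC.
have := is_derive_Phi P mU UA q; rewrite FE F'E => d1.
have d2 : is_derive (F q) 1 (@ln R) (F q)^-1 by exact: is_derive1_ln.
have d3 := @is_derive1_comp R (@ln R) F q _ _ d2 d1.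
have d4 := is_deriveN (is_deriveZ lnb^-1 d3).
apply: is_derive_eq d4 _.
by rewrite -[lnb^-1 *: _]/(lnb^-1 * _); field; rewrite !gt_eqF.
Qed.

Let dtauE q : dtau W0 q = - (F' q / (F q * lnb)).
Proof. by rewrite /dtau derive1E; exact: derive_val. Qed.

Let tau_expR q : expR (tau W0 q * lnb) = (F q)^-1.
Proof. by rewrite tauE mulNr divfK ?gt_eqF // expRN lnK // posrE. Qed.

Local Opaque tau dtau.

(** Concavity of tau, the logarithm of [Phi_tangent]. *)
Let tau_tangent p q : tau W0 q <= tau W0 p + (q - p) * dtau W0 p.
Proof.
have F0p : 0 < Phi P U p by rewrite FE.
have := Phi_tangent mU UA q F0p; rewrite FE F'E.
rewrite -ler_ln ?posrE ?mulr_gt0 ?expR_gt0 // lnM ?posrE ?expR_gt0 // expRK => h.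
have Fp := F_gt0 p; have Fq := F_gt0 q.
rewrite !tauE dtauE -(ler_pM2r lnb0).
have -> : - (ln (F q) / lnb) * lnb = - ln (F q) by field; rewrite gt_eqF.
have -> : (- (ln (F p) / lnb) + (q - p) * - (F' p / (F p * lnb))) * lnb =
    - ln (F p) - (q - p) * (F' p / F p) by field; rewrite !gt_eqF.
lra.
Qed.

Lemma tau_lipschitz q q' : `|tau W0 q' - tau W0 q| * ln b%:R <= ln A * `|q - q'|.
Proof.
rewrite -lnbE.
have key p p' : ln (F p') - ln (F p) <= ln A * `|p - p'|.
  have := Phi_lip P mU UA p p'; rewrite FE.
  rewrite -ler_ln ?posrE ?mulr_gt0 ?expR_gt0 // lnM ?posrE ?expR_gt0 // expRK.
  by lra.
rewrite -[X in _ * X <= _](gtr0_norm lnb0) -normrM mulrBl !tauE !mulNr !divfK ?gt_eqF //.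
have := key q q'; have := key q' q; rewrite (distrC q' q) => h1 h2.
by rewrite ler_norml; apply/andP; split; lra.
Qed.

(** A second order bound with a constant uniform in q, obtained from [Phi_taylor] and ln x <= x - 1.
    It is what makes the large deviation exponent quadratic in eps. *)
Lemma tau_quadratic (B : R) : exists2 C, 0 < C & forall q h, `|q| <= B -> `|h| <= 1 ->
  tau W0 q - tau W0 (q + h) + h * dtau W0 q <= C * h ^+ 2.
Proof.
have lA0 : 0 <= ln A by rewrite ln_ge0 // ltW.
pose C0 := b%:R * (ln A ^+ 2 * expR ((B + 1) * ln A)).
pose m := b%:R * expR (- (B * ln A)).
have m0 : 0 < m by rewrite mulr_gt0 // expR_gt0.
have C00 : 0 <= C0 by rewrite mulr_ge0 ?(ltW b0) // mulr_ge0 ?sqr_ge0 ?expR_ge0.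
(* The added 1 makes C positive, since the optimal shift eps / (4 C) divides by it. *)
exists (C0 / m / lnb + 1).
  by rewrite ltr_wpDl // !divr_ge0 // ltW.
move=> q h qB h1.
have mF : m <= F q.
  rewrite -FE; apply: le_trans (Phi_ge P mU UA q); rewrite card_ord ler_pM2l //.
  by rewrite ler_expR lerN2 ler_wpM2r.
have tay : F (q + h) <= F q + h * F' q + C0 * h ^+ 2.
  have := Phi_taylor P mU UA q h; rewrite card_ord ler_norml => /andP[_].
  have : b%:R * (ln A ^+ 2 * expR ((`|q| + `|h|) * ln A)) * h ^+ 2 <= C0 * h ^+ 2.
    rewrite ler_wpM2r ?sqr_ge0 // /C0 ler_pM2l // ler_wpM2l ?sqr_ge0 // ler_expR.
    by rewrite ler_wpM2r // lerD.
  by rewrite FE F'E; lra.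
have Fq := F_gt0 q; have Fqh := F_gt0 (q + h).
have ln1 : ln (F (q + h)) - ln (F q) <= h * (F' q / F q) + C0 / m * h ^+ 2.
  rewrite -ln_div ?posrE //.
  have q0 : 0 < F (q + h) / F q by rewrite divr_gt0.
  have := expR_ge1Dx (ln (F (q + h) / F q)); rewrite lnK ?posrE // => l1.
  have l2 : F (q + h) / F q <= 1 + h * (F' q / F q) + C0 * h ^+ 2 / F q.
    rewrite ler_pdivrMr //; apply: le_trans tay _.
    by rewrite le_eqVlt; apply/orP; left; apply/eqP; field; rewrite gt_eqF.
  have l3 : C0 * h ^+ 2 / F q <= C0 / m * h ^+ 2.
    rewrite [leRHS]mulrAC; apply: ler_wpM2l; first by rewrite mulr_ge0 // sqr_ge0.
    by rewrite lef_pV2.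
  by lra.
rewrite -(ler_pM2r lnb0) !tauE dtauE.
have -> : (- (ln (F q) / lnb) - - (ln (F (q + h)) / lnb) + h * - (F' q / (F q * lnb))) * lnb =
    ln (F (q + h)) - ln (F q) - h * (F' q / F q) by field; rewrite !gt_eqF.
have -> : (C0 / m / lnb + 1) * h ^+ 2 * lnb = C0 / m * h ^+ 2 + h ^+ 2 * lnb.
  by field; rewrite !gt_eqF.
have : 0 <= h ^+ 2 * lnb by rewrite mulr_ge0 ?sqr_ge0 // ltW.
by move: ln1; lra.
Qed.

Let int_exp_tau q n :
  (\int[P]_x (\sum_(i < b) expR (tau W0 q * lnb + q * U x i) ^+ n)%:E =
   (expR ((n%:R * tau W0 q - tau W0 (n%:R * q)) * lnb))%:E)%E.
Proof.
under eq_integral => x _.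
  rewrite (eq_bigr (fun i => expR (n%:R * tau W0 q * lnb) * expR (n%:R * q * U x i))); last first.
    by move=> i _; rewrite -expRM_natl -expRD; congr expR; ring.
  rewrite -big_distrr EFinM /=; over.
rewrite ge0_integralZl //.
- by rewrite integral_F -EFinM mulrBl expRD expRN tau_expR invrK.
- by apply/measurable_EFinP; apply: measurable_sum => i;
    apply: measurableT_comp => //; exact: measurable_funM.
- by move=> x _; rewrite lee_fin; apply: sumr_ge0 => i _; exact: expR_ge0.
Qed.

Lemma integral_normalized_weights lo hi q :
  {ae P, forall x, forall i, lo <= tnth (W0 x) i <= hi} ->
  (\int[P]_x (\sum_(i < b) expR (tau W0 q * ln b%:R +
    q * ln (Num.max lo (Num.min hi (tnth (W0 x) i)))))%:E = 1)%E.
Proof.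
move=> lohi; rewrite -lnbE.
have := int_exp_tau q 1; rewrite !mul1r subrr mul0r expR0 => <-.
apply: ae_eq_integral => //.
- apply/measurable_EFinP; apply: measurable_sum => i.
  apply: measurableT_comp => //; apply: measurable_funD => //.
  apply: measurable_funM => //; apply: measurableT_comp => //.
  apply: (measurable_maxr (measurable_cst _)).
  exact: (measurable_minr (measurable_cst _)).
- apply/measurable_EFinP; apply: measurable_sum => i; apply: measurable_funX.
  by apply: measurableT_comp => //; apply: measurable_funD => //; exact: measurable_funM.
- move: boxE lohi; apply: filterS2 => x h1 h2 _; congr EFin; apply: eq_bigr => i _.
  have /andP[h3 h4] := h2 i.
  by rewrite expr1 /U h1 (min_r h4) (max_r h3).
Qed.

Lemma tau_at1 : (\sum_(k < b) 'E_P[fun x => tnth (W0 x) k] = 1)%E -> tau W0 1 = 0.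
Proof.
move=> mean; suff F1 : F 1 = 1 by rewrite tauE F1 ln1 mul0r oppr0.
apply: EFin_inj; rewrite -integral_F -mean.
under eq_integral do rewrite -sumEFin.
have mexp i : measurable_fun setT (fun x => expR (1 * U x i)).
  by apply: measurableT_comp => //; exact: measurable_funM.
rewrite ge0_integral_sum //.
- apply: eq_bigr => i _; rewrite unlock; apply: ae_eq_integral => //.
  + exact/measurable_EFinP.
  + exact/measurable_EFinP.
  + move: boxE; apply: filterS => x h _; congr EFin.
    by rewrite mul1r /U lnK ?posrE // h.
- by move=> i; exact/measurable_EFinP.
Qed.

Hypothesis J_full : forall q, 0 < dtau W0 q * q - tau W0 q.

Let e q := dtau W0 q * q - tau W0 q.

(** The tangent at q = (n + 1) p, evaluated at p and multiplied by n + 1, is tau(q) - n e(q), and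
    e(q) > 0. *)
Let tau_scale_le (n : nat) p : n.+1%:R * tau W0 p <= tau W0 (n.+1%:R * p).
Proof.
set q := n.+1%:R * p; have t := tau_tangent q p; have Jq := J_full q.
have t2 : n.+1%:R * tau W0 p <= n.+1%:R * (tau W0 q + (p - q) * dtau W0 q).
  by rewrite ler_wpM2l.
apply: le_trans t2 _.
have -> : n.+1%:R * (tau W0 q + (p - q) * dtau W0 q) =
    tau W0 q - n%:R * (dtau W0 q * q - tau W0 q).
  by rewrite /q -natr1; ring.
by rewrite gerBl mulr_ge0 // ltW.
Qed.

(* With s = b^(-e(p)/2), the variables (s b^tau(p) W^p)^n have summable means
   since n tau(p) <= tau(n p); being almost surely bounded in n, they give
   s b^tau(p) W^p <= 1. *)
Let ae_weight_bound p :
  {ae P, forall x, forall i, tau W0 p * lnb + p * U x i <= e p / 2 * lnb}.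
Proof.
have e0 : 0 < e p by exact: J_full.
pose s := expR (- (e p / 2 * lnb)).
have s0 : 0 < s by exact: expR_gt0.
have s1 : s < 1 by rewrite -expR0 ltr_expR oppr_lt0 mulr_gt0 // divr_gt0.
pose z x i := expR (tau W0 p * lnb + p * U x i).
have mz : forall n, measurable_fun setT (fun x => \sum_(i < b) z x i ^+ n).
  move=> n; apply: measurable_sum => i; apply: measurable_funX.
  by apply: measurableT_comp => //; apply: measurable_funD => //; exact: measurable_funM.
pose f n x := s ^+ n.+1 * \sum_(i < b) z x i ^+ n.+1.
have z0 x n : 0 <= \sum_(i < b) z x i ^+ n.
  by apply: sumr_ge0 => i _; rewrite exprn_ge0 // expR_ge0.
have : {ae P, forall x, exists M, forall n, f n x <= M}.
  apply: (@ae_bounded_series _ T R P f (fun n => s ^+ n) (1 - s)^-1).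
  - by move=> n; exact: measurable_funM.
  - by move=> n x; rewrite mulr_ge0 // exprn_ge0 // ltW.
  - move=> n; under eq_integral do rewrite EFinM.
    rewrite ge0_integralZl //.
    + rewrite int_exp_tau -EFinM lee_fin exprSr -mulrA ler_piMr ?exprn_ge0 ?(ltW s0) //.
      rewrite mulr_ile1 ?expR_ge0 ?(ltW s0) ?(ltW s1) // -[leRHS]expR0 ler_expR.
      by rewrite pmulr_lle0 // subr_le0; exact: tau_scale_le.
    + exact/measurable_EFinP.
    + by move=> x _; rewrite lee_fin.
    + by rewrite lee_fin exprn_ge0 // ltW.
  - move=> n; have d0 : 0 < 1 - s by rewrite subr_gt0.
    rewrite -[leRHS]mul1r ler_pdivlMr //.
    have -> : (\sum_(i < n) s ^+ i) * (1 - s) = 1 - s ^+ n.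
      elim: n => [|n IH]; first by rewrite big_ord0 mul0r expr0 subrr.
      by rewrite big_ord_recr /= mulrDl IH exprS; ring.
    by rewrite gerBl exprn_ge0 // ltW.
apply: filterS => x [M fM] i.
have zs n : (s * z x i) ^+ n.+1 <= M.
  apply: le_trans (fM n); rewrite /f exprMn ler_wpM2l ?exprn_ge0 ?(ltW s0) //.
  by rewrite (bigD1 i) //= lerDl sumr_ge0 // => j _; rewrite exprn_ge0 // expR_ge0.
suff : s * z x i <= 1.
  by rewrite /s /z -expRD -[leRHS]expR0 ler_expR; lra.
rewrite leNgt; apply/negP => z1.
set t := s * z x i - 1; have t0 : 0 < t by rewrite subr_gt0.
have zt : s * z x i = 1 + t by rewrite /t addrC subrK.
have bern n : 1 + n%:R * t <= (s * z x i) ^+ n.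
  rewrite zt; elim: n => [|n IH]; first by rewrite mul0r addr0 expr0.
  have t1 : 0 <= 1 + t by rewrite addr_ge0 // ltW.
  rewrite exprS; apply: le_trans (ler_wpM2l t1 IH).
  have : 0 <= n%:R * t ^+ 2 by rewrite mulr_ge0 ?sqr_ge0.
  by rewrite -natr1; nra.
have M0 : 0 <= `|M| / t by rewrite divr_ge0 // ltW.
have /andP[_ hM] := truncn_itv M0.
have := le_trans (bern _) (zs (Num.truncn (`|M| / t))).
rewrite ltr_pdivrMr // in hM.
by have := ler_norm M; lra.
Qed.

(** The bound at p alone, b^(e(p)/2), exceeds 1; strict contraction appears at s p. Concavity gives
    tau(s p) <= s tau(p) - (1 - s) e(p), and s e / 2 - (1 - s) e <= - e / 4 for s <= 1/2. *)
Let weight_upper (p s y : R) : 0 <= s <= 2^-1 ->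
  tau W0 p * lnb + p * ln y <= e p / 2 * lnb ->
  tau W0 (s * p) * lnb + s * p * ln y <= - (e p / 4) * lnb.
Proof.
move=> /andP[s0 s2] h; have e0 : 0 < e p by exact: J_full.
have t : tau W0 (s * p) <= s * tau W0 p - (1 - s) * e p.
  apply: le_trans (tau_tangent p (s * p)) _.
  by rewrite le_eqVlt; apply/orP; left; apply/eqP; rewrite /e; ring.
have h2 : s * (tau W0 p * lnb + p * ln y) <= s * (e p / 2 * lnb) by rewrite ler_wpM2l.
have h3 : tau W0 (s * p) * lnb <= (s * tau W0 p - (1 - s) * e p) * lnb.
  by rewrite ler_wpM2r // ltW.
have h4 : s * (e p * lnb) <= 2^-1 * (e p * lnb) by rewrite ler_wpM2r // mulr_ge0 // ltW.
have -> : s * p * ln y = s * (tau W0 p * lnb + p * ln y) - s * tau W0 p * lnb by ring.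
have -> : - (e p / 4) * lnb = 2^-1 * (2^-1 * (e p * lnb)) - e p * lnb + 2^-1 * (e p * lnb).
  by field.
nra.
Qed.

(** Two almost sure bounds, at p = 2 B and at -2 B, confine ln W to an interval. Every q with |q| <=
    B is s p or - s p with 0 <= s <= 1/2, so [weight_upper] covers all parameters at once with a
    single theta. *)
Lemma weights_in_box (B : nat) : (0 < B)%N -> exists lo hi theta g,
  [/\ 0 < lo <= hi,
      {ae P, forall x, forall i, lo <= tnth (W0 x) i <= hi},
      theta < 1, b%:R^-1 <= theta & (0 < g)%N /\
      forall q y, `|q| <= B%:R -> lo <= y <= hi ->
        [/\ `|ln y| <= ln A, b%:R^-1 ^+ g <= expR (tau W0 q * ln b%:R + q * ln y) &
          expR (tau W0 q * ln b%:R + q * ln y) <= theta]].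
Proof.
rewrite -lnbE.
move=> B0; have BR : 0 < (B%:R : R) by rewrite ltr0n.
pose p : R := 2 * B%:R; have p0 : 0 < p by rewrite mulr_gt0.
pose uhi := (e p / 2 - tau W0 p) * lnb / p.
pose ulo := (tau W0 (- p) - e (- p) / 2) * lnb / p.
have hiP v : (tau W0 p * lnb + p * v <= e p / 2 * lnb) = (v <= uhi).
  rewrite /uhi ler_pdivlMr //; move: (e p) (tau W0 p) => ep tp.
  by apply/idP/idP; lra.
have loP v : (tau W0 (- p) * lnb + - p * v <= e (- p) / 2 * lnb) = (ulo <= v).
  rewrite /ulo ler_pdivrMr //; move: (e (- p)) (tau W0 (- p)) => ep tp.
  by apply/idP/idP; lra.
pose lo := Num.max A^-1 (expR ulo); pose hi := Num.min A (expR uhi).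
pose eta := Num.min (e p) (e (- p)) / 4.
have eta0 : 0 < eta by rewrite divr_gt0 // lt_min !J_full.
(* Lipschitz continuity of tau and |q ln y| <= B ln A bound the exponent below by -(|tau(0)| ln b +
   2 B ln A). *)
pose g := (Num.truncn (`|tau W0 0| + 2 * (ln A * B%:R) / lnb)).+1.
exists lo, hi, (Num.max b%:R^-1 (expR (- eta * lnb))), g.
have inbox : {ae P, forall x, forall i, lo <= tnth (W0 x) i <= hi}.
  move: boxE (ae_weight_bound p) (ae_weight_bound (- p)).
  apply: filterS3 => x hb1 h1 h2 i; rewrite -hb1.
  have /andP[k1 k2] := box_bounds x i.
  rewrite ge_max k1 le_min k2 /=.
  have := h1 i; have := h2 i; rewrite hiP loP /U => m1 m2.
  by rewrite -[box x i]lnK ?posrE // !ler_expR m1.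
(* A property that holds almost surely holds at some point; this yields lo <= hi. *)
have [x xin] : exists x, forall i, lo <= tnth (W0 x) i <= hi.
  apply: contrapT => hN.
  have : ~ {ae P, forall x, False}.
    move=> [N [mN PN sub]]; have : P setT = 0%E.
      by rewrite (_ : setT = N) //; apply/esym/seteqP; split => // y _; apply: sub.
    by rewrite probability_setT => /eqP; rewrite onee_eq0.
  apply; move: inbox; apply: filterS => x h; apply: hN; by exists x.
have c0 : 'I_b by exact: (Ordinal (ltnW hb)).
split.
- have /andP[h1 h2] := xin c0; rewrite (le_trans h1 h2) andbT.
  by rewrite lt_max Ai0.
- exact: inbox.
- rewrite gt_max invf_lt1 // ltr1n hb /= -expR0 ltr_expR mulNr oppr_lt0 mulr_gt0 //.
- by rewrite le_max lexx.
split => // q y qB /andP[ylo yhi].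
have y0 : 0 < y.
  by apply: lt_le_trans ylo; rewrite lt_max Ai0.
have lyA : `|ln y| <= ln A.
  move: ylo yhi; rewrite ge_max le_min => /andP[h1 _] /andP[h2 _].
  by rewrite ler_norml -lnV ?posrE // !ler_ln ?posrE // h1.
have lA0 : 0 <= ln A by rewrite ln_ge0 // ltW.
split => //.
- have -> : (b%:R^-1 : R) = expR (- lnb) by rewrite expRN lnbE lnK // posrE.
  rewrite -expRM_natl ler_expR.
  have lip := tau_lipschitz 0 q; rewrite -lnbE sub0r normrN in lip.
  have q1 : ln A * `|q| <= ln A * B%:R by rewrite ler_wpM2l.
  have q2 : `|q * ln y| <= B%:R * ln A by rewrite normrM ler_pM.
  have G0 : 0 <= `|tau W0 0| + 2 * (ln A * B%:R) / lnb.
    by rewrite addr_ge0 // !mulr_ge0 // invr_ge0 ltW.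
  have /andP[_ gG] := truncn_itv G0; rewrite -/g in gG.
  have gG2 : (`|tau W0 0| + 2 * (ln A * B%:R) / lnb) * lnb <= g%:R * lnb.
    by rewrite ler_wpM2r // ltW.
  have e1 : (`|tau W0 0| + 2 * (ln A * B%:R) / lnb) * lnb = `|tau W0 0| * lnb + 2 * (ln A * B%:R).
    by field; rewrite gt_eqF.
  rewrite e1 in gG2.
  have t1 : - (`|tau W0 0| * lnb) <= tau W0 0 * lnb.
    by rewrite -mulNr ler_wpM2r ?(ltW lnb0) // lerNl -normrN ler_norm.
  have t2 : - (ln A * `|q|) <= (tau W0 q - tau W0 0) * lnb.
    have : - (`|tau W0 q - tau W0 0| * lnb) <= (tau W0 q - tau W0 0) * lnb.
      by rewrite -mulNr ler_wpM2r ?(ltW lnb0) // lerNl -normrN ler_norm.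
    by lra.
  move: q2; rewrite ler_norml => /andP[q2 _].
  by rewrite mulrN; lra.
- rewrite le_max; apply/orP; right; rewrite ler_expR.
  have eta1 : forall p', p' = p \/ p' = - p -> - (e p' / 4) * lnb <= - eta * lnb.
    move=> p' pp; rewrite ler_wpM2r ?(ltW lnb0) // lerN2 /eta ler_pM2r ?invr_gt0 //.
    by case: pp => ->; rewrite ge_min lexx ?orbT.
  have lnhi : ln y <= uhi.
    by move: yhi; rewrite le_min => /andP[_]; rewrite -{1}[y]lnK ?posrE // ler_expR.
  have lnlo : ulo <= ln y.
    by move: ylo; rewrite ge_max => /andP[_]; rewrite -{1}[y]lnK ?posrE // ler_expR.
  have [q0|q0] := leP 0 q.
    have qE : q = q / p * p by field; rewrite gt_eqF.
    rewrite qE; apply: le_trans (weight_upper _ _) (eta1 p (or_introl erefl)).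
      rewrite divr_ge0 ?(ltW p0) //= ler_pdivrMr // /p mulrA mulVf // mul1r.
      by apply: le_trans qB; exact: ler_norm.
    by rewrite hiP.
  have qE : q = (- q / p) * - p by field; rewrite gt_eqF.
  rewrite qE; apply: le_trans (weight_upper _ _) (eta1 (- p) (or_intror erefl)).
    rewrite divr_ge0 ?(ltW p0) ?oppr_ge0 ?(ltW q0) //= ler_pdivrMr // /p mulrA mulVf // mul1r.
    by apply: le_trans qB; rewrite -normrN ler_norm.
  by rewrite loP.
Qed.

End structure_function.

(** * Counting *)

Section counting.
Context (R : realType) (I : finType) (s Z1 Zq : I -> R) (tau : R -> R)
  (E q a e eps C p Y : R).
Let h := eps / (4 * C).
Hypotheses (C0 : 0 < C) (E0 : 0 <= E) (eps0 : 0 < eps)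
  (moment : forall r, `|r| = h -> \sum_u expR (E * tau (q + r) + (q + r) * s u) <= expR p)
  (quad : forall r, `|r| = h -> tau q - tau (q + r) + r * a <= C * r ^+ 2)
  (Z1_bounds : forall u, expR (- p) <= Z1 u <= expR p)
  (Zq_bounds : forall u, expR (- p) <= Zq u <= expR p)
  (Y_lb : expR (- p) <= Y)
  (YE : Y = \sum_u expR (E * tau q + q * s u) * Zq u)
  (eE : e = a * q - tau q)
  (small1 : (`|q| + 1) * p + ln 2 <= E * eps)
  (small2 : 2 * p <= E * eps)
  (small3 : ln 4 + 3 * p <= E * eps ^+ 2 / (16 * C)).

Let counted := [pred u | expR (- (E * (a + eps))) <= expR (s u) * Z1 u <= expR (- (E * (a - eps)))].
Let f u := expR (E * tau q + q * s u) * Zq u.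

Let Z1_ln u : expR (ln (Z1 u)) = Z1 u /\ `|ln (Z1 u)| <= p.
Proof.
have /andP[l r] := Z1_bounds u; have z0 : 0 < Z1 u by apply: lt_le_trans l; exact: expR_gt0.
split; first by rewrite lnK // posrE.
by rewrite ler_norml -(ler_expR (- p)) -(ler_expR (ln _)) lnK ?posrE // l.
Qed.

Let Zq_ln u : expR (ln (Zq u)) = Zq u /\ `|ln (Zq u)| <= p.
Proof.
have /andP[l r] := Zq_bounds u; have z0 : 0 < Zq u by apply: lt_le_trans l; exact: expR_gt0.
split; first by rewrite lnK // posrE.
by rewrite ler_norml -(ler_expR (- p)) -(ler_expR (ln _)) lnK ?posrE // l.
Qed.

Let f_ge0 u : 0 <= f u.
Proof. by rewrite /f mulr_ge0 ?expR_ge0 // -(Zq_ln u).1 expR_ge0. Qed.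

Let countedE u : counted u = (`|E * a + s u + ln (Z1 u)| <= E * eps).
Proof.
have [+ _] := Z1_ln u; move: (ln _) => l /= <-.
rewrite -expRD !ler_expR ler_norml.
by apply/idP/idP => /andP[h1 h2]; apply/andP; split; lra.
Qed.

Let f_counted u : counted u ->
  expR (- (E * e) - `|q| * (E * eps) - (`|q| + 1) * p) <= f u <=
  expR (- (E * e) + `|q| * (E * eps) + (`|q| + 1) * p).
Proof.
rewrite countedE => c; rewrite /f -(Zq_ln u).1 -expRD !ler_expR eE.
have := (Zq_ln u).2; rewrite ler_norml => /andP[z1 z2].
have h1 : `|q * (E * a + s u + ln (Z1 u))| <= `|q| * (E * eps).
  by rewrite normrM ler_wpM2l.
have h2 : `|q * ln (Z1 u)| <= `|q| * p by rewrite normrM ler_wpM2l // (Z1_ln u).2.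
move: h1 h2; rewrite !ler_norml => /andP[h1 h2] /andP[h3 h4].
by apply/andP; split; lra.
Qed.

(* Chernoff's bound: h = eps / (4 C) minimizes C h^2 - h eps / 2. *)
Let f_not_counted u : ~~ counted u ->
  f u <= expR (p - E * eps ^+ 2 / (16 * C)) *
    (expR (E * tau (q + h) + (q + h) * s u) + expR (E * tau (q - h) + (q - h) * s u)).
Proof.
rewrite countedE -ltNge => c.
have h0 : 0 < h by rewrite divr_gt0 // mulr_gt0.
(* Discarding ln (Z1 u) costs p, which is at most half of E eps. *)
have c2 : E * eps / 2 <= `|E * a + s u|.
  have t := lt_le_trans c (le_trans (ler_normD (E * a + s u) (ln (Z1 u))) (lerD (lexx _) (Z1_ln u).2)).
  by move: t; set X := `|_|; move: small2; lra.
have [r rh cr] : exists2 r, r = h \/ r = - h & `|r| * (E * eps / 2) <= r * (E * a + s u).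
  have [pos|neg] := leP 0 (E * a + s u).
    exists h; first by left.
    by rewrite gtr0_norm // ler_wpM2l ?(ltW h0) // -(ger0_norm pos).
  exists (- h); first by right.
  by rewrite normrN gtr0_norm // mulNr -mulrN ler_wpM2l ?(ltW h0) // -(ltr0_norm neg).
have nr : `|r| = h by case: rh => ->; rewrite ?normrN gtr0_norm.
have fr : f u <= expR (p - E * eps ^+ 2 / (16 * C)) * expR (E * tau (q + r) + (q + r) * s u).
  rewrite /f -(Zq_ln u).1 -!expRD ler_expR.
  have z := le_trans (ler_norm _) (Zq_ln u).2.
  have Q : E * (tau q - tau (q + r) + r * a) <= E * (C * r ^+ 2) by rewrite ler_wpM2l // quad.
  have e1 : E * (C * r ^+ 2) - `|r| * (E * eps / 2) = - (E * eps ^+ 2 / (16 * C)).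
    rewrite -[r ^+ 2]real_normK ?num_real // nr /h; field; by rewrite gt_eqF.
  by move: e1; set X := E * eps ^+ 2 / (16 * C); lra.
apply: le_trans fr _; rewrite ler_pM2l ?expR_gt0 //.
by case: rh => ->; rewrite ?lerDl ?lerDr expR_ge0.
Qed.

(** In [small3], ln 4 accounts for the two shifts and the half, and 3 p for the mass Zq, the moment
    bound and the lower bound on Y. *)
Let bad_sum : \sum_(u | ~~ counted u) f u <= Y / 2.
Proof.
have h0 : 0 < h by rewrite divr_gt0 // mulr_gt0.
pose g u := expR (p - E * eps ^+ 2 / (16 * C)) *
  (expR (E * tau (q + h) + (q + h) * s u) + expR (E * tau (q - h) + (q - h) * s u)).
apply: (@le_trans _ _ (\sum_(u | ~~ counted u) g u)).
  by apply: ler_sum => u; exact: f_not_counted.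
apply: (@le_trans _ _ (\sum_u g u)).
  rewrite [leRHS](bigID counted) /= lerDr; apply: sumr_ge0 => u _.
  by rewrite mulr_ge0 ?addr_ge0 // expR_ge0.
rewrite -mulr_sumr big_split /=.
have m1 := moment (gtr0_norm h0).
have m2 : \sum_u expR (E * tau (q - h) + (q - h) * s u) <= expR p.
  by apply: moment; rewrite normrN gtr0_norm.
apply: (@le_trans _ _ (expR (p - E * eps ^+ 2 / (16 * C)) * (2 * expR p))).
  rewrite ler_pM2l ?expR_gt0 //; lra.
rewrite mulrCA -expRD ler_pdivlMr // mulrAC -natrM.
apply: le_trans Y_lb; rewrite -[X in X * _](@lnK _ 4%:R) ?posrE // -expRD ler_expR.
by move: small3; lra.
Qed.

(** Here E stands for n ln b, s u for the logarithm of the weight of u, Z1 and Zq for the masses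
    below u, and e^p for the polynomial P. The counted words carry between Y / 2 and Y, each about
    e^(- E e). The error |q| E eps comes from the exponent of f, and one more E eps absorbs (|q| +
    1) p + ln 2: hence the factor 1 + |q|. *)
Lemma counting_bounds :
  Y * expR (E * (e - (1 + `|q|) * eps)) <= #|counted|%:R <=
  Y * expR (E * (e + (1 + `|q|) * eps)).
Proof.
have YE2 : Y = \sum_(u | counted u) f u + \sum_(u | ~~ counted u) f u.
  by rewrite YE (bigID counted).
have bad0 : 0 <= \sum_(u | ~~ counted u) f u by apply: sumr_ge0 => u _.
set hiv := expR (- (E * e) + `|q| * (E * eps) + (`|q| + 1) * p).
set lov := expR (- (E * e) - `|q| * (E * eps) - (`|q| + 1) * p).
have up : lov * #|counted|%:R <= \sum_(u | counted u) f u.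
  rewrite mulr_natr -sumr_const; apply: ler_sum => u cu.
  by have /andP[] := f_counted cu.
have dn : \sum_(u | counted u) f u <= hiv * #|counted|%:R.
  rewrite mulr_natr -sumr_const; apply: ler_sum => u cu.
  by have /andP[] := f_counted cu.
have Y0 : 0 < Y by apply: lt_le_trans Y_lb; exact: expR_gt0.
apply/andP; split.
- have hY : Y / 2 <= hiv * #|counted|%:R by have := bad_sum; lra.
  rewrite -(ler_pM2l (expR_gt0 _ : 0 < hiv)); apply: le_trans hY.
  rewrite mulrCA ler_pM2l // /hiv -expRD -[leRHS]lnK ?posrE // ler_expR lnV ?posrE //.
  by move: small1; lra.
- rewrite -(ler_pM2l (expR_gt0 _ : 0 < lov)) mulrCA; apply: (@le_trans _ _ Y).
    by move: YE2 up bad0; lra.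
  rewrite -[leLHS]mulr1 ler_pM2l // /lov -expRD -[leLHS]expR0 ler_expR.
  have : 0 < ln 2 :> R by rewrite ln_gt0 // ltr1n.
  by move: small1; lra.
Qed.

End counting.

(** * Growth rates of eps_n and S_j *)

Lemma ln_nat_large (R : realType) (M : R) : \forall n \near \oo, M <= ln (n%:R : R).
Proof.
near=> n; have h : expR M <= n%:R by near: n; exact: nbhs_infty_ger.
by rewrite -[leLHS]expRK ler_ln ?posrE ?expR_gt0 // (lt_le_trans _ h) ?expR_gt0.
Unshelve. all: by end_near. Qed.

(** With y = sqrt x >= 2 a and ln y <= y, a ln x = 2 a ln y <= y^2. *)
Lemma scaled_ln_le (R : realType) (a x : R) : 0 < a -> 4 * a ^+ 2 <= x -> a * ln x <= x.
Proof.
move=> a0 ax; have x0 : 0 < x by apply: lt_le_trans ax; rewrite mulr_gt0 // exprn_gt0.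
set y := Num.sqrt x; have y0 : 0 < y by rewrite sqrtr_gt0.
have xy : x = y ^+ 2 by rewrite sqr_sqrtr // ltW.
have y2 : 2 * a <= y.
  rewrite -(@ler_pXn2r _ 2) ?nnegrE ?(ltW y0) ?mulr_ge0 ?(ltW a0) // -xy.
  by apply: le_trans ax; rewrite exprMn -natrX.
have lny : ln y <= y.
  have h : -1 < y - 1 by rewrite -subr_gt0 opprK subrK.
  have := le_ln1Dx h; rewrite addrC subrK => /le_trans; apply.
  by rewrite gerBl.
have h : 2 * a * ln y <= y * y.
  apply: le_trans (_ : 2 * a * y <= _); first by rewrite ler_wpM2l // mulr_ge0 // ltW.
  by rewrite ler_wpM2r // ltW.
by rewrite {1}xy lnXn // -[_ *+ 2]mulr_natl mulrCA mulrA xy expr2.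
Qed.

Section rates.
Context (R : realType) (eps : nat -> R) (eta : R).
Hypotheses (eta_gt0 : 0 < eta) (eps_lb : forall n, (1 <= n)%N ->
   n%:R `^ (- 2^-1) * ln n%:R `^ (2^-1 + eta) <= eps n).

(** n eps_n^2 is at least ln(n)^(1 + 2 eta), whose exponent exceeds 1, so it beats every multiple of
    ln n. *)
Lemma rate_dominates_ln (L : R) : \forall n \near \oo, L * (1 + ln n%:R) <= n%:R * eps n ^+ 2.
Proof.
pose M := Num.max 1 L.
have M1 : 1 <= M by rewrite le_max lexx.
have M0 : 0 < M by exact: lt_le_trans M1.
near=> n.
have n1 : (1 <= n)%N by near: n; exact: nbhs_infty_ge.
have n0 : 0 < (n%:R : R) by rewrite ltr0n.
have l1 : 1 <= ln (n%:R : R) by near: n; exact: ln_nat_large.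
have l2 : (2 * M) `^ (2 * eta)^-1 <= ln (n%:R : R) by near: n; exact: ln_nat_large.
have l0 : 0 < ln (n%:R : R) by exact: lt_le_trans l1.
have big : 2 * M <= ln n%:R `^ (2 * eta).
  have -> : 2 * M = ((2 * M) `^ (2 * eta)^-1) `^ (2 * eta).
    by rewrite -powRrM mulVf ?powRr1 ?mulr_ge0 ?(ltW M0) // mulf_neq0 // gt_eqF.
  by apply: ge0_ler_powR; rewrite ?nnegrE ?powR_ge0 ?(ltW l0) // mulr_ge0 // ltW.
set x := n%:R `^ (- 2^-1) * ln n%:R `^ (2^-1 + eta).
have x0 : 0 <= x by rewrite mulr_ge0 // powR_ge0.
have xe : x ^+ 2 <= eps n ^+ 2.
  by rewrite lerXn2r ?nnegrE // ?eps_lb // (le_trans x0) // eps_lb.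
apply: (@le_trans _ _ (n%:R * x ^+ 2)); last by rewrite ler_pM2l.
have -> : n%:R * x ^+ 2 = ln n%:R * ln n%:R `^ (2 * eta).
  rewrite /x exprMn -!powR_mulrn ?powR_ge0 // -!powRrM mulNr mulVf // mulrDl mulVf //.
  rewrite powRN powRr1 ?(ltW n0) // mulrA divff ?gt_eqF // mul1r (mulrC eta).
  by rewrite powRD ?(gt_eqF l0) ?implybT // powRr1 // ltW.
apply: (@le_trans _ _ (ln n%:R * (2 * M))); last by rewrite ler_pM2l.
apply: (@le_trans _ _ (M * (1 + ln n%:R))).
  by rewrite ler_wpM2r ?addr_ge0 ?(ltW l0) // le_max lexx orbT.
rewrite mulrA [_ * M]mulrC ler_pM2l //.
by move: l1; set l := ln _; lra.
Unshelve. all: by end_near. Qed.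

(** For n >= S_j this bounds the lengths j + n of the words w ++ u by 2 n, so that bounds polynomial
    in the length are polynomial in n. The exponential form comes down to ln(j)^(1 + eta) <= j. *)
Lemma scale_sequence_ge (S : nat -> nat) :
  (forall j, S j =
     Num.truncn (expR ((j%:R * ln j%:R `^ eta) `^ (1 + 2 * eta)^-1))) \/
  (exists2 eta', 0 < eta' & forall j, S j = Num.truncn (j%:R * ln (j%:R : R) `^ eta')) ->
  \forall j \near \oo, (j <= S j)%N.
Proof.
have a0 : 0 < 1 + eta by rewrite addr_gt0.
case=> [SE|[eta' e0 SE]]; near=> j; rewrite SE truncn_ge_nat //.
- have n1 : (1 <= j)%N by near: j; exact: nbhs_infty_ge.
  have n0 : 0 < (j%:R : R) by rewrite ltr0n.
  have l1 : 4 * (1 + eta) ^+ 2 <= ln (j%:R : R) by near: j; exact: ln_nat_large.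
  have l0 : 0 < ln (j%:R : R) by apply: lt_le_trans l1; rewrite mulr_gt0 // exprn_gt0.
  rewrite -[leLHS]lnK ?posrE // ler_expR.
  have e2 : 0 < 1 + 2 * eta by rewrite addr_gt0 // mulr_gt0.
  rewrite [leLHS](_ : _ = (ln j%:R `^ (1 + 2 * eta)) `^ (1 + 2 * eta)^-1); last first.
    by rewrite -powRrM divff ?gt_eqF // powRr1 // ltW.
  apply: ge0_ler_powR; rewrite ?nnegrE ?powR_ge0 ?invr_ge0 ?(ltW e2) //.
    by rewrite mulr_ge0 // powR_ge0.
  rewrite (_ : 1 + 2 * eta = (1 + eta) + eta); last by ring.
  rewrite powRD ?(gt_eqF l0) ?implybT // ler_wpM2r ?powR_ge0 //.
  rewrite /powR gt_eqF // -[leRHS]lnK ?posrE // ler_expR.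
  exact: scaled_ln_le.
- have l1 : 1 <= ln (j%:R : R) by near: j; exact: ln_nat_large.
  have p1 : 1 `^ eta' = 1 :> R by rewrite powR1.
  rewrite ler_peMr // -[leLHS]p1 ge0_ler_powR ?nnegrE ?(ltW e0) //.
  exact: le_trans l1.
- by rewrite mulr_ge0 // powR_ge0.
Unshelve. all: by end_near. Qed.

End rates.

Lemma mass_poly_bound_expR (R : realType) (b g n m : nat) :
  (1 < b)%N -> (0 < n)%N -> (0 < m)%N -> (m <= 2 * n)%N ->
  mass_poly_bound R b g m <= expR (ln 2 + (4 * g)%:R * (ln (b * 2)%:R + ln n%:R)).
Proof.
move=> b1 n0 m0 mn.
have h0 : 0 < (b * m)%:R :> R by rewrite ltr0n muln_gt0 m0 ltnW.
have b20 : 0 < (b * 2)%:R :> R by rewrite ltr0n muln_gt0 ltnW.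
have nR : 0 < n%:R :> R by rewrite ltr0n.
rewrite /mass_poly_bound expRD lnK ?posrE // ler_pM2l // -lnM ?posrE // expRM_natl.
rewrite lnK ?posrE ?mulr_gt0 // lerXn2r ?nnegrE ?(ltW h0) ?mulr_ge0 ?(ltW b20) ?(ltW nR) //.
by rewrite -natrM ler_nat -mulnA leq_mul2l mn orbT.
Qed.

Lemma geometric_times_poly (R : realType) (b g m : nat) (theta e : R) :
  (1 < b)%N -> 0 < theta < 1 -> 0 < e ->
  \forall n \near \oo, theta ^+ n * mass_poly_bound R b g (m + n) <= e.
Proof.
move=> b1 /andP[t0 t1] e0.
have ltn : ln theta < 0 by rewrite -ln1 ltr_ln ?posrE.
set c := - ln theta; have c0 : 0 < c by rewrite oppr_gt0.
(* With this slope, a ln n <= n lets half of the decay rate c absorb the power 4 g of n. *)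
pose a := (4 * g)%:R / (c / 2) + 1.
have c2 : 0 < c / 2 by rewrite divr_gt0.
have a0 : 0 < a by rewrite ltr_wpDl // divr_ge0 // ltW.
near=> n.
have n0 : (0 < n)%N by near: n; exact: nbhs_infty_ge.
have nm : (m <= n)%N by near: n; exact: nbhs_infty_ge.
have n1 : 4 * a ^+ 2 <= (n%:R : R) by near: n; exact: nbhs_infty_ger.
have n2 : (ln 2 + (4 * g)%:R * ln (b * 2)%:R - ln e) / (c / 2) <= (n%:R : R).
  by near: n; exact: nbhs_infty_ger.
have mn : (m + n <= 2 * n)%N by rewrite mul2n -addnn leq_add2r.
have := @mass_poly_bound_expR R b g n (m + n) b1 n0 (ltn_addl _ n0) mn => pb.
apply: le_trans (ler_wpM2l _ pb) _; first by rewrite exprn_ge0 // ltW.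
have -> : theta ^+ n = expR (n%:R * - c).
  by rewrite expRM_natl /c opprK lnK.
rewrite -expRD -[leRHS]lnK ?posrE // ler_expR.
have h1 := scaled_ln_le a0 n1.
rewrite ler_pdivrMr // in n2.
have ln0 : 0 <= ln n%:R :> R by rewrite ln_ge0 // ler1n.
have h2 : (4 * g)%:R * ln n%:R <= n%:R * (c / 2).
  have -> : (4 * g)%:R = (a - 1) * (c / 2) :> R by rewrite /a addrK divfK // gt_eqF.
  rewrite mulrAC ler_pM2r //; move: ln0 h1; set l := ln _; lra.
move: n2 h2; rewrite mulrDr.
set u := (4 * g)%:R * ln (b * 2)%:R; set v := (4 * g)%:R * ln _; lra.
Unshelve. all: by end_near. Qed.

(* For y = W this is b^tau(q) W^q, and for q = 1 it is y itself as tau(1) = 0. *)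
Definition tilted (R : realType) (b : nat) (tau : R -> R) (y : seq 'I_b -> 'I_b -> R)
  (q : R) (w : seq 'I_b) (i : 'I_b) : R := expR (tau q * ln b%:R + q * ln (y w i)).

Lemma cw_gt0 (R : realType) (b : nat) (y : seq 'I_b -> 'I_b -> R) v u :
  (forall w i, 0 < y w i) -> 0 < cw y v u.
Proof. by move=> y0; elim: u v => [|i u IH] v //=; rewrite mulr_gt0. Qed.

Lemma cw_tilted (R : realType) (b : nat) (tau : R -> R) (y : seq 'I_b -> 'I_b -> R) q v u :
  (forall w i, 0 < y w i) ->
  cw (tilted tau y q) v u = expR ((size u)%:R * ln b%:R * tau q + q * ln (cw y v u)).
Proof.
move=> y0; elim: u v => [|i u IH] v /=.
  by rewrite ln1 mulr0 !mul0r addr0 expR0.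
rewrite IH /tilted -expRD lnM ?posrE ?cw_gt0 // -natr1; congr expR; ring.
Qed.

(** * Limit masses and counting for a single realization *)

Section realization.
Context (R : realType) (b : nat).
Hypothesis hb : (1 < b)%N.
Variables (tau a : R -> R) (y : seq 'I_b -> 'I_b -> R) (B g : nat) (theta kappa M Bk C : R).
Let V := tilted tau y.
Hypotheses (tau1 : tau 1 = 0) (y_gt0 : forall w i, 0 < y w i)
  (g_gt0 : (0 < g)%N) (theta_lt1 : theta < 1) (btheta : b%:R^-1 <= theta) (kappa0 : 0 <= kappa)
  (V_bounds : forall q w i, `|q| <= B%:R -> b%:R^-1 ^+ g <= V q w i <= theta)
  (V_lip : forall q q' w i, `|q| <= B%:R -> `|q'| <= B%:R ->
     V q' w i <= expR (kappa * `|q - q'|) * V q w i)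
  (grid_M : forall L (u : L.-tuple 'I_b) l c i (sg : bool),
     (l <= c)%N -> (c <= L)%N -> (i < grid_size b B L)%N ->
   expR ((-1) ^+ sg * (2 * b%:R * Num.sqrt (grid_scale b theta l c (L - l)))^-1 *
     rel_incr (uniform_below c (V (grid R b B L i))) (take l u) (L - l)) <= M * b%:R ^+ (5 * L))
  (BkB : Bk + 1 <= B%:R) (Bk0 : 0 <= Bk) (C0 : 0 < C)
  (quad : forall q h, `|q| <= Bk -> `|h| <= 1 -> tau q - tau (q + h) + h * a q <= C * h ^+ 2).

Let lnb0 : 0 < ln (b%:R : R). Proof. by rewrite ln_gt0 // ltr1n. Qed.
Let V_gt0 q w i : 0 < V q w i. Proof. exact: expR_gt0. Qed.
Let theta0 : 0 < theta.
Proof. by apply: lt_le_trans btheta; rewrite invr_gt0 ltr0n ltnW. Qed.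
Let B1 : 1 <= (B%:R : R). Proof. by apply: le_trans BkB; rewrite lerDr. Qed.

Let V1E : V 1 = y.
Proof.
apply/funext => w; apply/funext => i.
by rewrite /V /tilted tau1 mul0r add0r mul1r lnK // posrE.
Qed.

Definition limit_mass q v := limn (Ym (V q) v).
Local Notation Y := limit_mass.

Let cvg_mass q v : `|q| <= B%:R -> Ym (V q) v n @[n --> \oo] --> Y q v.
Proof.
have Vp q' w i : `|q'| <= B%:R -> 0 < V q' w i <= theta.
  by move=> qB'; have /andP[_ h] := V_bounds w i qB'; rewrite V_gt0.
have [H H0 HV] := increments_off_grid hb theta_lt1 btheta kappa0 Vp V_lip grid_M.
exact: (cvgn_mass hb theta_lt1 btheta V_bounds H0 HV).
Qed.

Let mass_bounds : exists l0, forall l, (l0 <= l)%N -> forall q v, `|q| <= B%:R -> size v = l ->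
  (forall n, Ym (V q) v n <= mass_poly_bound R b g l) /\
  (mass_poly_bound R b g l)^-1 <= Y q v <= mass_poly_bound R b g l.
Proof.
have Vp q' w i : `|q'| <= B%:R -> 0 < V q' w i <= theta.
  by move=> qB'; have /andP[_ h] := V_bounds w i qB'; rewrite V_gt0.
have [H H0 HV] := increments_off_grid hb theta_lt1 btheta kappa0 Vp V_lip grid_M.
have [l0 hl0] := masses_polynomial hb theta_lt1 btheta g_gt0 V_bounds H0 HV.
exists l0 => l l0l q v qB vl; have [up dn] := hl0 l l0l q v qB vl.
have cv : cvgn (Ym (V q) v) by apply: (cvgP (Y q v)); exact: (@cvg_mass q v qB).
split => //; apply/andP; split; first exact: limr_ge.
by apply: limr_le => //; exact: nearW.
Qed.

Lemma limit_mass_ge0 q v : `|q| <= B%:R -> 0 <= Y q v.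
Proof.
move=> qB; apply: limr_ge; first by apply: (cvgP (Y q v)); exact: (@cvg_mass q v qB).
by apply: nearW => n; apply: Ym_ge0 => w i; exact: ltW.
Qed.

Let limit_mass_split q v n : `|q| <= B%:R ->
  Y q v = \sum_(u : n.-tuple 'I_b) cw (V q) v u * Y q (v ++ u).
Proof.
move=> qB; apply: cvg_lim => //.
rewrite -(cvg_shiftn n) /=.
under eq_fun do rewrite addnC Ym_add.
apply: cvg_sumr => u; apply: cvgMr.
exact: cvg_mass.
Qed.

(** The smallness required of the cells holds because the weight theta^n of a word of length n beats
    the polynomial bound on the mass below it. *)
Lemma cascade_measure_limit_mass q v : `|q| <= B%:R ->
  cascade_measure hb (V q) v [set: R] = (Y q v)%:E /\
  forall u, cascade_measure hb (V q) v (badic_itv u : set R) =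
    (cw (V q) v u * Y q (v ++ u))%:E.
Proof.
move=> qB; apply: cascade_measureE.
- by move=> w i; exact: ltW.
- by move=> w; exact: cvg_mass.
- move=> e e0; have [l0 hl0] := mass_bounds.
  have th : 0 < theta < 1 by rewrite theta0.
  near \oo => n; exists n => u.
  have ln : (l0 <= size v + n)%N by apply: leq_trans (leq_addl _ _); near: n; exact: nbhs_infty_ge.
  have sz : size (v ++ u) = (size v + n)%N by rewrite size_cat size_tuple.
  have [_ /andP[_ Yu]] := hl0 _ ln q _ qB sz.
  have h : theta ^+ n * mass_poly_bound R b g (size v + n) <= e.
    by near: n; exact: geometric_times_poly.
  apply: le_trans h; apply: le_trans (ler_wpM2l _ Yu) _.
    by apply/ltW; exact: cw_gt0.
  rewrite ler_wpM2r //; first by rewrite /mass_poly_bound mulr_ge0 // exprn_ge0.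
  rewrite -[X in _ ^+ X](size_tuple u); apply: cw_le => w i.
  by have /andP[_ h] := V_bounds w i qB; rewrite ltW //=.
Unshelve. all: by end_near. Qed.

(** The words w and w ++ u have lengths between j and 2 n, so all the masses met lie between e^-p
    and e^p with p of order ln n, which n eps_n^2 dominates. The margin 1 in [BkB] leaves room for q
    +- h and for the parameter 1, whose cascade is mu itself. *)
Lemma counting_near (eps : nat -> R) (eta : R) (S : nat -> nat) :
  0 < eta -> (forall n, (1 <= n)%N -> 0 < eps n) -> eps n @[n --> \oo] --> 0 ->
  (forall n, (1 <= n)%N -> n%:R `^ (- 2^-1) * ln n%:R `^ (2^-1 + eta) <= eps n) ->
  (\forall j \near \oo, (j <= S j)%N) ->
  \forall j \near \oo, forall (q : R) (w : j.-tuple 'I_b) (n : nat),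
    `|q| <= Bk -> (S j <= n)%N ->
    let e := a q * q - tau q in
    Y q w * b%:R `^ (n%:R * (e - (1 + `|q|) * eps n)) <=
      (counting_N b n (cascade_measure hb y w) (a q) (eps n))%:R <=
    Y q w * b%:R `^ (n%:R * (e + (1 + `|q|) * eps n)).
Proof.
move=> eta0 eps0 eps_cvg eps_lb Sj.
have [l0 hl0] := mass_bounds.
pose c0 : R := ln 2 + (4 * g)%:R * (ln (b * 2)%:R + 1).
have ln20 : 0 < ln 2 :> R by rewrite ln_gt0 // ltr1n.
have ln40 : 0 < ln 4 :> R by rewrite ln_gt0 // ltr1n.
have lnb2 : 0 <= ln (b * 2)%:R :> R by rewrite ln_ge0 // ler1n muln_gt0 ltnW.
have c00 : 0 <= c0 by rewrite addr_ge0 ?(ltW ln20) // mulr_ge0 // addr_ge0.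
(* The sum of the constants in the three smallness conditions of [counting_bounds], p being at most
   c0 (1 + ln n); the division by ln b compensates E = n ln b. *)
pose L := (16 * C * (ln 4 + 3 * c0) + (Bk + 1) * c0 + ln 2 + 2 * c0) / ln b%:R.
(* [eps n <= 1] makes lower bounds on E eps^2 valid for E eps, and [eps n <= 4 * C] makes the shift
   h at most 1, as [quad] requires. *)
have [N _ HN] : \forall n \near \oo,
    [/\ (0 < n)%N, L * (1 + ln n%:R) <= n%:R * eps n ^+ 2, eps n <= 1 & eps n <= 4 * C].
  near=> n; split; near: n.
  - exact: nbhs_infty_ge.
  - exact: rate_dominates_ln eta0 eps_lb L.
  - by apply: cvgr_le eps_cvg _ _.
  - by apply: cvgr_le eps_cvg _ _; rewrite mulr_gt0.
near=> j; move=> q w n qK Sn; pose e := a q * q - tau q; rewrite -!/e.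
have j0 : (0 < j)%N by near: j; exact: nbhs_infty_ge.
have lj : (l0 <= j)%N by near: j; exact: nbhs_infty_ge.
have Nj : (N <= j)%N by near: j; exact: nbhs_infty_ge.
have jn : (j <= n)%N by apply: leq_trans Sn; near: j.
have [n0 rate e1 e4C] := HN n (leq_trans Nj jn).
have en0 := eps0 n n0.
have qB : `|q| <= B%:R by apply: le_trans qK (le_trans _ BkB); rewrite lerDl.
have one : `|1| <= (B%:R : R) by rewrite normr1.
pose p := ln 2 + (4 * g)%:R * (ln (b * 2)%:R + ln n%:R : R).
have lnn0 : 0 <= ln n%:R :> R by rewrite ln_ge0 // ler1n.
have pb m : (0 < m)%N -> (m <= 2 * n)%N -> mass_poly_bound R b g m <= expR p.
  exact: mass_poly_bound_expR.
have pbV m : (0 < m)%N -> (m <= 2 * n)%N -> expR (- p) <= (mass_poly_bound R b g m)^-1.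
  move=> m0 mn; rewrite expRN lef_pV2 ?posrE ?expR_gt0 ?pb //.
  by rewrite mulr_gt0 // exprn_gt0 // ltr0n muln_gt0 m0 ltnW.
have Ybounds q' v : `|q'| <= B%:R -> (j <= size v <= 2 * n)%N ->
    expR (- p) <= Y q' v <= expR p.
  move=> q'B /andP[jv vn]; have v0 := leq_trans j0 jv.
  have [_ /andP[h1 h2]] := hl0 _ (leq_trans lj jv) q' v q'B erefl.
  by rewrite (le_trans (pbV _ v0 vn) h1) (le_trans h2 (pb _ v0 vn)).
have pc : p <= c0 * (1 + ln n%:R).
  rewrite /p /c0; have h1 : 0 <= ln 2 * ln n%:R :> R by rewrite mulr_ge0 // ltW.
  have h2 : 0 <= (4 * g)%:R * (ln (b * 2)%:R * ln n%:R) :> R by rewrite !mulr_ge0.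
  have h3 : 0 <= (4 * g)%:R :> R by [].
  move: h1 h2 h3; set x1 := ln 2; set x2 := ln n%:R; set x3 := ln _; set x4 := (4 * g)%:R; lra.
set E := n%:R * ln (b%:R : R).
have E0 : 0 <= E by rewrite mulr_ge0 // ltW.
have rateE : (16 * C * (ln 4 + 3 * c0) + (Bk + 1) * c0 + ln 2 + 2 * c0) * (1 + ln n%:R) <=
    E * eps n ^+ 2.
  move: rate; rewrite -(ler_pM2r lnb0) /L mulrAC divfK ?gt_eqF // => /le_trans; apply.
  by rewrite /E mulrAC.
have l1 : 0 <= 1 + ln n%:R :> R by rewrite addr_ge0.
have t1 : 0 <= 16 * C * (ln 4 + 3 * c0) * (1 + ln n%:R).
  by rewrite !mulr_ge0 // ?(ltW C0) // addr_ge0 ?mulr_ge0 // ltW.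
have t2 : 0 <= (Bk + 1) * c0 * (1 + ln n%:R) by rewrite !mulr_ge0 // addr_ge0.
have t3 : 0 <= ln 2 * (1 + ln n%:R) :> R by rewrite mulr_ge0 // ltW.
have t4 : 0 <= c0 * (1 + ln n%:R) :> R by apply: mulr_ge0.
have E2 : E * eps n ^+ 2 <= E * eps n.
  by rewrite ler_wpM2l // expr2 ler_piMl // ltW.
have Bk1 : `|q| + 1 <= Bk + 1 by rewrite lerD2r.
have h0 : 0 < eps n / (4 * C) by rewrite divr_gt0 // mulr_gt0.
have hle1 : eps n / (4 * C) <= 1 by rewrite ler_pdivrMr ?mulr_gt0 // mul1r.
have wn (u : n.-tuple 'I_b) : (j <= size (w ++ u) <= 2 * n)%N.
  by rewrite size_cat !size_tuple leq_addr mul2n -addnn leq_add2r.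
have := @counting_bounds R (n.-tuple 'I_b) (fun u => ln (cw y w u))
  (fun u => Y 1 (w ++ u)) (fun u => Y q (w ++ u)) tau E q (a q) e (eps n) C p (Y q w) C0 E0 en0.
have bE x : b%:R `^ (n%:R * x) = expR (E * x).
  by rewrite /powR gt_eqF ?ltr0n ?(ltnW hb) // mulrAC.
have -> : #|[pred u : n.-tuple 'I_b |
     expR (- (E * (a q + eps n))) <= expR (ln (cw y w u)) * Y 1 (w ++ u) &
     expR (ln (cw y w u)) * Y 1 (w ++ u) <= expR (- (E * (a q - eps n)))]| =
   counting_N b n (cascade_measure hb y w) (a q) (eps n).
  apply: eq_card => u; rewrite !inE.
  have [_] := cascade_measure_limit_mass w one; rewrite V1E => ->.
  by rewrite !lee_fin -!mulrN !bE lnK // posrE cw_gt0.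
rewrite !bE; apply => //.
- move=> r rh; have qrB : `|q + r| <= B%:R.
    by apply: le_trans (ler_normD _ _) (le_trans _ BkB); rewrite rh lerD.
  have [h _] := hl0 j lj (q + r) w qrB (size_tuple w).
  apply: le_trans (le_trans (h n) (pb _ j0 _)); last by rewrite (leq_trans jn) // leq_pmull.
  by rewrite /Ym; apply: ler_sum => u _; rewrite cw_tilted // size_tuple.
- by move=> r rh; apply: quad => //; rewrite rh.
- by move=> u; exact: Ybounds.
- by move=> u; exact: Ybounds.
- have wj : (j <= size w <= 2 * n)%N.
    by rewrite size_tuple leqnn (leq_trans jn) // leq_pmull.
  by have /andP[] := Ybounds q w qB wj.
- rewrite (limit_mass_split _ n qB); apply: eq_bigr => u _.
  by rewrite cw_tilted // size_tuple.
- have h : (`|q| + 1) * p <= (Bk + 1) * (c0 * (1 + ln n%:R)).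
    by apply: ler_pM => //; rewrite /p addr_ge0 ?(ltW ln20) // mulr_ge0 // addr_ge0.
  apply: le_trans E2; apply: le_trans rateE.
  have : ln 2 <= ln 2 * (1 + ln n%:R) :> R by rewrite ler_peMr ?(ltW ln20) // lerDl.
  move: h t1 t2 t3 t4; set X := ln n%:R; set Y2 := ln 2; set Y4 := ln 4; lra.
- apply: le_trans E2; apply: le_trans rateE.
  move: pc t1 t2 t3 t4; set X := ln n%:R; set Y2 := ln 2; set Y4 := ln 4; lra.
- rewrite ler_pdivlMr ?mulr_gt0 //; apply: le_trans rateE.
  have h : ln 4 + 3 * p <= (ln 4 + 3 * c0) * (1 + ln n%:R).
    have : 0 <= ln 4 * ln n%:R :> R by rewrite mulr_ge0 // ltW.
    by move: pc; set X := ln n%:R; set Y4 := ln 4; lra.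
  have C16 : 0 <= 16 * C by rewrite mulr_ge0 // ltW.
  have := ler_wpM2l C16 h.
  move: t1 t2 t3 t4; set X := ln n%:R; set Y2 := ln 2; set Y4 := ln 4; lra.
Unshelve. all: by end_near. Qed.

End realization.

(** * From the generic vector to the whole tree *)

Lemma ae_same_law d d' (T : measurableType d) (T' : measurableType d') (R : realType)
    (P : probability T R) (X Y : {RV P >-> T'}) (D : set T') :
  measurable D -> same_law X Y ->
  {ae P, forall x, D (Y x)} -> {ae P, forall x, D (X x)}.
Proof.
move=> mD XY.
have mp (Z : {RV P >-> T'}) : measurable (~` (Z @^-1` D)).
  by apply: measurableC; rewrite -[X in measurable X]setTI; exact: measurable_funP.
move=> /(negligibleP P (mp Y)) Y0; apply/(negligibleP P (mp X)).
by rewrite -Y0; exact: (XY _ (measurableC mD)).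
Qed.

Lemma ge0_integral_same_law d d' (T : measurableType d) (T' : measurableType d') (R : realType)
    (P : probability T R) (X Y : {RV P >-> T'}) (f : T' -> R) :
  measurable_fun setT f -> (forall y, 0 <= f y) -> same_law X Y ->
  (\int[P]_x (f (X x))%:E = \int[P]_x (f (Y x))%:E)%E.
Proof.
move=> mf f0 XY.
have key (Z : {RV P >-> T'}) : (\int[P]_x (f (Z x))%:E = \int[distribution P Z]_t (f t)%:E)%E.
  by rewrite ge0_integral_distribution //; exact/measurable_EFinP.
rewrite (key X) (key Y); apply: eq_measure_integral => D mD _; exact: XY.
Qed.

Lemma measurable_tuple_box (R : realType) (n : nat) (lo hi : R) :
  measurable [set t : n.-tuple R | forall i, lo <= tnth t i <= hi].
Proof.
rewrite (_ : mkset _ = \bigcap_(i in [set: 'I_n]) ((fun t : n.-tuple R => tnth t i) @^-1` `[lo, hi])).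
  apply: fin_bigcap_measurable => [|i _]; first exact: finite_finset.
  by rewrite -[X in measurable X]setTI; apply: measurable_tnth.
apply/seteqP; split => t /= h i; first by move=> _; rewrite /= in_itv /= h.
by have := h i I; rewrite /= in_itv.
Qed.

Lemma ae_forall_count d (T : measurableType d) (R : realType) (P : probability T R)
    (I : countType) (Q : I -> T -> Prop) :
  (forall i, {ae P, forall x, Q i x}) -> {ae P, forall x, forall i, Q i x}.
Proof.
move=> aeQ.
have : {ae P, forall x, forall n, if unpickle n is Some i then Q i x else True}.
  apply: ae_foralln => n; case: (unpickle n) => [i|]; first exact: aeQ.
  exact: aeW.
by apply: filterS => x h i; have := h (pickle i); rewrite pickleK.
Qed.

Theorem theorem4 (d : measure_display) (T : measurableType d) (R : realType)
    (P : probability T R) (b : nat) (hb : (1 < b)%N)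
    (W0 : {RV P >-> b.-tuple R}) (W : seq 'I_b -> {RV P >-> b.-tuple R})
    (W0_gt0 : {ae P, forall x, forall i : 'I_b, 0 < tnth (W0 x) i})
    (W0_mean : (\sum_(k < b) 'E_P[fun x => tnth (W0 x) k] = 1)%E)
    (W_law : forall w, same_law (W w) W0)
    (W_indep : mutually_independent W)
    (eps : nat -> R)
    (eps_gt0 : forall n, (1 <= n)%N -> 0 < eps n)
    (eps_cvg0 : eps n @[n --> \oo] --> 0)
    (eps_series : forall alpha : R, 0 < alpha ->
       cvgn (fun N => \sum_(1 <= n < N)
                        n%:R * b%:R `^ (- (n%:R * alpha * eps n ^+ 2))))
    (eta : R) (eta_gt0 : 0 < eta)
    (eps_lb : forall n, (1 <= n)%N ->
       n%:R `^ (- 2^-1) * ln n%:R `^ (2^-1 + eta) <= eps n)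
    (J_full : J_set W0 = [set: R])
    (W0_bounded : exists2 A : R, 1 < A &
       {ae P, forall x, forall i : 'I_b, A^-1 <= tnth (W0 x) i <= A})
    (S : nat -> nat)
    (S_def :
       (forall j, S j =
          Num.truncn (expR ((j%:R * ln j%:R `^ eta) `^ (1 + 2 * eta)^-1)))
       \/
       exists eta1 eta' : R,
         [/\ 0 < eta1,
             forall n, (2 <= n)%N -> ln n%:R `^ (- eta1) <= eps n,
             2 * eta1 < eta' &
             forall j, S j = Num.truncn (j%:R * ln j%:R `^ eta')])
    (K : set R) (K_compact : compact K) (K_itv : is_interval K)
    (beta : R) (beta_def : beta = 1 + sup [set `|q| | q in K]) :
  {ae P, forall x, \forall j \near \oo,
     forall (q : R) (w : j.-tuple 'I_b) (n : nat), K q -> (S j <= n)%N ->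
       let Y := Y_mass hb W0 W q x w in
       let N := counting_N b n (mu_cascade hb W x w) (dtau W0 q) (eps n) in
       let e := dtau W0 q * q - tau W0 q in
       Y * b%:R `^ (n%:R * (e - beta * eps n)) <= N%:R
         <= Y * b%:R `^ (n%:R * (e + beta * eps n))}.
Proof.
have [A A1 W0A] := W0_bounded.
have Jq q : 0 < dtau W0 q * q - tau W0 q.
  have : J_set W0 q by rewrite J_full.
  by move/interior_subset => [].
set supK := sup _ in beta_def.
have Kub : has_ubound [set `|q| | q in K].
  have [M0 [_ hM]] := compact_bounded K_compact.
  exists (M0 + 1) => _ [q Kq <-]; apply: hM => //; by rewrite ltrDl.
have KB q : K q -> `|q| <= supK.
  by move=> Kq; apply: (ub_le_sup Kub); exists q.
(* The maximum with 0 gives a nonnegative bound without deciding whether K is empty. *)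
pose Bk := Num.max 0 supK.
have Bk0 : 0 <= Bk by rewrite le_max lexx.
have KBk q : K q -> `|q| <= Bk by move=> Kq; rewrite le_max KB ?orbT.
pose B := (Num.truncn (Bk + 1)).+1.
have BkB : Bk + 1 <= B%:R.
  by have /andP[_ /ltW] := @truncn_itv _ (Bk + 1) (addr_ge0 Bk0 ler01).
have [lo [hi [theta [g [lohi aebox th1 bth [g0 box]]]]]] :=
  weights_in_box hb A1 W0A Jq (ltn0Sn _ : (0 < B)%N).
have lo0 : 0 < lo by case/andP: lohi.
have lehi : lo <= hi by case/andP: lohi.
have [C C0 quad] := tau_quadratic hb A1 W0A Bk.
(* The estimates on increments need weights bounded at every sample point; clipped weights are, and
   almost surely they are the original ones at all nodes. *)
pose clip z := Num.max lo (Num.min hi z).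
have clip_box z : lo <= clip z <= hi.
  by rewrite le_max lexx /= ge_max lehi ge_min lexx.
pose phi q (t : b.-tuple R) i := expR (tau W0 q * ln b%:R + q * ln (clip (tnth t i))).
have mphi q i : measurable_fun setT (phi q ^~ i).
  apply: measurableT_comp => //; apply: measurable_funD => //.
  apply: measurable_funM => //; apply: measurableT_comp => //.
  apply: (measurable_maxr (measurable_cst _)).
  apply: (measurable_minr (measurable_cst _)).
  exact: measurable_tnth.
have phi_bounds q t i : `|q| <= B%:R -> 0 <= phi q t i <= theta.
  by move=> qB; rewrite expR_ge0; have [_ _ ->] := box q _ qB (clip_box (tnth t i)).
have Ephi q w : `|q| <= B%:R -> (\int[P]_x (\sum_(i < b) phi q (W w x) i)%:E = 1)%E.
  move=> qB; rewrite -[RHS](integral_normalized_weights hb A1 W0A q aebox).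
  apply: (@ge0_integral_same_law _ _ _ _ _ P (W w) W0 (fun t => \sum_(i < b) phi q t i)).
  - exact: measurable_sum.
  - by move=> t; apply: sumr_ge0 => i _; exact: expR_ge0.
  - exact: W_law.
have aegrid := ae_grid_bound W_indep hb mphi th1 bth phi_bounds Ephi.
have aeW : {ae P, forall x, forall w i, lo <= tnth (W w x) i <= hi}.
  apply: ae_forall_count => w.
  exact: (ae_same_law (@measurable_tuple_box R b lo hi) (W_law w)).
have Sj : \forall j \near \oo, (j <= S j)%N.
  apply: (@scale_sequence_ge R eta eta_gt0); case: S_def => [|[eta1 [eta' [e1 _ e2 SE]]]].
    by left.
  by right; exists eta' => //; apply: lt_trans e2; rewrite mulr_gt0.
(* One ln A for the Lipschitz constant of tau(q) ln b, one for that of q ln y. *)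
pose kappa := 2 * ln A.
have lA0 : 0 < ln A by rewrite ln_gt0.
(* Neither of these two almost sure events mentions q, w or n, so the conclusion holds for all of
   them off one null set. *)
move: aegrid aeW; apply: filterS2 => x [M grid_M] inbox.
pose y w i := clip (tnth (W w x) i).
have yE w i : y w i = tnth (W w x) i.
  by have /andP[h1 h2] := inbox w i; rewrite /y /clip min_r // max_r.
have y0 w i : 0 < y w i.
  by apply: lt_le_trans lo0 _; have /andP[] := clip_box (tnth (W w x) i).
have V_bounds q w i : `|q| <= B%:R -> b%:R^-1 ^+ g <= tilted (tau W0) y q w i <= theta.
  by move=> qB; have [_ -> ->] := box q _ qB (clip_box (tnth (W w x) i)).
have one : `|1| <= (B%:R : R) by rewrite normr1 ler1n.
have V_lip q q' w i : `|q| <= B%:R -> `|q'| <= B%:R ->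
    tilted (tau W0) y q' w i <= expR (kappa * `|q - q'|) * tilted (tau W0) y q w i.
  move=> qB q'B; have [lnA _ _] := box q _ qB (clip_box (tnth (W w x) i)).
  rewrite /tilted -expRD ler_expR.
  have lip := tau_lipschitz hb A1 W0A q q'.
  have b0 : 0 < ln b%:R :> R by rewrite ln_gt0 // ltr1n.
  have h1 : (tau W0 q' - tau W0 q) * ln b%:R <= ln A * `|q - q'|.
    by apply: le_trans lip; rewrite ler_pM2r // ler_norm.
  have h2 : (q' - q) * ln (y w i) <= ln A * `|q - q'|.
    apply: le_trans (ler_norm _) _; rewrite normrM mulrC (distrC q) ler_wpM2r //.
  by move: h1 h2; rewrite /kappa; set X := ln _; set Z := ln (y w i); lra.
have kappa0 : 0 <= kappa by rewrite mulr_ge0 // ltW.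
have tau1 := tau_at1 hb A1 W0A W0_mean.
have cnear := counting_near hb tau1 y0 g0 th1 bth kappa0 V_bounds V_lip grid_M BkB Bk0 C0 quad
  eta_gt0 eps_gt0 eps_cvg0 eps_lb Sj.
have massE q w : `|q| <= B%:R -> Y_mass hb W0 W q x w = limit_mass (tau W0) y q w.
  move=> qB; have [h _] := cascade_measure_limit_mass hb g0 th1 bth kappa0 V_bounds
    V_lip grid_M w qB.
  rewrite /Y_mass /mu_analyzing.
  have -> : (fun w i => b%:R `^ tau W0 q * tnth (W w x) i `^ q) = tilted (tau W0) y q.
    apply/funext => v; apply/funext => i.
    rewrite -yE /tilted expRD /powR !gt_eqF ?ltr0n ?(ltnW hb) //.
  by rewrite h.
have muE w : mu_cascade hb W x w = cascade_measure hb y w.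
  rewrite /mu_cascade (_ : (fun v i => tnth (W v x) i) = y) //.
  by apply/funext => v; apply/funext => i; rewrite yE.
move: cnear Sj (nbhs_infty_ge 1); apply: filterS3 => j hj Sjj j1 q w n Kq Sn.
have qK := KBk q Kq.
have qB : `|q| <= B%:R by apply: le_trans qK (le_trans _ BkB); rewrite lerDl.
rewrite massE // muE.
have /andP[h1 h2] := hj q w n qK Sn.
have b1 : 1 <= b%:R :> R by rewrite ler1n ltnW.
have Y0 : 0 <= limit_mass (tau W0) y q w.
  exact: (limit_mass_ge0 hb th1 bth kappa0 V_bounds V_lip grid_M w qB).
have n1 : (1 <= n)%N by apply: leq_trans Sn; exact: leq_trans Sjj.
have qbeta : (1 + `|q|) * eps n <= beta * eps n.
  by rewrite (ler_pM2r (eps_gt0 n n1)) beta_def lerD2l KB.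
apply/andP; split.
- apply: le_trans h1; rewrite ler_wpM2l // ler_powR // ler_wpM2l //; lra.
- apply: le_trans h2 _; rewrite ler_wpM2l // ler_powR // ler_wpM2l //; lra.
Qed.
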